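(* Let $\mathfrak{f}$ be a surface in $\mathbb{RP}^3$ with positive definite projective metric, let $g_1:\mathbb{D}\to\mathcal{Q}$ be its first-order Gauss map, and let $\{\alpha^\lambda\}_{\lambda\in\mathbb{S}^1}$ be the associated family of $1$-forms $\alpha^\lambda=U^\lambda dz+V^\lambda d\bar z$. Then the following three properties are mutually equivalent: 1. The surface $\mathfrak{f}$ is a definite Demoulin surface or a projective minimal coincidence surface. 2. The first-order Gauss map $g_1$ is a harmonic map into $\mathcal{Q}$. 3. $\{d+\alpha^\lambda\}_{\lambda\in\mathbb{S}^1}$ is a family of flat connections on $\mathbb{D}\times G$, i.e. $d\alpha^\lambda+\frac12[\alpha^\lambda\wedge\alpha^\lambda]=0$ for all $\lambda\in\mathbb{S}^1$.
   Context: **Surface and canonical system.** Let $\mathfrak{f}:M\to\mathbb{RP}^3$ be an immersed surface and $f$ a local lift to $\mathbb{R}^4\setminus\{0\}$. Write $D$ for the flat connection of $\mathbb{R}^4$, $\zeta$ for the radial vector field, and $\xi$ for a vector field along $f$ transversal to the span of $\zeta$ and $df(TM)$. The Gauss formula $D_X f_*Y=f_*(\nabla_XY)+h(X,Y)\xi+T(X,Y)\zeta$ defines a symmetric form $h$ whose conformal class $[h]$ (up to sign) depends only on $\mathfrak{f}$. It is assumed that $h$ is definite (positive definite after choosing the sign of $\xi$), and $M$ is a Riemann surface with conformal structure $[h]$. Let $\mathbb{D}\subset M$ be a simply connected (connected) domain with complex coordinate $z$. There is a lift $f:\mathbb{D}\to\mathbb{R}^4\setminus\{0\}$, unique up to a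 constant factor, satisfying the canonical system $$f_{zz}=b f_{\bar z}+pf,\qquad f_{\bar z\bar z}=\bar b f_z+\bar p f$$ for smooth complex functions $b,p$. The projective metric of $\mathfrak{f}$ is $8|b|^2dz\,d\bar z$. ''Positive definite projective metric'' means that the symmetric form $h$ defined by the Gauss formula $D_X f_*Y=f_*(\nabla_XY)+h(X,Y)\xi+T(X,Y)\zeta$ is definite (positive definite after choosing the sign of $\xi$) and $b$ vanishes nowhere. All objects below are considered on $\mathbb{D}$. **Invariants and classes of surfaces.** Set $$k=\tfrac12\left(|b|^2-(\log b)_{z\bar z}\right),\qquad P=p+\frac{b_{\bar z}}{2}-\frac{\bar b_{zz}}{2\bar b}+\frac{\bar b_z^2}{4\bar b^2}.$$ The surface is a *definite Demoulin surface* if $P=0$ identically. It is *projective minimal* if it is a critical point of the area functional of the projective metric; equivalently, $\bar bP_z+2\bar b_zP=0$. It is a *coincidence surface* if $(\log(b\bar b^2))_z=0$; equivalently, around each point there is a holomorphic coordinate (with correspondingly rescaled lift) in which the function $b$ of the canonical system is a nonzero constant. (Under a holomorphic change of coordinate $w(z)$, $b$ changes to $\tilde b=(\overline{w_z}/w_z^2)\,b$.) A *projective minimal coincidence surface* is a coincidence surface that is projective minimal. **Wilczynski frame.** Let $$U=\begin{pmatrix}\frac{\bar b_z}{2\bar b}&P&k&b\bar P\\1&-\frac{\bar b_z}{2\bar b}&0&k\\0&b&\frac{\bar b_z}{2\bar b}&P\\0&0&1&-\frac{\bar b_z}{2\bar b}\end{pmatrix},\qquad V=\begin{pmatrix}\frac{b_{\bar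 z}}{2b}&\bar k&\bar P&\bar bP\\0&\frac{b_{\bar z}}{2b}&\bar b&\bar P\\1&0&-\frac{b_{\bar z}}{2b}&\bar k\\0&1&0&-\frac{b_{\bar z}}{2b}\end{pmatrix}.$$ The Wilczynski frame $F=(f,f_1,f_2,\eta)$, where $f_1=f_z-\frac{\bar b_z}{2\bar b}f$, $f_2=f_{\bar z}-\frac{b_{\bar z}}{2b}f$, $\eta=f_{z\bar z}-\frac{\bar b_z}{2\bar b}f_{\bar z}-\frac{b_{\bar z}}{2b}f_z+\left(\frac{|b_{\bar z}|^2}{4|b|^2}-\frac{|b|^2}{2}\right)f$, satisfies $F_z=FU$, $F_{\bar z}=FV$. The compatibility conditions (projective Gauss–Codazzi equations), which hold for every surface, are $\bar P_z=k_{\bar z}+k\,b_{\bar z}/b$ and $\mathrm{Im}(\bar bP_z+2\bar b_zP)=0$. From now on $F$ denotes the solution of $F_z=FU$, $F_{\bar z}=FV$ normalized by $F(z_* )=\mathrm{id}$ at a base point $z_*\in\mathbb{D}$ (this changes the frame by left multiplication by a constant matrix). With $$L=\frac1{\sqrt2}\begin{pmatrix}\sqrt2&0&0&0\\0&\sqrt{-1}&-\sqrt{-1}&0\\0&1&1&0\\0&0&0&\sqrt2\end{pmatrix},$$ the matrix $\hat F=LFL^{-1}$ takes values in $\mathrm{SL}_4\mathbb{R}$. Put $G=L^{-1}\,\mathrm{SL}_4\mathbb{R}\,L\subset\mathrm{SL}_4\mathbb{C}$, with Lie algebra $\mathfrak g$; so $F$ is $G$-valued. **Target space and Gauss map.**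 Let $$\hat J_1=\begin{pmatrix}0&0&0&1\\0&1&0&0\\0&0&1&0\\1&0&0&0\end{pmatrix}=LJ_1L^{\mathrm T},$$ where $J_1$ is the $4\times4$ antidiagonal matrix with all antidiagonal entries $1$. Let $\mathcal{Q}$ be the space of real symmetric $4\times4$ matrices of determinant $-1$ with three positive and one negative eigenvalue (it parametrizes conformal $2$-spheres in $\mathbb{RP}^3$); it is the orbit of $\hat J_1$ under the $\mathrm{SL}_4\mathbb{R}$-action $(g,Q)\mapsto gQg^{\mathrm T}$. It carries the invariant semi-Riemannian metric $\langle X,Y\rangle_Q=\mathrm{Tr}(Q^{-1}XQ^{-1}Y)$, making it a semi-Riemannian symmetric space. The *first-order Gauss map* is $g_1=\hat F\hat J_1\hat F^{\mathrm T}=LFJ_1F^{\mathrm T}L^{\mathrm T}:\mathbb{D}\to\mathcal{Q}$. A smooth map from a Riemann surface to a semi-Riemannian manifold is *harmonic* if its tension field vanishes. **The family $\alpha^\lambda$.** Let $\tau_1(X)=-J_1X^{\mathrm T}J_1$ on $\mathfrak g$ (and on $\mathfrak g^{\mathbb C}=\mathfrak{sl}_4\mathbb{C}$), with $(+1)$-eigenspace $\mathfrak k_1$ and $(-1)$-eigenspace $\mathfrak p_1$. Decompose $U=U_{\mathfrak k_1}+U_{\mathfrak p_1}$, $V=V_{\mathfrak k_1}+V_{\mathfrak p_1}$ along the complexified eigenspaces, and for $\lambda\in\mathbb{S}^1$ set $U^\lambda=U_{\mathfrak k_1}+\lambda^{-1}U_{\mathfrak p_1}$, $V^\lambda=V_{\mathfrak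 k_1}+\lambda V_{\mathfrak p_1}$, $\alpha^\lambda=U^\lambda dz+V^\lambda d\bar z$. Explicitly, $U^\lambda$ (resp. $V^\lambda$) is obtained from $U$ (resp. $V$) by multiplying all off-diagonal entries by $\lambda^{-1}$ (resp. $\lambda$) and leaving the diagonal unchanged. *)

(* Defs.v *)
From HB Require Import structures.
From mathcomp Require Import all_boot all_order all_algebra.
From mathcomp Require Import complex.
From mathcomp Require Import all_classical all_reals all_analysis.

Set Implicit Arguments.
Unset Strict Implicit.
Unset Printing Implicit Defensive.

Import Order.TTheory GRing.Theory Num.Theory.
Import numFieldNormedType.Exports.

Local Open Scope classical_set_scope.
Local Open Scope ring_scope.

(* The complex coordinate z = x + i y identifies the domain with a subset of
   R * R; a point is written q = (x, y), and functions on the domain are total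
   functions on R * R of which only the values on the domain matter. *)

Definition dirx (R : realType) : R * R := (1, 0).
Definition diry (R : realType) : R * R := (0, 1).

Fixpoint Ck (R : realType) (W : normedModType R) (n : nat)
    (D : set (R * R)) (u : R * R -> W) : Prop :=
  {in D, continuous u} /\
  match n with
  | 0%N => True
  | m.+1 => [/\ forall q, D q -> derivable u q (dirx R),
               forall q, D q -> derivable u q (diry R),
               Ck m D (fun q => 'D_(dirx R) u q) &
               Ck m D (fun q => 'D_(diry R) u q)]
  end.

Definition smooth (R : realType) (W : normedModType R)
    (D : set (R * R)) (u : R * R -> W) : Prop := forall n, Ck n D u.

Definition smoothC (R : realType) (D : set (R * R)) (u : R * R -> R[i]) : Prop :=
  smooth D (fun q => complex.Re (u q) : R^o) /\
  smooth D (fun q => complex.Im (u q) : R^o).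

Definition simply_connected (R : realType) (D : set (R * R)) : Prop :=
  connected D /\
  forall gam : R -> R * R,
    {within `[0, 1], continuous gam} ->
    (forall t, 0 <= t <= 1 -> D (gam t)) -> gam 0 = gam 1 ->
  exists H : R * R -> R * R,
    [/\ {within `[0, 1] `*` `[0, 1], continuous H},
        forall s t, 0 <= s <= 1 -> 0 <= t <= 1 -> D (H (s, t)),
        forall t, 0 <= t <= 1 -> H (0, t) = gam t /\ H (1, t) = gam 0 &
        forall s, 0 <= s <= 1 -> H (s, 0) = gam 0 /\ H (s, 1) = gam 0].

(** Complex derivatives *)

Definition dC (R : realType) (v : R * R) (u : R * R -> R[i]) (q : R * R) : R[i] :=
  Complex ('D_v (fun q' => complex.Re (u q') : R^o) q)
          ('D_v (fun q' => complex.Im (u q') : R^o) q).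

Definition iC (R : realType) : R[i] := Complex 0 1.

Definition dz (R : realType) (u : R * R -> R[i]) (q : R * R) : R[i] :=
  (dC (dirx R) u q - iC R * dC (diry R) u q) / 2.

Definition dzb (R : realType) (u : R * R -> R[i]) (q : R * R) : R[i] :=
  (dC (dirx R) u q + iC R * dC (diry R) u q) / 2.

Definition barC (R : realType) (u : R * R -> R[i]) (q : R * R) : R[i] :=
  conjc (u q).

(* (log u)_z for a nowhere vanishing u; it does not depend on the branch. *)
Definition dz_log (R : realType) (u : R * R -> R[i]) (q : R * R) : R[i] :=
  dz u q / u q.

Definition dmxC (R : realType) (m n : nat) (v : R * R)
    (A : R * R -> 'M[R[i]]_(m, n)) (q : R * R) : 'M[R[i]]_(m, n) :=
  \matrix_(i, j) dC v (fun q' => A q' i j) q.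

Definition mx4 (T : nmodType) (s : seq (seq T)) : 'M[T]_4 :=
  \matrix_(i, j) nth 0 (nth [::] s i) j.

(** Surfaces in RP^3, given by lifts to R^4 *)

(* q |-> [f q] is an immersion into RP^3. *)
Definition immersed_lift (R : realType) (D : set (R * R))
    (f : R * R -> 'cV[R]_4) : Prop :=
  smooth D f /\
  forall q, D q ->
    f q != 0 /\
    \rank (row_mx (f q) (row_mx ('D_(dirx R) f q) ('D_(diry R) f q))) = 3.

Definition dir (R : realType) (i : 'I_2) : R * R :=
  if i == 0 then dirx R else diry R.

Definition transversal (R : realType) (D : set (R * R))
    (f xi : R * R -> 'cV[R]_4) : Prop :=
  smooth D xi /\
  forall q, D q ->
    forall c0 c1 c2 : R,
      xi q <> c0 *: f q + c1 *: 'D_(dirx R) f q + c2 *: 'D_(diry R) f q.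

(* D_X f_* Y = f_* (nabla_X Y) + h(X, Y) xi + T(X, Y) zeta on coordinate
   fields: g1, g2 are the components of nabla_X Y, and the radial field zeta
   along f is f itself. *)
Definition gauss_formula (R : realType) (D : set (R * R))
    (f xi : R * R -> 'cV[R]_4) (h : R * R -> 'M[R]_2) : Prop :=
  forall q, D q -> forall i j : 'I_2, exists g1 g2 T : R,
    'D_(dir R i) (fun q' => 'D_(dir R j) f q') q =
      (g1 *: 'D_(dirx R) f q + g2 *: 'D_(diry R) f q)
      + h q i j *: xi q + T *: f q.

(* Definiteness of h, together with the fact that z is a coordinate for the
   Riemann surface structure [h], that is, h is a multiple of dx^2 + dy^2.
   The sign of xi is chosen so that h is positive. *)
Definition definite_conformal (R : realType) (D : set (R * R))
    (f : R * R -> 'cV[R]_4) : Prop :=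
  exists (xi : R * R -> 'cV[R]_4) (h : R * R -> 'M[R]_2),
    [/\ transversal D f xi, gauss_formula D f xi h,
        forall q, D q -> forall v : 'cV[R]_2, v != 0 ->
          0 < (v^T *m h q *m v) 0 0 &
        forall q, D q -> exists rho : R, h q = rho%:M].

Definition compC (R : realType) (f : R * R -> 'cV[R]_4) (i : 'I_4)
  (q : R * R) : R[i] := real_complex R (f q i 0).

Definition canonical_system (R : realType) (D : set (R * R))
    (f : R * R -> 'cV[R]_4) (b p : R * R -> R[i]) : Prop :=
  [/\ smoothC D b, smoothC D p &
    forall q, D q -> forall i : 'I_4,
      dz (dz (compC f i)) q = b q * dzb (compC f i) q + p q * compC f i q /\
      dzb (dzb (compC f i)) q =
        barC b q * dz (compC f i) q + barC p q * compC f i q].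

(* f is the canonical lift, with coefficients b and p, of a surface whose
   projective metric 8 |b|^2 dz dzbar is positive definite. *)
Definition definite_surface (R : realType) (D : set (R * R))
    (f : R * R -> 'cV[R]_4) (b p : R * R -> R[i]) : Prop :=
  [/\ immersed_lift D f, definite_conformal D f, canonical_system D f b p &
      forall q, D q -> b q != 0].

(** Invariants and classes of surfaces *)

Definition kinv (R : realType) (b : R * R -> R[i]) (q : R * R) : R[i] :=
  (`|b q| ^+ 2 - dzb (dz_log b) q) / 2.

Definition Pinv (R : realType) (b p : R * R -> R[i]) (q : R * R) : R[i] :=
  p q + dzb b q / 2 - dz (dz (barC b)) q / (2 * barC b q)
  + dz (barC b) q ^+ 2 / (4 * barC b q ^+ 2).

Definition demoulin (R : realType) (D : set (R * R)) (b p : R * R -> R[i]) : Prop :=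
  forall q, D q -> Pinv b p q = 0.

(* The Euler-Lagrange equation of the area functional of the projective
   metric. *)
Definition projective_minimal (R : realType) (D : set (R * R))
    (b p : R * R -> R[i]) : Prop :=
  forall q, D q ->
    barC b q * dz (Pinv b p) q + 2 * dz (barC b) q * Pinv b p q = 0.

Definition coincidence (R : realType) (D : set (R * R)) (b : R * R -> R[i]) : Prop :=
  forall q, D q -> dz_log (fun q' => b q' * barC b q' ^+ 2) q = 0.

(** The Wilczynski frame *)

Definition Umx (R : realType) (b p : R * R -> R[i]) (q : R * R) : 'M[R[i]]_4 :=
  let a := dz (barC b) q / (2 * barC b q) in
  let P := Pinv b p q in
  let k := kinv b q in
  mx4 [:: [:: a; P;      k; b q * conjc P];
          [:: 1; - a;    0; k];
          [:: 0; b q;    a; P];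
          [:: 0; 0;      1; - a]].

Definition Vmx (R : realType) (b p : R * R -> R[i]) (q : R * R) : 'M[R[i]]_4 :=
  let c := dzb b q / (2 * b q) in
  let P := Pinv b p q in
  let k := kinv b q in
  mx4 [:: [:: c; conjc k; conjc P;  barC b q * P];
          [:: 0; c;       barC b q; conjc P];
          [:: 1; 0;       - c;      conjc k];
          [:: 0; 1;       0;        - c]].

Definition wilczynski (R : realType) (f : R * R -> 'cV[R]_4)
    (b : R * R -> R[i]) (q : R * R) : 'M[R[i]]_4 :=
  let a := dz (barC b) q / (2 * barC b q) in
  let c := dzb b q / (2 * b q) in
  \matrix_(i, j)
    (let fi := compC f i in
     nth 0 [:: fi q;
               dz fi q - a * fi q;
               dzb fi q - c * fi q;
               dzb (dz fi) q - a * dzb fi q - c * dz fi q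
                 + (`|dzb b q| ^+ 2 / (4 * `|b q| ^+ 2) - `|b q| ^+ 2 / 2) * fi q]
           j).

(* The solution of F_z = F U, F_zbar = F V with F(zs) = id: both systems are
   left invariant, so the Wilczynski frame is normalized by a constant left
   factor. *)
Definition frame (R : realType) (f : R * R -> 'cV[R]_4) (b : R * R -> R[i])
    (zs q : R * R) : 'M[R[i]]_4 :=
  invmx (wilczynski f b zs) *m wilczynski f b q.

Definition Lmx (R : realType) : 'M[R[i]]_4 :=
  let s : R[i] := real_complex R (Num.sqrt 2) in
  s^-1 *: mx4 [:: [:: s; 0;    0;      0];
                  [:: 0; iC R; - iC R; 0];
                  [:: 0; 1;    1;      0];
                  [:: 0; 0;    0;      s]].

(* L F L^-1 has real entries, so that taking real parts loses nothing. *)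
Definition Fhat (R : realType) (f : R * R -> 'cV[R]_4) (b : R * R -> R[i])
    (zs q : R * R) : 'M[R]_4 :=
  map_mx (@complex.Re R) (Lmx R *m frame f b zs q *m invmx (Lmx R)).

(** The space Q and harmonic maps into it *)

Definition J1 (T : nzRingType) : 'M[T]_4 :=
  mx4 [:: [:: 0; 0; 0; 1]; [:: 0; 0; 1; 0]; [:: 0; 1; 0; 0]; [:: 1; 0; 0; 0]].

Definition J1hat (T : nzRingType) : 'M[T]_4 :=
  mx4 [:: [:: 0; 0; 0; 1]; [:: 0; 1; 0; 0]; [:: 0; 0; 1; 0]; [:: 1; 0; 0; 0]].

(* The eigenvalues are counted with multiplicity. *)
Definition Qspace (R : realType) : set 'M[R]_4 :=
  [set S : 'M[R]_4 |
    [/\ S^T = S, \det S = -1 &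
        exists s : 4.-tuple R,
          [/\ char_poly S = \prod_(a <- s) ('X - a%:P),
              count (fun a => 0 < a) s = 3%N &
              count (fun a => a < 0) s = 1%N]]].

(* The tangent space of Qspace at S: the differential of det at S is
   X |-> det S * tr (S^-1 X). *)
Definition Qtangent (R : realType) (S : 'M[R]_4) : set 'M[R]_4 :=
  [set X : 'M[R]_4 | X^T = X /\ \tr (invmx S *m X) = 0].

Definition Qmetric (R : realType) (S X Y : 'M[R]_4) : R :=
  \tr (invmx S *m X *m invmx S *m Y).

Definition smooth_curve (R : realType) (c : R -> 'M[R]_4) : Prop :=
  forall (n : nat) (t : R), derivable (derive1n n c) t 1.

Definition tangent_field_along (R : realType) (c Y : R -> 'M[R]_4) : Prop :=
  smooth_curve Y /\ forall t, Qtangent (c t) (Y t).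

(* Covariant derivative of the field Y along the curve c for the connection
   D + Gam, where D is the flat connection of the ambient space of matrices. *)
Definition cov_along (R : realType) (Gam : 'M[R]_4 -> 'M[R]_4 -> 'M[R]_4 -> 'M[R]_4)
    (c Y : R -> 'M[R]_4) (t : R) : 'M[R]_4 :=
  derive1 Y t + Gam (c t) (derive1 c t) (Y t).

(* Every affine connection of Qspace has the form D_X Y + Gam(X, Y) with Gam
   bilinear on tangent spaces, and its torsion is the skew part of Gam.  The
   clauses are: bilinearity (given symmetry), vanishing torsion, covariant
   derivatives of tangent fields are tangent, and compatibility with the
   metric. *)
Definition levi_civita (R : realType)
    (Gam : 'M[R]_4 -> 'M[R]_4 -> 'M[R]_4 -> 'M[R]_4) : Prop :=
  [/\ forall S, Qspace S -> forall (a : R) X X' Y,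
        Qtangent S X -> Qtangent S X' -> Qtangent S Y ->
        Gam S (a *: X + X') Y = a *: Gam S X Y + Gam S X' Y,
      forall S, Qspace S -> forall X Y,
        Qtangent S X -> Qtangent S Y -> Gam S X Y = Gam S Y X,
      forall c, smooth_curve c -> (forall t, Qspace (c t)) ->
        forall Y, tangent_field_along c Y ->
        forall t, Qtangent (c t) (cov_along Gam c Y t) &
      forall c, smooth_curve c -> (forall t, Qspace (c t)) ->
        forall Y Z, tangent_field_along c Y -> tangent_field_along c Z ->
        forall t,
        derive1 (fun t' => Qmetric (c t') (Y t') (Z t') : R^o) t =
          Qmetric (c t) (cov_along Gam c Y t) (Z t)
          + Qmetric (c t) (Y t) (cov_along Gam c Z t)].

(* Trace of nabla dg with respect to dx^2 + dy^2: another metric in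
   the conformal class only rescales it by a positive function. *)
Definition tension (R : realType) (Gam : 'M[R]_4 -> 'M[R]_4 -> 'M[R]_4 -> 'M[R]_4)
    (g : R * R -> 'M[R]_4) (q : R * R) : 'M[R]_4 :=
  \sum_(i < 2)
    ('D_(dir R i) (fun q' => 'D_(dir R i) g q') q
     + Gam (g q) ('D_(dir R i) g q) ('D_(dir R i) g q)).

(* The Levi-Civita connection exists and is unique on tangent vectors. *)
Definition harmonic_into_Q (R : realType) (D : set (R * R))
    (g : R * R -> 'M[R]_4) : Prop :=
  [/\ smooth D g, forall q, D q -> Qspace (g q) &
      exists Gam, levi_civita Gam /\ forall q, D q -> tension Gam g q = 0].

Definition gauss_map1 (R : realType) (f : R * R -> 'cV[R]_4)
    (b : R * R -> R[i]) (zs q : R * R) : 'M[R]_4 :=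
  Fhat f b zs q *m J1hat R *m (Fhat f b zs q)^T.

(** The family of connections *)

Definition tau1 (R : realType) (X : 'M[R[i]]_4) : 'M[R[i]]_4 :=
  - (J1 R[i] *m X^T *m J1 R[i]).

Definition k_part (R : realType) (X : 'M[R[i]]_4) : 'M[R[i]]_4 :=
  2^-1 *: (X + tau1 X).

Definition p_part (R : realType) (X : 'M[R[i]]_4) : 'M[R[i]]_4 :=
  2^-1 *: (X - tau1 X).

Definition Ulam (R : realType) (b p : R * R -> R[i]) (lam : R[i]) (q : R * R) :
    'M[R[i]]_4 :=
  k_part (Umx b p q) + lam^-1 *: p_part (Umx b p q).

Definition Vlam (R : realType) (b p : R * R -> R[i]) (lam : R[i]) (q : R * R) :
    'M[R[i]]_4 :=
  k_part (Vmx b p q) + lam *: p_part (Vmx b p q).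

(* The value of U^lam dz + V^lam dzbar at q on the tangent vector v. *)
Definition alpha (R : realType) (b p : R * R -> R[i]) (lam : R[i])
    (q v : R * R) : 'M[R[i]]_4 :=
  Complex v.1 v.2 *: Ulam b p lam q + Complex v.1 (- v.2) *: Vlam b p lam q.

(* The Lie algebra of L^-1 SL_4(R) L. *)
Definition gLie (R : realType) : set 'M[R[i]]_4 :=
  [set X : 'M[R[i]]_4 | \tr X = 0 /\
    forall i j, complex.Im ((Lmx R *m X *m invmx (Lmx R)) i j) = 0].

(* d alpha + 1/2 [alpha /\ alpha], evaluated on constant vector fields v, w. *)
Definition curvature (R : realType) (al : R * R -> R * R -> 'M[R[i]]_4)
    (q v w : R * R) : 'M[R[i]]_4 :=
  dmxC v (fun q' => al q' w) q - dmxC w (fun q' => al q' v) q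
  + (al q v *m al q w - al q w *m al q v).

Definition flat_connection (R : realType) (D : set (R * R))
    (al : R * R -> R * R -> 'M[R[i]]_4) : Prop :=
  (forall q v, D q -> gLie (al q v)) /\
  (forall q v w, D q -> curvature al q v w = 0).

(* Main.v *)
(** All three properties are equivalent to the pair of equations [P_zb = 0] and
    [bbar * P_z + 2 * bbar_z * P = 0] at every point.  In the curvature of
    [alpha^lambda] the coefficient of [lambda^-1] is a nilpotent matrix whose
    entries are these two expressions (up to conjugation), and the tension field
    of [g_1 = L F J_1 F^T L^T] is the same matrix carried along by the frame.

    Given the two equations, [|P|^2] solves a linear first order system, so [P]
    vanishes identically or nowhere.  In the second case [P] is holomorphic,
    hence so is [bbar_z / bbar = - P_z / (2 * P)].  Thus [(log b)_z,zb = 0] and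
    [k = |b|^2 / 2], and the Codazzi equation turns [P_zb = 0] into
    [(log (b * bbar^2))_z = 0].  Conversely, for a coincidence surface
    [X = (log b)_z,zb] satisfies [X + 2 * Xbar = 0], so that [X = 0] and the
    same computation gives [P_zb = 0]. *)

Require Import Defs.
From HB Require Import structures.
From mathcomp Require Import all_boot all_order all_algebra.
From mathcomp Require Import perm complex ring lra.
From mathcomp Require Import all_classical all_reals all_analysis.

Set Implicit Arguments.
Unset Strict Implicit.
Unset Printing Implicit Defensive.

Import Order.TTheory GRing.Theory Num.Theory.
Import numFieldNormedType.Exports.

Local Open Scope classical_set_scope.
Local Open Scope ring_scope.

(** Only the canonical system is given, so the structure equations have to be derived.
    Differentiating the columns of the frame yields [F_z = F U] and [F_zb = F V] up to an unknown
    [delta] in the corner entry; the mixed derivatives of the invertible frame then force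
    [2 * delta = 0], which is the first Gauss-Codazzi equation. Invertibility rests on definiteness:
    [4 f_{z zb}] is the Laplacian of [f], which is transversal to the surface in a conformal
    coordinate. The matrix in both criteria has one source. The curvature vanishes at [lambda = 1],
    which eliminates its [lambda]-free coefficient; and the first derivatives of [F J_1 F^T] see
    only the [p_1]-parts, whose symmetrised products cancel against the connection term of the
    tension field. Harmonicity refers to an arbitrary Levi-Civita connection, specified by its
    action along curves. It has to be identified on tangent vectors: the curves
    [(1 + t N) S (1 + t N)^T] with [N ^ 2 = 0] are polynomial and remain in the target, and such [N]
    span the trace-free matrices, hence reach every tangent vector. *)

(** * Partial derivatives on open subsets of the plane *)

Section RealCalculus.
Variable R : realType.
Implicit Types (D : set (R * R)) (q w : R * R).

(** Identities between functions are available on [D] only; since [D] is open they hold near each of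
    its points, and derivatives depend only on the germ. *)
Lemma eq_derivable_on (W : normedModType R) D (u v : R * R -> W) q w :
  open D -> (forall q, D q -> u q = v q) -> D q ->
  derivable u q w -> derivable v q w.
Proof.
move=> oD uv Dq; apply: near_eq_derivable.
by apply: filterS (open_nbhs_nbhs (conj oD Dq)) => x; exact: uv.
Qed.

Lemma eq_derive_on (W : normedModType R) D (u v : R * R -> W) q w :
  open D -> (forall q, D q -> u q = v q) -> D q -> 'D_w u q = 'D_w v q.
Proof.
move=> oD uv Dq; apply: near_eq_derive.
by apply: filterS (open_nbhs_nbhs (conj oD Dq)) => x; exact: uv.
Qed.

Lemma eq_Ck (W : normedModType R) n D (u v : R * R -> W) :
  open D -> (forall q, D q -> u q = v q) -> Ck n D u -> Ck n D v.
Proof.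
move=> oD; have cP (f g : R * R -> W) : (forall q, D q -> f q = g q) ->
    {in D, continuous f} -> {in D, continuous g}.
  move=> fg cf q qD; have Dq : D q by exact: set_mem.
  rewrite /continuous_at -(fg q Dq); apply: cvg_trans (cf q qD).
  apply: near_eq_cvg.
  by apply: filterS (open_nbhs_nbhs (conj oD Dq)) => x; exact: fg.
elim: n u v => [|n IHn] u v uv; first by case=> cu _; split=> //; exact: cP cu.
case=> cu [dx dy Cx Cy]; split; first exact: cP cu.
split.
- by move=> q Dq; exact: (eq_derivable_on oD uv Dq (dx q Dq)).
- by move=> q Dq; exact: (eq_derivable_on oD uv Dq (dy q Dq)).
- by apply: IHn Cx => q Dq; exact: (eq_derive_on _ oD uv Dq).
- by apply: IHn Cy => q Dq; exact: (eq_derive_on _ oD uv Dq).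
Qed.

Lemma Ck_le (W : normedModType R) n D (u : R * R -> W) :
  Ck n.+1 D u -> Ck n D u.
Proof.
elim: n u => [|n IHn] u; first by case=> cu _; split.
by case=> cu [dx dy Cx Cy]; exact: (conj cu (And4 dx dy (IHn _ Cx) (IHn _ Cy))).
Qed.

Lemma Ck_cst n D (c : R) : Ck n D (fun=> c : R^o).
Proof.
elim: n c => [|n IHn] c; split=> //; try by move=> q _; exact: cst_continuous.
split; try by move=> q _; exact: derivable_cst.
all: rewrite [X in Ck _ _ X](_ : _ = fun=> 0 : R^o) //.
all: by apply/funext => q; exact: derive_cst.
Qed.

Lemma CkD n D (u v : R * R -> R^o) : open D -> Ck n D u -> Ck n D v ->
  Ck n D (fun q => u q + v q : R^o).
Proof.
move=> oD; elim: n u v => [|n IHn] u v.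
  by case=> cu _ [cv _]; split=> // q qD; apply: cvgD; [exact: cu|exact: cv].
case=> cu [ux uy Cux Cuy] [cv [vx vy Cvx Cvy]]; split.
  by move=> q qD; apply: cvgD; [exact: cu|exact: cv].
split; try by move=> q Dq; apply: derivableD; auto.
- apply: eq_Ck (IHn _ _ Cux Cvx) => // q Dq.
  by rewrite -(deriveD (ux q Dq) (vx q Dq)).
- apply: eq_Ck (IHn _ _ Cuy Cvy) => // q Dq.
  by rewrite -(deriveD (uy q Dq) (vy q Dq)).
Qed.

Lemma CkM n D (u v : R * R -> R^o) : open D -> Ck n D u -> Ck n D v ->
  Ck n D (fun q => u q * v q : R^o).
Proof.
move=> oD; elim: n u v => [|n IHn] u v.
  by case=> cu _ [cv _]; split=> // q qD; apply: cvgM; [exact: cu|exact: cv].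
(* The product rule multiplies derivatives by undifferentiated factors, so both factors are also
   needed at order [n]. *)
move=> Cu Cv; have [Cu' Cv'] := (Ck_le Cu, Ck_le Cv).
case: Cu Cv => cu [ux uy Cux Cuy] [cv [vx vy Cvx Cvy]]; split.
  by move=> q qD; apply: cvgM; [exact: cu|exact: cv].
split; try by move=> q Dq; apply: derivableM; auto.
- apply: eq_Ck (CkD oD (IHn _ _ Cu' Cvx) (IHn _ _ Cv' Cux)) => // q Dq.
  by rewrite -(deriveM (ux q Dq) (vx q Dq)).
- apply: eq_Ck (CkD oD (IHn _ _ Cu' Cvy) (IHn _ _ Cv' Cuy)) => // q Dq.
  by rewrite -(deriveM (uy q Dq) (vy q Dq)).
Qed.

Lemma CkN n D (u : R * R -> R^o) : open D -> Ck n D u ->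
  Ck n D (fun q => - u q : R^o).
Proof.
move=> oD Cu; apply: eq_Ck (CkM oD (Ck_cst n D (-1)) Cu) => // q _.
by rewrite mulN1r.
Qed.

(** The derivative of [1/u] is [- (1/u)^2] times that of [u], so the induction concerns the single
    function [u]: order [n] for [1/u] feeds order [n.+1]. *)
Lemma CkV n D (u : R * R -> R^o) : open D -> (forall q, D q -> u q != 0) ->
  Ck n D u -> Ck n D (fun q => (u q)^-1 : R^o).
Proof.
move=> oD u0; elim: n => [|n IHn].
  case=> cu _; split=> // q qD; apply: cvgV; last exact: cu.
  by apply: u0; exact: set_mem.
move=> Cu; have Cu' := Ck_le Cu; have IH := IHn Cu'.
case: Cu => cu [ux uy Cux Cuy]; split.
  move=> q qD; apply: cvgV; last exact: cu.
  by apply: u0; exact: set_mem.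
split; try by move=> q Dq; apply: derivableV; auto.
- apply: eq_Ck (CkN oD (CkM oD (CkM oD IH IH) Cux)) => // q Dq.
  rewrite (deriveV (u0 q Dq) (ux q Dq)) expr2 invfM.
  by rewrite scaleNr.
- apply: eq_Ck (CkN oD (CkM oD (CkM oD IH IH) Cuy)) => // q Dq.
  rewrite (deriveV (u0 q Dq) (uy q Dq)) expr2 invfM.
  by rewrite scaleNr.
Qed.

Lemma cvg_mxP m n (T : Type) (F : set_system T) (FF : Filter F)
    (M : T -> 'M[R]_(m, n)) (A : 'M[R]_(m, n)) :
  (M x @[x --> F] --> A) <->
  forall i j, (M x i j : R^o) @[x --> F] --> (A i j : R^o).
Proof.
split=> [MA i j|MA].
  apply: (@cvg_comp _ _ _ M (fun B : 'M[R]_(m, n) => B i j)); first exact: MA.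
  exact: coord_continuous.
apply/cvgrPdist_le => /= e e0; near=> x.
rewrite /Num.Def.normr/= mx_normrE (bigmax_le _ (ltW e0))//= => i _.
rewrite !mxE/=; move: i; near: x; apply: filter_forall => /= i.
exact: ((cvgrPdist_le _ _).1 (MA i.1 i.2)).
Unshelve. all: by end_near. Qed.

Lemma derive_mxE m n (V : normedModType R) (M : V -> 'M[R]_(m, n)) t v i j :
  derivable M t v -> ('D_v M t) i j = 'D_v (fun x => M x i j : R^o) t.
Proof. by move=> dM; rewrite derive_mx // mxE. Qed.

Lemma Ck_mxP k m n D (M : R * R -> 'M[R]_(m, n)) : open D ->
  Ck k D M <-> forall i j, Ck k D (fun q => M q i j : R^o).
Proof.
move=> oD.
have cP (N : R * R -> 'M[R]_(m, n)) : {in D, continuous N} <->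
    forall i j, {in D, continuous (fun q => N q i j : R^o)}.
  split=> [cN i j q qD|cN q qD]; first by have /cvg_mxP := cN q qD; exact.
  by apply/cvg_mxP => i j; exact: cN.
elim: k M => [|k IHk] M /=.
  split=> [[/cP cM _] i j|CM]; first by split.
  by split=> //; apply/cP => i j; case: (CM i j).
split=> [[/cP cM [dx dy /IHk Cx /IHk Cy]] i j|CM].
  split=> //; split.
  - by move=> q Dq; have /derivable_mxP := dx q Dq; exact.
  - by move=> q Dq; have /derivable_mxP := dy q Dq; exact.
  - by apply: eq_Ck (Cx i j) => // q Dq; rewrite derive_mxE //; exact: dx.
  - by apply: eq_Ck (Cy i j) => // q Dq; rewrite derive_mxE //; exact: dy.
have dx q : D q -> derivable M q (dirx R).
  by move=> Dq; apply/derivable_mxP => i j; case: (CM i j) => _ [] /(_ q Dq).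
have dy q : D q -> derivable M q (diry R).
  by move=> Dq; apply/derivable_mxP => i j; case: (CM i j) => _ [] _ /(_ q Dq).
split; first by apply/cP => i j; case: (CM i j).
split=> //; apply/IHk => i j; case: (CM i j) => _ [_ _ Cx Cy].
- by apply: eq_Ck Cx => // q Dq; rewrite derive_mxE //; exact: dx.
- by apply: eq_Ck Cy => // q Dq; rewrite derive_mxE //; exact: dy.
Qed.

(** The one-variable difference quotient is literally the directional one; this opens the way to the
    mean value theorem on horizontal slices. *)
Lemma is_derive_slicex (u : R * R -> R^o) (x y : R) :
  derivable u (x, y) (dirx R) ->
  is_derive x 1 (fun t => u (t, y) : R^o) ('D_(dirx R) u (x, y)).
Proof.
have E : (fun h : R => h^-1 *: (((fun t => u (t, y) : R^o) \o shift x) (h *: 1) - u (x, y)))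
   = (fun h => h^-1 *: ((u \o shift (x, y)) (h *: dirx R) - u (x, y))).
  apply/funext => h /=; congr (_ *: (u _ - _)).
  by congr pair; rewrite /= ?scaler0 ?add0r.
by move=> du; apply: DeriveDef; rewrite ?/derivable ?/derive E.
Qed.

Lemma is_derive_slicey (u : R * R -> R^o) (x y : R) :
  derivable u (x, y) (diry R) ->
  is_derive y 1 (fun t => u (x, t) : R^o) ('D_(diry R) u (x, y)).
Proof.
have E : (fun h : R => h^-1 *: (((fun t => u (x, t) : R^o) \o shift y) (h *: 1) - u (x, y)))
   = (fun h => h^-1 *: ((u \o shift (x, y)) (h *: diry R) - u (x, y))).
  apply/funext => h /=; congr (_ *: (u _ - _)).
  by congr pair; rewrite /= ?scaler0 ?add0r.
by move=> du; apply: DeriveDef; rewrite ?/derivable ?/derive E.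
Qed.

Lemma MVT_is_derive (g dg : R -> R) (a b : R) : a < b ->
  (forall t, t \in `[a, b] -> is_derive t 1 (g : R -> R^o) (dg t)) ->
  exists2 c, c \in `[a, b] & g b - g a = dg c * (b - a).
Proof.
move=> ab dgP.
have sub t : t \in `]a, b[ -> t \in `[a, b].
  by rewrite !in_itv /= => /andP[/ltW -> /ltW ->].
have dI t : t \in `]a, b[ -> is_derive t 1 g (dg t) by move=> /sub; exact: dgP.
have cI : {within `[a, b], continuous g}.
  apply: derivable_within_continuous => t tI.
  by have [dt _] := dgP t tI; exact: dt.
have [c cab E] := MVT ab dI cI.
by exists c => //; exact: sub.
Qed.

(** Balls of the product norm are square boxes, the shape required for moving along horizontal and
    vertical segments. *)
Lemma open_box D q : open D -> D q -> exists2 e : R, 0 < e &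
  forall x y, `|q.1 - x| < e -> `|q.2 - y| < e -> D (x, y).
Proof.
move=> oD Dq; have /nbhs_ballP[e /= e0 eD] := open_nbhs_nbhs (conj oD Dq).
by exists e => // x y qx qy; apply: eD; split.
Qed.

Lemma continuous_box D (u : R * R -> R^o) q (eps : R) :
  {in D, continuous u} -> D q -> 0 < eps -> exists2 e : R, 0 < e &
  forall x y, `|q.1 - x| < e -> `|q.2 - y| < e -> `|u q - u (x, y)| < eps.
Proof.
move=> cu /mem_set/cu/cvgrPdist_lt /(_ eps) H e0.
have /nbhs_ballP[e /= e0' eD] := H e0.
by exists e => // x y qx qy; apply: (eD (x, y)); split.
Qed.

Lemma in_box (x h t : R) e : 0 < h -> h < e -> t \in `[x, x + h] -> `|x - t| < e.
Proof.
rewrite in_itv /= => h0 he /andP[xt th].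
by rewrite ltr_norml; apply/andP; split; lra.
Qed.

(* Both mixed derivatives are limits of the same second difference quotient. *)
Lemma mixed_derivatives D (u : R * R -> R^o) q : open D -> Ck 2 D u -> D q ->
  'D_(diry R) (fun q => 'D_(dirx R) u q) q =
  'D_(dirx R) (fun q => 'D_(diry R) u q) q.
Proof.
case: q => x y oD [cu [ux uy [cux [_ uxy _ [cuxy _]]] [cuy [uyx _ [cuyx _] _]]]] Dq.
set A := fun q => 'D_(diry R) (fun q => 'D_(dirx R) u q) q : R^o.
set B := fun q => 'D_(dirx R) (fun q => 'D_(diry R) u q) q : R^o.
apply/eqP; rewrite -subr_eq0; apply/negPn/negP => AB0.
rewrite -[X in X - _]/(A (x, y)) -[X in _ - X]/(B (x, y)) in AB0.
(* Half of the supposed gap between the mixed derivatives: on a box where each of them varies by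
   less than [eps], a common value contradicts the gap. *)
pose eps := `|A (x, y) - B (x, y)| / 2.
have eps0 : 0 < eps by rewrite divr_gt0 // normr_gt0.
have [e1 e10 DP] := open_box oD Dq.
have [e2 e20 AP] := continuous_box cuxy Dq eps0.
have [e3 e30 BP] := continuous_box cuyx Dq eps0.
pose e := Num.min e1 (Num.min e2 e3).
have e0 : 0 < e by rewrite !lt_min e10 e20.
pose h := e / 2.
have h0 : 0 < h by rewrite divr_gt0.
have he : h < e by rewrite /h; lra.
move: (he); rewrite {1}/e !lt_min => /and3P[h1 h2 h3].
have xh : x < x + h by rewrite ltrDl.
have yh : y < y + h by rewrite ltrDl.
have Dbox t s : t \in `[x, x + h] -> s \in `[y, y + h] -> D (t, s).
  by move=> tI sI; apply: DP; [exact: in_box tI|exact: in_box sI].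
have le_l (a b : R) : a < b -> a \in `[a, b].
  by move=> /ltW ab; rewrite in_itv /= lexx ab.
have le_r (a b : R) : a < b -> b \in `[a, b].
  by move=> /ltW ab; rewrite in_itv /= lexx ab.
have MVTh (g dg : R -> R) a :
    (forall t, t \in `[a, a + h] -> is_derive t 1 (g : R -> R^o) (dg t)) ->
    exists2 c, c \in `[a, a + h] & g (a + h) - g a = dg c * h.
  move=> dgP; have ah : a < a + h by rewrite ltrDl.
  have [c cI E] := MVT_is_derive ah dgP.
  by exists c => //; rewrite E; congr (_ * _); ring.
(* The second difference over the square of side [h] is expanded by the mean value theorem in [x]
   and then in [y]; afterwards in the opposite order. *)
have [c cI Ec] : exists2 c, c \in `[x, x + h] &
    u (x + h, y + h) - u (x + h, y) - (u (x, y + h) - u (x, y)) =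
    ('D_(dirx R) u (c, y + h) - 'D_(dirx R) u (c, y)) * h.
  apply: (MVTh (fun t => u (t, y + h) - u (t, y))
    (fun t => 'D_(dirx R) u (t, y + h) - 'D_(dirx R) u (t, y)) x) => t tI.
  apply: is_deriveB; apply: is_derive_slicex; apply: ux; apply: Dbox tI _.
  + exact: le_r.
  + exact: le_l.
have [d dI Ed] : exists2 d, d \in `[y, y + h] &
    'D_(dirx R) u (c, y + h) - 'D_(dirx R) u (c, y) = A (c, d) * h.
  apply: (MVTh (fun t => 'D_(dirx R) u (c, t)) (fun t => A (c, t)) y) => t tI.
  by apply: is_derive_slicey; apply: uxy; exact: Dbox.
have [d' d'I Ed'] : exists2 d, d \in `[y, y + h] &
    u (x + h, y + h) - u (x, y + h) - (u (x + h, y) - u (x, y)) =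
    ('D_(diry R) u (x + h, d) - 'D_(diry R) u (x, d)) * h.
  apply: (MVTh (fun t => u (x + h, t) - u (x, t))
    (fun t => 'D_(diry R) u (x + h, t) - 'D_(diry R) u (x, t)) y) => t tI.
  apply: is_deriveB; apply: is_derive_slicey; apply: uy; apply: Dbox => //.
  + exact: le_r.
  + exact: le_l.
have [c' c'I Ec'] : exists2 c, c \in `[x, x + h] &
    'D_(diry R) u (x + h, d') - 'D_(diry R) u (x, d') = B (c, d') * h.
  apply: (MVTh (fun t => 'D_(diry R) u (t, d')) (fun t => B (t, d')) x) => t tI.
  by apply: is_derive_slicex; apply: uyx; exact: Dbox.
(* Both expansions compute the same second difference, so the two mixed derivatives agree, though at
   possibly different points of the box. *)
have AB : A (c, d) = B (c', d').
  have hN : h != 0 by rewrite gt_eqF.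
  have swap (a1 a2 a3 a4 a b : R) : a1 - a2 - (a3 - a4) = a * h * h ->
      a1 - a3 - (a2 - a4) = b * h * h -> a = b.
    move=> Ea Eb; apply: (mulIf hN); apply: (mulIf hN).
    by rewrite -Ea -Eb; ring.
  rewrite Ed in Ec; rewrite Ec' in Ed'.
  exact: (swap _ _ _ _ (A (c, d)) (B (c', d')) Ec Ed').
have Ad : `|A (x, y) - A (c, d)| < eps.
  by apply: AP; [exact: in_box cI|exact: in_box dI].
have Bd : `|B (x, y) - B (c', d')| < eps.
  by apply: BP; [exact: in_box c'I|exact: in_box d'I].
have tri (a b a' b' : R) : a' = b' -> `|a - a'| < eps -> `|b - b'| < eps ->
    `|a - b| < eps + eps.
  move=> <- aa' bb'; rewrite (_ : a - b = (a - a') - (b - a')); last by ring.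
  by apply: le_lt_trans (ler_normB _ _) _; exact: ltrD.
have := tri _ _ _ _ AB Ad Bd.
by rewrite /eps -splitr ltxx.
Qed.

(** Gronwall's argument for a linear equation with bounded coefficient: squaring [psi] removes its
    sign, and an exponential weight turns the bound [K] into monotonicity on either side of [t0]. *)
Lemma vanish_segment (psi m : R -> R) (t0 e K : R) :
  (forall t, `|t0 - t| < e -> is_derive t 1 (psi : R -> R^o) (m t * psi t)) ->
  (forall t, `|t0 - t| < e -> `|m t| <= K) -> psi t0 = 0 ->
  forall t, `|t0 - t| < e -> psi t = 0.
Proof.
move=> dpsi mK psi0 t te.
(* [psi ^ 2 * exp (- 2 s K t)] decreases away from [t0] in the direction [s]. *)
pose w (s r : R) := psi r * psi r * expR (- 2 * s * K * r).
have dw s r : `|t0 - r| < e -> is_derive r 1 (w s : R -> R^o)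
    (2 * (m r - s * K) * (psi r * psi r) * expR (- 2 * s * K * r)).
  move=> re; have dp := dpsi r re.
  set k := - 2 * s * K.
  have dE : is_derive r 1 (fun r => expR (k * r) : R^o) (expR (k * r) * k).
    have dk := is_deriveZ k (is_derive_id r (1 : R^o)).
    rewrite /GRing.scale /= mulr1 in dk.
    exact: (is_derive1_comp (is_derive_expR (k * r)) dk).
  have dw := is_deriveM (is_deriveM dp dp) dE.
  apply: (is_derive_eq dw).
  rewrite /GRing.scale /= -[(psi * psi) r]/(psi r * psi r) /k.
  by ring.
have psiw s : w s t <= 0 -> psi t = 0.
  rewrite /w pmulr_lle0 ?expR_gt0 // => le0.
  have /eqP : psi t * psi t = 0 by apply/eqP; rewrite eq_le le0 -expr2 sqr_ge0.
  by rewrite mulf_eq0 orbb => /eqP.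
have w0 s : w s t0 = 0 by rewrite /w psi0 !mul0r.
have bnd r : `|t0 - r| < e -> m r - K <= 0 /\ 0 <= m r + K.
  by move=> /mK; rewrite ler_norml => /andP[? ?]; split; lra.
have pos s r : 0 <= psi r * psi r * expR (- 2 * s * K * r).
  by rewrite mulr_ge0 ?expR_ge0 // -expr2 sqr_ge0.
have [lt_t0|lt_t|<-] := ltgtP t0 t; last by [].
- have near_t0 r : r \in `[t0, t] -> `|t0 - r| < e.
    rewrite in_itv /= => /andP[? ?]; apply: le_lt_trans te.
    by rewrite !ler0_norm; lra.
  have [r rI E] := MVT_is_derive lt_t0 (fun r rI => dw 1 r (near_t0 r rI)).
  apply: (psiw 1); rewrite w0 subr0 in E; rewrite E.
  have [mK0 _] := bnd r (near_t0 r rI).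
  apply: mulr_le0_ge0; last by rewrite subr_ge0 ltW.
  rewrite -mulrA; apply: mulr_le0_ge0; last exact: pos.
  by rewrite mul1r; lra.
- have near_t0 r : r \in `[t, t0] -> `|t0 - r| < e.
    rewrite in_itv /= => /andP[? ?]; apply: le_lt_trans te.
    by rewrite !ger0_norm; lra.
  have [r rI E] := MVT_is_derive lt_t (fun r rI => dw (-1) r (near_t0 r rI)).
  apply: (psiw (-1)); rewrite w0 sub0r in E; rewrite -oppr_ge0 E.
  have [_ mK0] := bnd r (near_t0 r rI).
  apply: mulr_ge0; last by rewrite subr_ge0 ltW.
  rewrite -mulrA; apply: mulr_ge0; last exact: pos.
  by rewrite mulN1r opprK; lra.
Qed.

(** The zero set is closed in [D] by continuity. It is open because every point of a small box is
    joined to the centre by a horizontal and a vertical segment, on which uniqueness for linear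
    ordinary differential equations applies; continuity of [m1] and [m2] at the centre provides the
    bounds. *)
Lemma vanish_connected D (phi m1 m2 : R * R -> R^o) q0 : open D -> connected D ->
  {in D, continuous phi} -> {in D, continuous m1} -> {in D, continuous m2} ->
  (forall q, D q -> derivable phi q (dirx R)) ->
  (forall q, D q -> derivable phi q (diry R)) ->
  (forall q, D q -> 'D_(dirx R) phi q = m1 q * phi q) ->
  (forall q, D q -> 'D_(diry R) phi q = m2 q * phi q) ->
  D q0 -> phi q0 = 0 -> forall q, D q -> phi q = 0.
Proof.
move=> oD cD cphi cm1 cm2 dx dy Ex Ey Dq0 phi0 q Dq.
pose B := D `&` [set q | phi q = 0].
suff BD : B = D by move: Dq; rewrite -BD => -[].
apply: cD.
- by exists q0.
- exists B; last by rewrite /B setIA setIid.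
  rewrite openE => -[x y] [Dxy phixy].
  have [e1 e10 DP] := open_box oD Dxy.
  have [e2 e20 P1] := continuous_box cm1 Dxy ltr01.
  have [e3 e30 P2] := continuous_box cm2 Dxy ltr01.
  pose e := Num.min e1 (Num.min e2 e3).
  have e0 : 0 < e by rewrite !lt_min e10 e20.
  apply/nbhs_ballP; exists e => // -[x' y'] [/= bx' by'].
  have xx' : `|x - x'| < e := bx'; have yy' : `|y - y'| < e := by'.
  have bnd (a b : R) : `|a - b| < 1 -> `|b| <= `|a| + 1.
    move=> ab; rewrite -[b](subKr a).
    by apply: le_trans (ler_normB _ _) _; rewrite lerD2l ltW.
  have De a b : `|x - a| < e -> `|y - b| < e -> D (a, b).
    by rewrite /e !lt_min => /and3P[? _ _] /and3P[? _ _]; exact: DP.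
  have yy : `|y - y| < e by rewrite subrr normr0.
  have phix' : phi (x', y) = 0.
    apply: (@vanish_segment (fun t => phi (t, y)) (fun t => m1 (t, y)) x e
              (`|m1 (x, y)| + 1)) => // t te.
      by rewrite -Ex; [apply: is_derive_slicex; apply: dx; exact: De|exact: De].
    apply: bnd; move: te yy; rewrite /e !lt_min => /and3P[_ ? _] /and3P[_ ? _].
    exact: P1.
  split; first exact: De.
  apply: (@vanish_segment (fun t => phi (x', t)) (fun t => m2 (x', t)) y e
              (`|m2 (x, y)| + 1)) => // t te.
    by rewrite -Ey; [apply: is_derive_slicey; apply: dy; exact: De|exact: De].
  apply: bnd; move: te xx'; rewrite /e !lt_min => /and3P[_ _ ?] /and3P[_ _ ?].
  exact: P2.
- exists (~` (D `&` [set q | phi q != 0])).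
    apply: open_closedC; rewrite openE => r [Dr phir].
    rewrite /interior; near=> s; split.
      by near: s; exact: (open_nbhs_nbhs (conj oD Dr)).
    near: s; have /cvgrPdist_lt /(_ `|phi r|) := cphi r (mem_set Dr).
    rewrite normr_gt0 => /(_ phir); apply: filterS => s /=.
    by apply: contraTneq => ->; rewrite subr0 ltxx.
  apply/seteqP; split=> [s [Ds /= s0]|s [Ds /= s0]]; split=> //.
    by move=> [_ /=]; rewrite s0 eqxx.
  by apply/eqP/negPn/negP => s0'; apply: s0.
Unshelve. all: by end_near. Qed.

End RealCalculus.

(** * Wirtinger calculus for scalar and matrix functions *)

Section ComplexCalculus.
Variables (R : realType) (D : set (R * R)).
Hypothesis openD : open D.
Local Notation C := R[i].
Implicit Types (u v : R * R -> C) (q w : R * R).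

(** [Ck] grants derivability along the two coordinate directions; other directions require a
    separate argument for [C^1] functions. *)
Definition axis w := w = dirx R \/ w = diry R.

Lemma eq_smoothC u v : (forall q, D q -> u q = v q) -> smoothC D u -> smoothC D v.
Proof.
move=> uv [re im]; split=> n.
- by apply: eq_Ck (re n) => // q Dq; rewrite uv.
- by apply: eq_Ck (im n) => // q Dq; rewrite uv.
Qed.

Lemma smoothC_cst (c : C) : smoothC D (fun=> c).
Proof. by split=> n; exact: Ck_cst. Qed.

Lemma smoothCD u v : smoothC D u -> smoothC D v -> smoothC D (fun q => u q + v q).
Proof.
move=> [ur ui] [vr vi]; split=> n.
- apply: eq_Ck (CkD openD (ur n) (vr n)) => // q _.
  by case: (u q) => ? ?; case: (v q).
- apply: eq_Ck (CkD openD (ui n) (vi n)) => // q _.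
  by case: (u q) => ? ?; case: (v q).
Qed.

Lemma smoothCM u v : smoothC D u -> smoothC D v -> smoothC D (fun q => u q * v q).
Proof.
move=> [ur ui] [vr vi]; split=> n.
- apply: eq_Ck (CkD openD (CkM openD (ur n) (vr n))
    (CkN openD (CkM openD (ui n) (vi n)))) => // q _.
  by case: (u q) => ? ?; case: (v q).
- apply: eq_Ck (CkD openD (CkM openD (ur n) (vi n))
    (CkM openD (ui n) (vr n))) => // q _.
  by case: (u q) => ? ?; case: (v q) => ? ? /=.
Qed.

Lemma smoothC_conj u : smoothC D u -> smoothC D (fun q => conjc (u q)).
Proof.
move=> [ur ui]; split=> n.
- by apply: eq_Ck (ur n) => // q _; case: (u q).
- by apply: eq_Ck (CkN openD (ui n)) => // q _; case: (u q).
Qed.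

Lemma smoothCV u : (forall q, D q -> u q != 0) -> smoothC D u ->
  smoothC D (fun q => (u q)^-1).
Proof.
move=> u0 [ur ui].
pose N q := complex.Re (u q) * complex.Re (u q)
          + complex.Im (u q) * complex.Im (u q) : R^o.
have N0 q : D q -> N q != 0.
  move=> /u0; rewrite /N -!expr2; case: (u q) => a b; apply: contra => /=.
  by rewrite paddr_eq0 ?sqr_ge0 // !sqrf_eq0 eq_complex.
have NV n : Ck n D (fun q => (N q)^-1 : R^o).
  by apply: CkV => //; apply: CkD => //; apply: CkM.
split=> n.
- apply: eq_Ck (CkM openD (ur n) (NV n)) => // q _.
  by rewrite /N; case: (u q) => a b /=; rewrite -!expr2.
- apply: eq_Ck (CkN openD (CkM openD (ui n) (NV n))) => // q _.
  by rewrite /N; case: (u q) => a b /=; rewrite -!expr2.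
Qed.

Lemma smooth_dC u w : axis w -> smoothC D u -> smoothC D (dC w u).
Proof.
case=> -> [ur ui]; split=> n.
- by have [_ [_ _ Cx _]] := ur n.+1; exact: Cx.
- by have [_ [_ _ Cx _]] := ui n.+1; exact: Cx.
- by have [_ [_ _ _ Cy]] := ur n.+1; exact: Cy.
- by have [_ [_ _ _ Cy]] := ui n.+1; exact: Cy.
Qed.

Lemma smoothC_derivable u w q : axis w -> smoothC D u -> D q ->
  derivable (fun q => complex.Re (u q) : R^o) q w /\
  derivable (fun q => complex.Im (u q) : R^o) q w.
Proof.
by move=> [] -> [ur ui] Dq; have := (ur 1%N, ui 1%N);
  move=> [[_ [? ? _ _]] [_ [? ? _ _]]]; split; auto.
Qed.

Lemma eq_dC u v w q : (forall q, D q -> u q = v q) -> D q -> dC w u q = dC w v q.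
Proof.
by move=> uv Dq; congr Complex; apply: (eq_derive_on _ openD) => // r Dr; rewrite uv.
Qed.

Lemma dC_cst (c : C) w q : dC w (fun=> c) q = 0.
Proof. by rewrite /dC !(derive_cst (_ : R^o)). Qed.

Lemma dCD u v w q : axis w -> smoothC D u -> smoothC D v -> D q ->
  dC w (fun q => u q + v q) q = dC w u q + dC w v q.
Proof.
move=> aw su sv Dq.
have [ur ui] := smoothC_derivable aw su Dq.
have [vr vi] := smoothC_derivable aw sv Dq.
set a := (fun q => complex.Re (u q) : R^o) in ur *.
set b := (fun q => complex.Im (u q) : R^o) in ui *.
set c := (fun q => complex.Re (v q) : R^o) in vr *.
set d := (fun q => complex.Im (v q) : R^o) in vi *.
have -> : dC w (fun q => u q + v q) q = Complex ('D_w (a + c) q) ('D_w (b + d) q).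
  rewrite /dC; congr Complex; congr ('D_w _ q); apply/funext => r.
    rewrite [RHS]/GRing.add /= /a /b /c /d.
    by case: (u r) => ? ?; case: (v r) => ? ?.
  rewrite [RHS]/GRing.add /= /a /b /c /d.
  by case: (u r) => ? ?; case: (v r) => ? ?.
by rewrite (deriveD ur vr) (deriveD ui vi).
Qed.

Lemma dCM u v w q : axis w -> smoothC D u -> smoothC D v -> D q ->
  dC w (fun q => u q * v q) q = dC w u q * v q + u q * dC w v q.
Proof.
move=> aw su sv Dq.
have [ur ui] := smoothC_derivable aw su Dq.
have [vr vi] := smoothC_derivable aw sv Dq.
set a := (fun q => complex.Re (u q) : R^o) in ur *.
set b := (fun q => complex.Im (u q) : R^o) in ui *.
set c := (fun q => complex.Re (v q) : R^o) in vr *.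
set d := (fun q => complex.Im (v q) : R^o) in vi *.
have -> : dC w (fun q => u q * v q) q =
    Complex ('D_w (a * c - b * d) q) ('D_w (a * d + b * c) q).
  rewrite /dC; congr Complex; congr ('D_w _ q); apply/funext => r.
    rewrite [RHS]/GRing.add /= [X in _ = _ + X]/GRing.opp /= /GRing.mul /= /a /b /c /d.
    by case: (u r) => ? ?; case: (v r) => ? ?.
  rewrite [RHS]/GRing.add /= /GRing.mul /= /a /b /c /d.
  by case: (u r) => ? ?; case: (v r) => ? ?.
rewrite (deriveB (derivableM ur vr) (derivableM ui vi)).
rewrite (deriveD (derivableM ur vi) (derivableM ui vr)).
rewrite (deriveM ur vr) (deriveM ui vi) (deriveM ur vi) (deriveM ui vr) /dC -/a -/b -/c -/d.
rewrite [u q](_ : _ = Complex (a q) (b q)); last by rewrite /a /b; case: (u q).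
rewrite [v q](_ : _ = Complex (c q) (d q)); last by rewrite /c /d; case: (v q).
have cM (a0 b0 c0 d0 a' b' c' d' : R) :
    Complex (a0 * c' + c0 * a' - (b0 * d' + d0 * b'))
            (a0 * d' + d0 * a' + (b0 * c' + c0 * b')) =
    Complex a' b' * Complex c0 d0 + Complex a0 b0 * Complex c' d' :> C.
  by apply/eqP; rewrite eq_complex /=; apply/andP; split; apply/eqP; ring.
exact: cM.
Qed.

Lemma dC_conj u w q : axis w -> smoothC D u -> D q ->
  dC w (fun q => conjc (u q)) q = conjc (dC w u q).
Proof.
move=> aw su Dq; have [ur ui] := smoothC_derivable aw su Dq.
rewrite /dC /=; congr Complex.
  by congr ('D_w _ q); apply/funext => r; case: (u r).
rewrite -(deriveN ui); congr ('D_w _ q); apply/funext => r.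
by rewrite [RHS]/GRing.opp /=; case: (u r).
Qed.

Lemma axis_x : axis (dirx R). Proof. by left. Qed.
Lemma axis_y : axis (diry R). Proof. by right. Qed.
Hint Resolve axis_x axis_y : core.

(** Smoothness and both Wirtinger derivatives are kept in one judgement, so that the rules below
    compose as terms and the derivatives of a compound expression are read off from the resulting
    type. *)
Definition isd u uz ub := smoothC D u /\
  forall q, D q -> dz u q = uz q /\ dzb u q = ub q.

Lemma isd_smooth u uz ub : isd u uz ub -> smoothC D u. Proof. by case. Qed.

Lemma isd_z u uz ub q : isd u uz ub -> D q -> dz u q = uz q.
Proof. by move=> [_ H] /H[]. Qed.

Lemma isd_b u uz ub q : isd u uz ub -> D q -> dzb u q = ub q.
Proof. by move=> [_ H] /H[]. Qed.

Lemma isd_of u : smoothC D u -> isd u (dz u) (dzb u).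
Proof. by move=> su; split. Qed.

Lemma eq_isd u uz ub u' uz' ub' : isd u uz ub -> (forall q, D q -> u q = u' q) ->
  (forall q, D q -> uz q = uz' q) -> (forall q, D q -> ub q = ub' q) ->
  isd u' uz' ub'.
Proof.
move=> [su H] E Ez Eb; split; first exact: eq_smoothC su.
move=> q Dq; have [Hz Hb] := H q Dq.
have E' q' : D q' -> u' q' = u q' by move=> /E.
by rewrite /dz /dzb !(eq_dC _ E' Dq) -Ez // -Eb.
Qed.

Lemma isd_uniq u uz ub uz' ub' q : isd u uz ub -> isd u uz' ub' -> D q ->
  uz q = uz' q /\ ub q = ub' q.
Proof. by move=> [_ H] [_ H'] Dq; have [<- <-] := H q Dq; have [<- <-] := H' q Dq. Qed.

Lemma isd_cst (c : C) : isd (fun=> c) (fun=> 0) (fun=> 0).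
Proof.
split; first exact: smoothC_cst.
by move=> q _; rewrite /dz /dzb !dC_cst !(mulr0, subr0, addr0, mul0r).
Qed.

Lemma isdD u uz ub v vz vb : isd u uz ub -> isd v vz vb ->
  isd (fun q => u q + v q) (fun q => uz q + vz q) (fun q => ub q + vb q).
Proof.
move=> [su Hu] [sv Hv]; split; first exact: smoothCD.
move=> q Dq; have [<- <-] := Hu q Dq; have [<- <-] := Hv q Dq.
rewrite /dz /dzb (dCD axis_x su sv Dq) (dCD axis_y su sv Dq).
move: (dC (dirx R) u q) (dC (diry R) u q) (dC (dirx R) v q) (dC (diry R) v q).
by move=> a b c d; split; ring.
Qed.

Lemma isdM u uz ub v vz vb : isd u uz ub -> isd v vz vb ->
  isd (fun q => u q * v q) (fun q => uz q * v q + u q * vz q)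
      (fun q => ub q * v q + u q * vb q).
Proof.
move=> [su Hu] [sv Hv]; split; first exact: smoothCM.
move=> q Dq; have [<- <-] := Hu q Dq; have [<- <-] := Hv q Dq.
rewrite /dz /dzb (dCM axis_x su sv Dq) (dCM axis_y su sv Dq).
move: (dC (dirx R) u q) (dC (diry R) u q) (dC (dirx R) v q) (dC (diry R) v q).
by move: (u q) (v q) => u0 v0 a b c d; split; ring.
Qed.

Lemma isdN u uz ub : isd u uz ub ->
  isd (fun q => - u q) (fun q => - uz q) (fun q => - ub q).
Proof.
move=> du; have := isdM (isd_cst (-1)) du.
by move/eq_isd; apply=> q _; rewrite ?mul0r ?add0r mulN1r.
Qed.

Lemma isdB u uz ub v vz vb : isd u uz ub -> isd v vz vb ->
  isd (fun q => u q - v q) (fun q => uz q - vz q) (fun q => ub q - vb q).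
Proof. by move=> du dv; apply: isdD => //; exact: isdN. Qed.

(** Once [u^-1] is known to be smooth, its derivatives are forced by differentiating
    [u * u^-1 = 1]. *)
Lemma isdV u uz ub : (forall q, D q -> u q != 0) -> isd u uz ub ->
  isd (fun q => (u q)^-1) (fun q => - uz q / u q ^+ 2) (fun q => - ub q / u q ^+ 2).
Proof.
move=> u0 du; have sV := smoothCV u0 (isd_smooth du).
split=> // q Dq; have uq := u0 q Dq.
have H1 : isd (fun q => u q * (u q)^-1) (fun=> 0) (fun=> 0).
  by apply: eq_isd (isd_cst 1) _ _ _ => // r Dr; rewrite divff // u0.
have [] := isd_uniq (isdM du (isd_of sV)) H1 Dq.
move=> /eqP; rewrite addrC addr_eq0 => /eqP Ez /eqP; rewrite addrC addr_eq0 => /eqP Eb.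
by split; apply: (mulfI uq); rewrite ?Ez ?Eb; field.
Qed.

(** Conjugation changes the sign of [iC], hence exchanges the operators [dz] and [dzb]. *)
Lemma isd_conj u uz ub : isd u uz ub ->
  isd (fun q => conjc (u q)) (fun q => conjc (ub q)) (fun q => conjc (uz q)).
Proof.
move=> [su H]; split; first exact: smoothC_conj.
have ci : conjc (iC R) = - iC R by apply/eqP; rewrite eq_complex /= oppr0 !eqxx.
have c2 : conjc (2^-1 : C) = 2^-1 by rewrite fmorphV rmorph_nat.
have cM (x y : C) : conjc (x * y) = conjc x * conjc y by exact: rmorphM.
have cD (x y : C) : conjc (x + y) = conjc x + conjc y by exact: rmorphD.
have cN (x : C) : conjc (- x) = - conjc x by exact: rmorphN.
move=> q Dq; have [<- <-] := H q Dq.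
rewrite /dz /dzb (dC_conj axis_x su Dq) (dC_conj axis_y su Dq).
by rewrite !cM !c2 !cD cN cM ci mulNr opprK.
Qed.

Lemma smooth_dz u : smoothC D u -> smoothC D (dz u).
Proof.
move=> su; apply: smoothCM (smoothC_cst _); apply: smoothCD; first exact: smooth_dC.
have := smoothCM (smoothC_cst (- iC R)) (smooth_dC axis_y su).
by apply: eq_smoothC => q _; rewrite mulNr.
Qed.

Lemma smooth_dzb u : smoothC D u -> smoothC D (dzb u).
Proof.
move=> su; apply: smoothCM (smoothC_cst _); apply: smoothCD; first exact: smooth_dC.
by apply: smoothCM (smooth_dC axis_y su); exact: smoothC_cst.
Qed.

Lemma dC_mixed u q : smoothC D u -> D q ->
  dC (diry R) (dC (dirx R) u) q = dC (dirx R) (dC (diry R) u) q.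
Proof.
move=> [su si] Dq.
have Er := mixed_derivatives openD (su 2%N) Dq.
have Ei := mixed_derivatives openD (si 2%N) Dq.
by rewrite /dC /= Er Ei.
Qed.

Lemma dC_lincomb u w q (c d : C) : axis w -> smoothC D u -> D q ->
  dC w (fun q => dC (dirx R) u q * c + dC (diry R) u q * d) q =
  dC w (dC (dirx R) u) q * c + dC w (dC (diry R) u) q * d.
Proof.
move=> aw su Dq.
have sx := smooth_dC axis_x su; have sy := smooth_dC axis_y su.
have sc := smoothC_cst c; have sd := smoothC_cst d.
rewrite (dCD aw (smoothCM sx sc) (smoothCM sy sd) Dq).
rewrite (dCM aw sx sc Dq) (dCM aw sy sd Dq) !dC_cst.
by rewrite !mulr0 !addr0.
Qed.

Lemma dzb_dz u q : smoothC D u -> D q -> dzb (dz u) q = dz (dzb u) q.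
Proof.
move=> su Dq.
have Ez : dz u = fun q => dC (dirx R) u q * 2^-1 + dC (diry R) u q * (- iC R / 2).
  apply/funext => r; rewrite /dz; move: (dC (dirx R) u r) (dC (diry R) u r) => a b.
  by ring.
have Eb : dzb u = fun q => dC (dirx R) u q * 2^-1 + dC (diry R) u q * (iC R / 2).
  apply/funext => r; rewrite /dzb; move: (dC (dirx R) u r) (dC (diry R) u r) => a b.
  by ring.
rewrite Ez Eb /dzb /dz.
rewrite !(dC_lincomb _ _ axis_x su Dq) !(dC_lincomb _ _ axis_y su Dq) dC_mixed //.
move: (dC (dirx R) (dC (dirx R) u) q) (dC (dirx R) (dC (diry R) u) q)
  (dC (diry R) (dC (diry R) u) q) => a b c.
by ring.
Qed.

(** Ties the last column of the Wilczynski frame to the trace of [h], through which definiteness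
    enters. *)
Lemma dzb_dz_lap u q : smoothC D u -> D q -> dzb (dz u) q =
  (dC (dirx R) (dC (dirx R) u) q + dC (diry R) (dC (diry R) u) q) / 4.
Proof.
move=> su Dq.
have Ez : dz u = fun q => dC (dirx R) u q * 2^-1 + dC (diry R) u q * (- iC R / 2).
  apply/funext => r; rewrite /dz; move: (dC (dirx R) u r) (dC (diry R) u r) => a b.
  by ring.
have i2 : iC R * iC R = -1 by rewrite -expr2 sqr_i.
rewrite Ez /dzb !(dC_lincomb _ _ axis_x su Dq) !(dC_lincomb _ _ axis_y su Dq) dC_mixed //.
move: (dC (dirx R) (dC (dirx R) u) q) (dC (dirx R) (dC (diry R) u) q)
  (dC (diry R) (dC (diry R) u) q) => a b c.
transitivity ((a + - (iC R * iC R) * c) / 4); first by field.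
by rewrite i2 opprK mul1r.
Qed.

(** The integrability condition in the form used to extract compatibility equations: two independent
    computations of one mixed derivative. *)
Lemma isd_mixed u uz ub uzz uzb ubz ubb q : isd u uz ub -> isd uz uzz uzb ->
  isd ub ubz ubb -> D q -> uzb q = ubz q.
Proof.
move=> du duz dub Dq.
have := dzb_dz (isd_smooth du) Dq.
have <- : dzb (dz u) q = uzb q.
  by apply: isd_b Dq; apply: eq_isd duz _ _ _ => // r Dr; rewrite (isd_z du).
have <- : dz (dzb u) q = ubz q; last by [].
by apply: isd_z Dq; apply: eq_isd dub _ _ _ => // r Dr; rewrite (isd_b du).
Qed.

Lemma dC_isd u uz ub q : isd u uz ub -> D q ->
  dC (dirx R) u q = uz q + ub q /\ dC (diry R) u q = iC R * (uz q - ub q).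
Proof.
move=> [_ H] /H [<- <-]; rewrite /dz /dzb.
move: (dC (dirx R) u q) (dC (diry R) u q) => a b; split; first by field.
have i2 : iC R * iC R = -1 by rewrite -expr2 sqr_i.
transitivity (- (iC R * iC R) * b); first by rewrite i2 opprK mul1r.
by field.
Qed.

Lemma isd_sum n (u uz ub : 'I_n -> R * R -> C) :
  (forall i, isd (u i) (uz i) (ub i)) ->
  isd (fun q => \sum_i u i q) (fun q => \sum_i uz i q) (fun q => \sum_i ub i q).
Proof.
elim: n u uz ub => [|n IHn] u uz ub du.
  by apply: eq_isd (isd_cst 0) _ _ _ => q _; rewrite big_ord0.
apply: eq_isd (isdD (du ord0) (IHn _ _ _ (fun i => du (lift ord0 i)))) _ _ _ => q _;
by rewrite big_ord_recl.
Qed.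

Definition isdmx m n (A Az Ab : R * R -> 'M[C]_(m, n)) := forall i j,
  isd (fun q => A q i j) (fun q => Az q i j) (fun q => Ab q i j).

Lemma eq_isdmx m n (A Az Ab A' Az' Ab' : R * R -> 'M[C]_(m, n)) :
  isdmx A Az Ab -> (forall q, D q -> A q = A' q) ->
  (forall q, D q -> Az q = Az' q) -> (forall q, D q -> Ab q = Ab' q) ->
  isdmx A' Az' Ab'.
Proof.
by move=> dA E Ez Eb i j; apply: eq_isd (dA i j) _ _ _ => q Dq;
  rewrite ?E ?Ez ?Eb.
Qed.

Lemma isdmx_uniq m n (A Az Ab Az' Ab' : R * R -> 'M[C]_(m, n)) q :
  isdmx A Az Ab -> isdmx A Az' Ab' -> D q -> Az q = Az' q /\ Ab q = Ab' q.
Proof.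
by move=> dA dA' Dq; split; apply/matrixP => i j;
  have [] := isd_uniq (dA i j) (dA' i j) Dq.
Qed.

Lemma isdmx_mixed m n (A Az Ab Azz Azb Abz Abb : R * R -> 'M[C]_(m, n)) q :
  isdmx A Az Ab -> isdmx Az Azz Azb -> isdmx Ab Abz Abb -> D q -> Azb q = Abz q.
Proof.
by move=> dA dAz dAb Dq; apply/matrixP => i j;
  apply: isd_mixed (dA i j) (dAz i j) (dAb i j) Dq.
Qed.

Lemma isdmx_cst m n (A : 'M[C]_(m, n)) : isdmx (fun=> A) (fun=> 0) (fun=> 0).
Proof.
by move=> i j; apply: eq_isd (isd_cst (A i j)) _ _ _ => // q _; rewrite mxE.
Qed.

Lemma isdmxD m n (A Az Ab B Bz Bb : R * R -> 'M[C]_(m, n)) :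
  isdmx A Az Ab -> isdmx B Bz Bb ->
  isdmx (fun q => A q + B q) (fun q => Az q + Bz q) (fun q => Ab q + Bb q).
Proof.
by move=> dA dB i j; apply: eq_isd (isdD (dA i j) (dB i j)) _ _ _ => q _; rewrite mxE.
Qed.

Lemma isdmxM m n p (A Az Ab : R * R -> 'M[C]_(m, n)) (B Bz Bb : R * R -> 'M[C]_(n, p)) :
  isdmx A Az Ab -> isdmx B Bz Bb ->
  isdmx (fun q => A q *m B q) (fun q => Az q *m B q + A q *m Bz q)
        (fun q => Ab q *m B q + A q *m Bb q).
Proof.
move=> dA dB i j.
have := isd_sum (fun k => isdM (dA i k) (dB k j)).
by move/eq_isd; apply=> q _; rewrite !mxE ?big_split.
Qed.

Lemma isdmxT m n (A Az Ab : R * R -> 'M[C]_(m, n)) : isdmx A Az Ab ->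
  isdmx (fun q => (A q)^T) (fun q => (Az q)^T) (fun q => (Ab q)^T).
Proof. by move=> dA i j; apply: eq_isd (dA j i) _ _ _ => q _; rewrite mxE. Qed.

Lemma isd_prod n (u uz ub : 'I_n -> R * R -> C) :
  (forall i, isd (u i) (uz i) (ub i)) ->
  isd (fun q => \prod_i u i q)
      (fun q => \sum_k \prod_i (if i == k then uz i q else u i q))
      (fun q => \sum_k \prod_i (if i == k then ub i q else u i q)).
Proof.
elim: n u uz ub => [|n IHn] u uz ub du.
  by apply: eq_isd (isd_cst 1) _ _ _ => q _; rewrite !big_ord0.
have := isdM (du ord0) (IHn _ _ _ (fun i => du (lift ord0 i))).
move/eq_isd; apply=> q _; first by rewrite big_ord_recl.
all: rewrite [RHS]big_ord_recl; congr (_ + _).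
1,3: by rewrite big_ord_recl eqxx; congr (_ * _); apply: eq_bigr.
all: rewrite mulr_sumr; apply: eq_bigr => k _; rewrite big_ord_recl /=.
all: by congr (_ * _); apply: eq_bigr => i _; rewrite (inj_eq lift_inj).
Qed.

(** Jacobi's formula. It serves to show that a frame with trace-free [U] and [V] has constant
    determinant. *)
Lemma isd_det n (A Az Ab : R * R -> 'M[C]_n) : isdmx A Az Ab ->
  isd (fun q => \det (A q)) (fun q => \tr (Az q *m \adj (A q)))
      (fun q => \tr (Ab q *m \adj (A q))).
Proof.
move=> dA.
have jacobi (M N : 'M[C]_n) : \sum_(s : 'S_n) (-1) ^+ s *
    \sum_k \prod_i (if i == k then N i (s i) else M i (s i)) = \tr (N *m \adj M).
  (* Differentiating a product of entries replaces one row at a time; expansion along the replaced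
     row [k] leaves the cofactors of [M]. *)
  pose B k := \matrix_(i, j) if i == k then N i j else M i j.
  transitivity (\sum_k \det (B k)).
    under eq_bigr do rewrite mulr_sumr.
    rewrite exchange_big /=.
    by apply: eq_bigr => k _; apply: eq_bigr => s _; congr (_ * _);
      apply: eq_bigr => i _; rewrite mxE.
  apply: eq_bigr => k _; rewrite (expand_det_row _ k) mxE; apply: eq_bigr => j _.
  rewrite !mxE eqxx; congr (_ * _); rewrite /cofactor; congr (_ * \det _).
  by apply/matrixP => i l; rewrite !mxE eq_sym (negPf (neq_lift _ _)).
(* The rule for sums is indexed by ordinals, so the permutations are enumerated. *)
have sum_perm (F Fz Fb : 'S_n -> R * R -> C) :
    (forall s, isd (F s) (Fz s) (Fb s)) ->
    isd (fun q => \sum_s F s q) (fun q => \sum_s Fz s q) (fun q => \sum_s Fb s q).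
  move=> dF; have := isd_sum (fun i : 'I_#|{: 'S_n}| => dF (enum_val i)).
  have bij := onW_bij (fun=> true) (@enum_val_bij {perm 'I_n}).
  by move/eq_isd; apply=> q _; rewrite [RHS](reindex _ bij).
have dprod (s : 'S_n) := isdM (isd_cst ((-1) ^+ s)) (isd_prod (fun i => dA i (s i))).
have := sum_perm _ _ _ dprod.
by move/eq_isd; apply=> q _ //; rewrite -jacobi; apply: eq_bigr => s _;
  rewrite mul0r add0r.
Qed.

(** The real and imaginary parts of [u - u q0] solve the linear system with zero coefficients and
    vanish at [q0]. *)
Lemma isd_constant u q0 q : connected D -> isd u (fun=> 0) (fun=> 0) ->
  D q0 -> D q -> u q = u q0.
Proof.
move=> cD du Dq0 Dq.
have dv := isdB du (isd_cst (u q0)).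
have [sv Hv] := dv.
have zero w : axis w -> forall r, D r -> dC w (fun q => u q - u q0) r = 0.
  move=> aw r Dr; have [Ex Ey] := dC_isd dv Dr.
  by case: aw => ->; rewrite ?Ex ?Ey /= subrr ?addr0 ?subrr ?mulr0.
have c0 : {in D, continuous (fun _ : R * R => 0 : R^o)}.
  by move=> r _; exact: cst_continuous.
have part (g : C -> R) : (g = @complex.Re R \/ g = @complex.Im R) ->
    g (u q - u q0) = 0.
  move=> gE; pose phi r := g (u r - u q0) : R^o.
  have : smooth D phi by rewrite /phi; case: gE => ->; case: sv.
  move=> /(_ 1%N) [cphi [dx dy _ _]].
  apply: (vanish_connected openD cD cphi c0 c0 dx dy) Dq0 _ q Dq.
  - move=> r Dr; rewrite mul0r; have := zero _ axis_x _ Dr.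
    by move=> [E1 E2]; rewrite /phi; case: gE => ->.
  - move=> r Dr; rewrite mul0r; have := zero _ axis_y _ Dr.
    by move=> [E1 E2]; rewrite /phi; case: gE => ->.
  - by rewrite /phi subrr; case: gE => ->.
apply/eqP; rewrite -subr_eq0 eq_complex /=.
by rewrite !part ?eqxx; [|right|left].
Qed.

End ComplexCalculus.

Arguments conjc {R} x : simpl never.

(** * Conjugation as a field morphism *)

Section Conjugation.
Variable R : realType.
Implicit Types x y : R[i].

Lemma conjcM x y : conjc (x * y) = conjc x * conjc y. Proof. exact: rmorphM. Qed.
Lemma conjcD x y : conjc (x + y) = conjc x + conjc y. Proof. exact: rmorphD. Qed.
Lemma conjcN x : conjc (- x) = - conjc x. Proof. exact: rmorphN. Qed.
Lemma conjcX x n : conjc (x ^+ n) = conjc x ^+ n. Proof. exact: rmorphXn. Qed.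
Lemma conjc_natr n : conjc (n%:R : R[i]) = n%:R. Proof. exact: rmorph_nat. Qed.
Lemma conjcV x : conjc x^-1 = (conjc x)^-1. Proof. exact: fmorphV. Qed.

Definition conjcE := (@conjcK R, conjc_natr, conjcM, conjcD, conjcN, conjcX, conjcV).

End Conjugation.

(** * Derivatives of one row of the Wilczynski frame *)

Section ScalarStructureEquations.
Variables (R : realType) (D : set (R * R)).
Hypothesis openD : open D.
Local Notation C := R[i].
Local Notation isd := (isd D).

(* [bc], [pc], [Pc], [kc] and [c] stand for the conjugates of [b], [p], [P],
   [k] and [a], of which only the listed relations are used. *)
Variables (phi phz phb m b bz bb bc bcz bcb p pc a az ab c cz cb : R * R -> C).
Variables (P Pz Pb Pc Pcz Pcb k kz kb kc kcz kcb : R * R -> C).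
Hypotheses (dphi : isd phi phz phb)
  (dphz : isd phz (fun q => b q * phb q + p q * phi q) m)
  (dphb : isd phb m (fun q => bc q * phz q + pc q * phi q))
  (db : isd b bz bb) (dbc : isd bc bcz bcb) (da : isd a az ab) (dc : isd c cz cb)
  (dP : isd P Pz Pb) (dPc : isd Pc Pcz Pcb) (dk : isd k kz kb) (dkc : isd kc kcz kcb).
Hypotheses (bbE : forall q, D q -> bb q = 2 * b q * c q)
  (bczE : forall q, D q -> bcz q = 2 * bc q * a q)
  (PE : forall q, D q -> P q = p q + bb q / 2 - az q - a q ^+ 2)
  (PcE : forall q, D q -> Pc q = pc q + bcz q / 2 - cb q - c q ^+ 2)
  (czE : forall q, D q -> cz q = b q * bc q / 2 - k q)
  (abE : forall q, D q -> ab q = b q * bc q / 2 - kc q).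

(** The last three columns of the frame for a single component [phi] of [f]. Here [m] is
    [phi_{z zb}], and [a * c] takes the place of [|b_zb|^2 / (4 |b|^2)]. *)
Definition frame1 q := phz q - a q * phi q.
Definition frame2 q := phb q - c q * phi q.
Definition frame3 q :=
  m q - a q * phb q - c q * phz q + (a q * c q - b q * bc q / 2) * phi q.

Lemma isd_frame0 : isd phi (fun q => a q * phi q + frame1 q)
  (fun q => c q * phi q + frame2 q).
Proof. by apply: (eq_isd openD dphi) => q Dq //; rewrite /frame1 /frame2; ring. Qed.

Lemma isd_frame1 : isd frame1
  (fun q => P q * phi q - a q * frame1 q + b q * frame2 q)
  (fun q => kc q * phi q + c q * frame1 q + frame3 q).
Proof.
apply: (eq_isd openD (isdB openD dphz (isdM openD da dphi))) => q Dq //.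
  by rewrite PE // bbE // /frame1 /frame2; field.
by rewrite abE // /frame1 /frame3; field.
Qed.

Lemma isd_frame2 : isd frame2
  (fun q => k q * phi q + a q * frame2 q + frame3 q)
  (fun q => Pc q * phi q + bc q * frame1 q - c q * frame2 q).
Proof.
apply: (eq_isd openD (isdB openD dphb (isdM openD dc dphi))) => q Dq //.
  by rewrite czE // /frame2 /frame3; field.
by rewrite PcE // bczE // /frame1 /frame2; field.
Qed.

(* The last column is determined by the other ones up to [delta], which is
   zero by the first Gauss-Codazzi equation. *)
Lemma isd_frame3 e ez eb : isd frame3 ez eb -> e = frame3 ->
  (forall q, D q -> ez q =
    (b q * Pc q + (Pb q - kcz q - 2 * a q * kc q)) * phi q + k q * frame1 q
    + P q * frame2 q - a q * e q) /\
  (forall q, D q -> eb q =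
    (bc q * P q + (Pcz q - kb q - 2 * c q * k q)) * phi q + Pc q * frame1 q
    + kc q * frame2 q - c q * e q).
Proof.
move=> de ->; have [d0 d1 d2] := And3 isd_frame0 isd_frame1 isd_frame2.
split=> q Dq.
(* The [zb]-derivative of [frame1] contains [frame3] while its [z]-derivative does not, so equality
   of mixed derivatives can be solved for [frame3_z]. In the other case [frame2] yields [frame3_zb]
   likewise. *)
- have d1z := isdD openD (isdB openD (isdM openD dP d0) (isdM openD da d1))
    (isdM openD db d2).
  have d1b := isdD openD (isdD openD (isdM openD dkc d0) (isdM openD dc d1)) de.
  have /esym := isd_mixed openD d1 d1z d1b Dq.
  move/(canRL (addKr _)) => /= ->.
  by rewrite abE // bbE // czE //; field.
- have d2z := isdD openD (isdD openD (isdM openD dk d0) (isdM openD da d2)) de.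
  have d2b := isdB openD (isdD openD (isdM openD dPc d0) (isdM openD dbc d1))
    (isdM openD dc d2).
  have := isd_mixed openD d2 d2z d2b Dq.
  move/(canRL (addKr _)) => /= ->.
  by rewrite abE // bczE // czE //; field.
Qed.

End ScalarStructureEquations.

Lemma mulmx4E (T : pzRingType) (A B : 'M[T]_4) i j : (A *m B) i j =
  A i ord0 * B ord0 j + (A i (lift ord0 ord0) * B (lift ord0 ord0) j
  + (A i (lift ord0 (lift ord0 ord0)) * B (lift ord0 (lift ord0 ord0)) j
  + A i (lift ord0 (lift ord0 (lift ord0 ord0)))
    * B (lift ord0 (lift ord0 (lift ord0 ord0))) j)).
Proof. by rewrite mxE !big_ord_recl big_ord0 addr0. Qed.

(** * Frame equations and the first Gauss-Codazzi equation *)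

Section StructureEquations.
Variables (R : realType) (D : set (R * R)).
Hypothesis openD : open D.
Local Notation C := R[i].
Local Notation isd := (isd D).
Variables (f : R * R -> 'cV[R]_4) (b p : R * R -> C).
Hypotheses (sf : smooth D f) (cs : canonical_system D f b p)
  (b0 : forall q, D q -> b q != 0).

(** Half of [(log bbar)_z], as [dlogb] is half of [(log b)_zb]: the functions on the diagonals of
    [U] and [V], conjugate to each other. *)
Definition dlogz q : C := dz (barC b) q / (2 * barC b q).
Definition dlogb q : C := dzb b q / (2 * b q).
Local Notation a := dlogz.
Local Notation c := dlogb.
Local Notation P := (Pinv b p).
Local Notation k := (kinv b).
Local Notation bar u := (fun q => conjc (u q)).

Let sb : smoothC D b. Proof. by case: cs. Qed.
Let sp : smoothC D p. Proof. by case: cs. Qed.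
Let sbc : smoothC D (bar b). Proof. exact: smoothC_conj. Qed.
Let bc0 q : D q -> conjc (b q) != 0. Proof. by move=> Dq; rewrite conjc_eq0 b0. Qed.
Let two0 : 2 != 0 :> C. Proof. by rewrite pnatr_eq0. Qed.

Let db := isd_of sb.
Let dbc := isd_of sbc.
Let dbb : isd (dzb b) (dz (dzb b)) (dzb (dzb b)).
Proof. exact: isd_of (smooth_dzb openD sb). Qed.
Let dbcz : isd (dz (bar b)) (dz (dz (bar b))) (dzb (dz (bar b))).
Proof. exact: isd_of (smooth_dz openD sbc). Qed.

Lemma barP_dzb q : D q -> conjc (dzb b q) = dz (bar b) q.
Proof. by move=> Dq; rewrite (isd_z (isd_conj openD db) Dq). Qed.

Lemma dlogz_conj q : D q -> a q = conjc (c q).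
Proof.
move=> Dq; rewrite /a /c /barC -barP_dzb //.
by move: (dzb b q) (b q) => x y; rewrite !conjcE.
Qed.

Let isd_div u uz ub v vz vb : isd u uz ub -> isd v vz vb ->
    (forall q, D q -> v q != 0) ->
  isd (fun q => u q / v q) (fun q => uz q / v q - u q * vz q / v q ^+ 2)
      (fun q => ub q / v q - u q * vb q / v q ^+ 2).
Proof.
move=> du dv v0; apply: (eq_isd openD (isdM openD du (isdV openD v0 dv))) => // q Dq.
  by field; exact: v0.
by field; exact: v0.
Qed.

Lemma isd_dlogb : isd c
  (fun q => dz (dzb b) q / (2 * b q) - dzb b q * dz b q / (2 * b q ^+ 2))
  (fun q => dzb (dzb b) q / (2 * b q) - dzb b q * dzb b q / (2 * b q ^+ 2)).
Proof.
have d2b := isdM openD (isd_cst D 2) db.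
have n0 q : D q -> 2 * b q != 0 by move=> Dq; rewrite mulf_neq0 // b0.
apply: (eq_isd openD (isd_div dbb d2b n0)) => // q Dq; have h := b0 Dq.
all: move: (dz (dzb b) q) (dzb (dzb b) q) (dz b q) (dzb b q) (b q) h.
all: by move=> x1 x2 x3 x4 y y0; field.
Qed.

Lemma isd_dlogz : isd a (fun q => conjc (dzb c q)) (fun q => conjc (dz c q)).
Proof.
have dc : isd c (dz c) (dzb c) by apply: isd_of; case: isd_dlogb.
apply: (eq_isd openD (isd_conj openD dc)) => // q Dq.
by rewrite dlogz_conj.
Qed.

(** [c_z] is half of [(log b)_{z zb}], and the definition of [k] is solved for that mixed
    derivative. *)
Lemma dzlogb q : D q -> dz c q = b q * conjc (b q) / 2 - k q.
Proof.
move=> Dq; rewrite (isd_z isd_dlogb Dq) /kinv.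
have dbz := isd_of (smooth_dz openD sb).
have -> : dzb (dz_log b) q = dzb (dz b) q / b q - dz b q * dzb b q / b q ^+ 2.
  exact: isd_b (isd_div dbz db b0) Dq.
rewrite (dzb_dz openD sb Dq) sqr_normc.
move: (dz (dzb b) q) (dz b q) (dzb b q) (b q) (conjc (b q)) (b0 Dq).
by move=> x1 x2 x3 x4 y y0; field.
Qed.

Lemma smooth_dlogz : smoothC D a. Proof. by case: isd_dlogz. Qed.
Lemma smooth_dlogb : smoothC D c. Proof. by case: isd_dlogb. Qed.

(** The two quotients by [bbar] in [P] form the Riccati expression [- a_z - a^2]: [P] is what the
    substitution [f_1 = f_z - a f] makes of the coefficient [p]. *)
Lemma PinvE q : D q -> P q = p q + dzb b q / 2 - dz a q - a q ^+ 2.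
Proof.
move=> Dq; rewrite /Pinv.
have d2b := isdM openD (isd_cst D 2) dbc.
have n0 r : D r -> 2 * conjc (b r) != 0 by move=> Dr; rewrite mulf_neq0 // bc0.
have barE : barC b = bar b by [].
rewrite (isd_z (isd_div dbcz d2b n0) Dq) /a barE.
move: (bc0 Dq) (dz (dz (bar b)) q) (dz (bar b) q) (dzb b q) (p q).
by move: (conjc (b q)) => y y0 x1 x2 x3 x4; field.
Qed.

Lemma smooth_P : smoothC D P.
Proof.
have s : smoothC D (fun q => p q + dzb b q * 2^-1 - dz a q - a q * a q).
  have sa := smooth_dlogz.
  have saz := isd_of (smooth_dz openD sa).
  by case: (isdB openD (isdB openD (isdD openD (isd_of sp)
    (isdM openD dbb (isd_cst D 2^-1))) saz)
    (isdM openD (isd_of sa) (isd_of sa))).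
by apply: (eq_smoothC openD _ s) => q Dq; rewrite PinvE // expr2.
Qed.

Lemma smooth_k : smoothC D k.
Proof.
have s : smoothC D (fun q => b q * conjc (b q) * 2^-1 - dz c q).
  have sc := isd_of (smooth_dz openD smooth_dlogb).
  by case: (isdB openD (isdM openD (isdM openD db dbc) (isd_cst D 2^-1)) sc).
by apply: (eq_smoothC openD _ s) => q Dq; rewrite dzlogb //; ring.
Qed.

Let dP := isd_of smooth_P.
Let dk := isd_of smooth_k.
Let da := isd_of smooth_dlogz.
Let dc := isd_of smooth_dlogb.

Lemma smooth_compC i : smoothC D (compC f i).
Proof.
split=> n.
- by have /(Ck_mxP _ _ openD) := sf n; move=> /(_ i 0).
- exact: Ck_cst.
Qed.

Lemma wilczynski_cols q : D q -> wilczynski f b q = \matrix_(i, j) nth 0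
  [:: compC f i q; frame1 (compC f i) (dz (compC f i)) a q;
      frame2 (compC f i) (dzb (compC f i)) c q;
      frame3 (compC f i) (dz (compC f i)) (dzb (compC f i)) (dzb (dz (compC f i)))
        b (bar b) a c q] j.
Proof.
move=> Dq; apply/matrixP => i j; rewrite !mxE; congr nth.
rewrite /frame1 /frame2 /frame3 -/(a q) -/(c q); do 3 congr cons; congr cons.
congr (_ + _ * _).
have h := b0 Dq; have h' := bc0 Dq.
rewrite !sqr_normc (barP_dzb Dq) /a /c /barC.
by field; rewrite h h'.
Qed.

(** [U] with a free corner entry, and similarly [Vext]: as long as the Codazzi equation is unproved,
    the last column of the frame derivatives is known only up to the defect [delta]. *)
Definition Uext (x : R * R -> C) q : 'M[C]_4 :=
  mx4 [:: [:: a q; P q; k q; x q]; [:: 1; - a q; 0; k q];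
          [:: 0; b q; a q; P q]; [:: 0; 0; 1; - a q]].
Definition Vext (y : R * R -> C) q : 'M[C]_4 :=
  mx4 [:: [:: c q; conjc (k q); conjc (P q); y q];
          [:: 0; c q; conjc (b q); conjc (P q)];
          [:: 1; 0; - c q; conjc (k q)]; [:: 0; 1; 0; - c q]].
Definition delta q : C := dzb P q - dz (bar k) q - 2 * a q * conjc (k q).
Definition xdelta q : C := b q * conjc (P q) + delta q.
Definition ydelta q : C := conjc (b q) * P q + conjc (delta q).

Definition mx_of (A : R * R -> 'M[C]_4) (d : (R * R -> C) -> R * R -> C) q : 'M[C]_4 :=
  \matrix_(i, j) d (fun q => A q i j) q.

Lemma isdmx_of (A : R * R -> 'M[C]_4) :
  (forall i j, smoothC D (fun q => A q i j)) ->
  isdmx D A (mx_of A (@dz R)) (mx_of A (@dzb R)).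
Proof.
move=> sA i j; apply: (eq_isd openD (isd_of (sA i j))) => // q Dq; by rewrite mxE.
Qed.

Lemma smooth_mx4 (s : R * R -> seq (seq C)) :
  (forall i j : 'I_4, smoothC D (fun q => nth 0 (nth [::] (s q) i) j)) ->
  forall i j, smoothC D (fun q => mx4 (s q) i j).
Proof.
by move=> H i j; apply: (eq_smoothC openD _ (H i j)) => q _; rewrite mxE.
Qed.

Let smooth_opp u : smoothC D u -> smoothC D (fun q => - u q).
Proof. by move=> /isd_of /(isdN openD) []. Qed.

Lemma smooth_Uext x : smoothC D x -> forall i j, smoothC D (fun q => Uext x q i j).
Proof.
move=> sx; apply: smooth_mx4.
have [sa sP sk] := And3 smooth_dlogz smooth_P smooth_k.
move=> -[[|[|[|[|//]]]] ?] [[|[|[|[|//]]]] ?] //=;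
  by [exact: smoothC_cst|exact: smooth_opp].
Qed.

Lemma smooth_Vext y : smoothC D y -> forall i j, smoothC D (fun q => Vext y q i j).
Proof.
move=> sy; apply: smooth_mx4.
have [sc sP sk] := And3 smooth_dlogb smooth_P smooth_k.
have sPc := smoothC_conj openD sP; have skc := smoothC_conj openD sk.
move=> -[[|[|[|[|//]]]] ?] [[|[|[|[|//]]]] ?] //=;
  by [exact: smoothC_cst|exact: smooth_opp].
Qed.

Lemma smooth_delta : smoothC D delta.
Proof.
have dPb := isd_of (smooth_dzb openD smooth_P).
have skc := smoothC_conj openD smooth_k.
have dkz := isd_of (smooth_dz openD skc).
by case: (isdB openD (isdB openD dPb dkz) (isdM openD (isdM openD (isd_cst D 2) da)
  (isd_of skc))).
Qed.

(** The frame equations prior to Gauss-Codazzi, obtained row by row since each row involves one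
    component of [f]. *)
Lemma isd_wilczynski_ext : isdmx D (wilczynski f b)
  (fun q => wilczynski f b q *m Uext xdelta q)
  (fun q => wilczynski f b q *m Vext ydelta q).
Proof.
move=> i.
have sphi := smooth_compC i; have dphi := isd_of sphi.
have [_ _ cs'] := cs.
have dphz : isd (dz (compC f i)) (fun q => b q * dzb (compC f i) q + p q * compC f i q)
    (dzb (dz (compC f i))).
  apply: (eq_isd openD (isd_of (smooth_dz openD sphi))) => // q Dq.
  by have [] := cs' q Dq i.
have dphb : isd (dzb (compC f i)) (dzb (dz (compC f i)))
    (fun q => conjc (b q) * dz (compC f i) q + conjc (p q) * compC f i q).
  apply: (eq_isd openD (isd_of (smooth_dzb openD sphi))) => // q Dq.
    by rewrite (dzb_dz openD sphi Dq).
  by have [] := cs' q Dq i.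
have dPc := isd_conj openD dP; have dkc := isd_conj openD dk.
have dbc' := isd_conj openD db.
have bbE q : D q -> dzb b q = 2 * b q * c q.
  by move=> Dq; rewrite /c; have h := b0 Dq; field.
have bczE q : D q -> conjc (dzb b q) = 2 * conjc (b q) * a q.
  by move=> Dq; rewrite barP_dzb // /a; have h := bc0 Dq; rewrite /barC; field.
have abE q : D q -> dzb a q = b q * conjc (b q) / 2 - conjc (k q).
  move=> Dq; rewrite (isd_b isd_dlogz Dq) dzlogb //.
  by move: (b q) (k q) => x y; rewrite !conjcE (mulrC (conjc _)).
have PcE q : D q -> conjc (P q) = conjc (p q) + conjc (dzb b q) / 2 - dzb c q - c q ^+ 2.
  move=> Dq; rewrite PinvE // (isd_z isd_dlogz Dq) dlogz_conj //.
  by move: (p q) (dzb b q) (dzb c q) (c q) => x1 x2 x3 x4; rewrite !conjcE.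
have F0 := isd_frame0 openD a c dphi.
have F1 := isd_frame1 openD dphi dphz da bbE PinvE abE.
have F2 := isd_frame2 openD dphi dphb dc bczE PcE dzlogb.
set e := frame3 (compC f i) (dz (compC f i)) (dzb (compC f i)) (dzb (dz (compC f i)))
        b (bar b) a c in F1 F2.
have se : smoothC D e.
  have dphzb := isd_of (smooth_dzb openD (smooth_dz openD sphi)).
  case: (isdD openD (isdB openD (isdB openD dphzb (isdM openD da dphb))
    (isdM openD dc dphz)) (isdM openD (isdB openD (isdM openD da dc)
    (isdM openD (isdM openD db dbc') (isd_cst D 2^-1))) dphi)) => s _; exact: s.
have [ez eb] := isd_frame3 openD dphi dphz dphb db dbc' da dc dP dPc dk dkc
  bbE bczE PinvE PcE dzlogb abE (isd_of se) erefl.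
have dkcz q : D q -> conjc (dzb k q) = dz (bar k) q.
  by move=> Dq; rewrite -(isd_z dkc Dq).
have cdelta q : D q -> conjc (delta q) =
    conjc (dzb P q) - dzb k q - 2 * c q * k q.
  move=> Dq; rewrite /delta -dkcz // dlogz_conj //.
  by move: (dzb P q) (dzb k q) (c q) (k q) => x1 x2 x3 x4; rewrite !conjcE.
have W q : D q -> forall j, wilczynski f b q i j = nth 0
  [:: compC f i q; frame1 (compC f i) (dz (compC f i)) a q;
      frame2 (compC f i) (dzb (compC f i)) c q; e q] j.
  by move=> Dq j; rewrite wilczynski_cols // mxE.
have WM q (A : 'M[C]_4) : D q -> forall j, (wilczynski f b q *m A) i j =
    compC f i q * A ord0 j
    + (frame1 (compC f i) (dz (compC f i)) a q * A (lift ord0 ord0) j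
    + (frame2 (compC f i) (dzb (compC f i)) c q * A (lift ord0 (lift ord0 ord0)) j
    + e q * A (lift ord0 (lift ord0 (lift ord0 ord0))) j)).
  by move=> Dq j; rewrite mulmx4E !W.
move: F0 F1 F2 ez eb W WM.
set e1 := frame1 _ _ _; set e2 := frame2 _ _ _ => F0 F1 F2 ez eb W WM.
case=> -[|[|[|[|//]]]] lt4.
- apply: (eq_isd openD F0) => q Dq; rewrite ?WM ?W //= !mxE /=.
    by rewrite !(mulr0, addr0, mulr1) mulrC.
  by rewrite !(mulr0, addr0, add0r, mulr1) mulrC.
- apply: (eq_isd openD F1) => q Dq; rewrite ?WM ?W //= !mxE /=.
    by rewrite !(mulr0, addr0, mulr1, mulrN) !addrA (mulrC (P q)) (mulrC (a q)) (mulrC (b q)).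
  by rewrite !(mulr0, add0r, mulr1) !addrA (mulrC _ (compC _ _ _)) (mulrC (c q)).
- apply: (eq_isd openD F2) => q Dq; rewrite ?WM ?W //= !mxE /=.
    by rewrite !(mulr0, add0r, mulr1) !addrA (mulrC (k q)) (mulrC (a q)).
  rewrite !(mulr0, addr0, mulr1, mulrN) !addrA (mulrC _ (compC _ _ _)).
  by rewrite (mulrC (c q)) (mulrC _ (e1 q)).
- apply: (eq_isd openD (isd_of se)) => q Dq; rewrite ?WM ?W //= !mxE /=.
    rewrite ez // /xdelta /delta -dkcz // !mulrN !addrA.
    by rewrite (mulrC (compC f i q)) (mulrC (e1 q)) (mulrC (e2 q)) (mulrC (e q)).
  rewrite eb // /ydelta cdelta // !mulrN !addrA.
  by rewrite (mulrC (compC f i q)) (mulrC (e1 q)) (mulrC (e2 q)) (mulrC (e q)).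
Qed.

Hypothesis W_unit : forall q, D q -> wilczynski f b q \in unitmx.

(** The two mixed derivatives of the frame agree, and the invertible frame cancels on the left. *)
Lemma compat_ext q : D q ->
  mx_of (Uext xdelta) (@dzb R) q + Vext ydelta q *m Uext xdelta q =
  mx_of (Vext ydelta) (@dz R) q + Uext xdelta q *m Vext ydelta q.
Proof.
move=> Dq.
have sx : smoothC D xdelta.
  by case: (isdD openD (isdM openD db (isd_conj openD dP)) (isd_of smooth_delta)).
have sy : smoothC D ydelta.
  case: (isdD openD (isdM openD (isd_conj openD db) dP)
    (isd_conj openD (isd_of smooth_delta))) => s _; exact: s.
have dU := isdmx_of (smooth_Uext sx); have dV := isdmx_of (smooth_Vext sy).
have dW := isd_wilczynski_ext.
have := isdmx_mixed openD dW (isdmxM openD dW dU) (isdmxM openD dW dV) Dq.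
rewrite -!mulmxA -!mulmxDr => /(can_inj (mulKmx (W_unit Dq))).
by rewrite addrC => ->; rewrite addrC.
Qed.

(** Read off from entry (3,4) of the compatibility equation. Half of the terms there form [delta] by
    themselves, and the corner [xdelta] contributes [delta] once more with the same sign; the rest
    cancels and leaves [2 * delta = 0]. The unknown corner therefore causes no circularity. *)
Lemma gauss_codazzi q : D q ->
  dzb P q = dz (bar k) q + 2 * a q * conjc (k q).
Proof.
move=> Dq; have := compat_ext Dq.
set i2 := lift ord0 (lift ord0 ord0) : 'I_4.
set i3 := lift ord0 (lift ord0 (lift ord0 ord0)) : 'I_4.
move=> /matrixP /(_ i2 i3).
rewrite [LHS]mxE [RHS]mxE !mulmx4E.
have -> : mx_of (Uext xdelta) (@dzb R) q i2 i3 = dzb P q.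
  by rewrite mxE; congr (dzb _ q); apply/funext => r; rewrite mxE.
have -> : mx_of (Vext ydelta) (@dz R) q i2 i3 = dz (bar k) q.
  by rewrite mxE; congr (dz _ q); apply/funext => r; rewrite mxE.
rewrite /Uext /Vext !mxE /= !(mul0r, mul1r, add0r) /xdelta /delta.
have alg (Pb kz Pc P0 kc a0 c0 b1 : C) :
    Pb + (b1 * Pc + (Pb - kz - 2 * a0 * kc) + (- c0 * P0 + kc * - a0)) =
    kz + (b1 * Pc + (a0 * kc + P0 * - c0)) -> Pb = kz + 2 * a0 * kc.
  move=> E; have /eqP : 2 * (Pb - (kz + 2 * a0 * kc)) = 0.
    by move/eqP: E; rewrite -subr_eq0 => /eqP <-; ring.
  by rewrite mulf_eq0 (negPf two0) subr_eq0 => /eqP.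
exact: alg.
Qed.

Lemma delta0 q : D q -> delta q = 0.
Proof. by move=> Dq; rewrite /delta gauss_codazzi //; ring. Qed.

Lemma UextE q : D q -> Uext xdelta q = Umx b p q.
Proof. by move=> Dq; rewrite /Uext /xdelta delta0 // addr0. Qed.

Lemma VextE q : D q -> Vext ydelta q = Vmx b p q.
Proof. by move=> Dq; rewrite /Vext /ydelta delta0 // rmorph0 addr0. Qed.

Lemma isd_wilczynski : isdmx D (wilczynski f b)
  (fun q => wilczynski f b q *m Umx b p q) (fun q => wilczynski f b q *m Vmx b p q).
Proof.
by apply: (eq_isdmx openD isd_wilczynski_ext) => // q Dq; rewrite ?UextE ?VextE.
Qed.

Lemma smooth_Umx i j : smoothC D (fun q => Umx b p q i j).
Proof.
apply: (smooth_Uext (x := fun q => b q * conjc (P q))).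
by case: (isdM openD db (isd_conj openD dP)).
Qed.

Lemma smooth_Vmx i j : smoothC D (fun q => Vmx b p q i j).
Proof.
apply: (smooth_Vext (y := fun q => conjc (b q) * P q)).
by case: (isdM openD (isd_conj openD db) dP).
Qed.

Lemma compatibility q : D q ->
  mx_of (Umx b p) (@dzb R) q + Vmx b p q *m Umx b p q =
  mx_of (Vmx b p) (@dz R) q + Umx b p q *m Vmx b p q.
Proof.
move=> Dq; have dU := isdmx_of smooth_Umx; have dV := isdmx_of smooth_Vmx.
have dW := isd_wilczynski.
have := isdmx_mixed openD dW (isdmxM openD dW dU) (isdmxM openD dW dV) Dq.
rewrite -!mulmxA -!mulmxDr => /(can_inj (mulKmx (W_unit Dq))).
by rewrite addrC => ->; rewrite addrC.
Qed.

End StructureEquations.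

(** * Derivatives in arbitrary directions *)

Section DirectionalDerivative.
Variable R : realType.
Implicit Types (D : set (R * R)).

(** The increments [h * v.1] and [h * v.2] of a directional difference quotient have either sign and
    may vanish. *)
Lemma MVT_signed (g dg : R -> R) (x s : R) :
  (forall t, `|x - t| <= `|s| -> is_derive t 1 (g : R -> R^o) (dg t)) ->
  exists2 c, `|x - c| <= `|s| & g (x + s) - g x = dg c * s.
Proof.
move=> dgP; have [s0|s0|->] := ltgtP s 0; last first.
- by exists x; [rewrite subrr normr0|rewrite addr0 subrr mulr0].
- have xs : x < x + s by rewrite ltrDl.
  have near t : t \in `[x, x + s] -> `|x - t| <= `|s|.
    by rewrite in_itv /= => /andP[? ?]; rewrite (gtr0_norm s0) ler0_norm; lra.
  have [c cI E] := MVT_is_derive xs (fun t tI => dgP t (near t tI)).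
  by exists c; [exact: near|rewrite E; congr (_ * _); ring].
- have xs : x + s < x by rewrite gtrDl.
  have near t : t \in `[x + s, x] -> `|x - t| <= `|s|.
    by rewrite in_itv /= => /andP[? ?]; rewrite (ltr0_norm s0) ger0_norm; lra.
  have [c cI E] := MVT_is_derive xs (fun t tI => dgP t (near t tI)).
  exists c; first exact: near.
  by rewrite -opprB E; ring.
Qed.

(** The increment is split into a vertical and a horizontal one, and continuity of the partial
    derivatives controls both mean values. Curvature is evaluated on arbitrary vectors, which is
    where this enters. *)
Lemma derive_direction D (u : R * R -> R^o) q v : open D -> Ck 1 D u -> D q ->
  'D_v u q = v.1 * 'D_(dirx R) u q + v.2 * 'D_(diry R) u q.
Proof.
case: q v => x y [v1 v2] oD [cu [ux uy [cux _] [cuy _]]] Dq /=.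
set A := fun q => 'D_(dirx R) u q; set B := fun q => 'D_(diry R) u q.
rewrite -/(A (x, y)) -/(B (x, y)).
apply: cvg_lim => //; apply/cvgrPdist_lt => /= e e0.
(* The summand [1] keeps [K] positive for [v = 0] and makes the final estimate
   [(|v1| + |v2|) * (e / K) < e] strict. *)
pose K := `|v1| + `|v2| + 1.
have K0 : 0 < K by rewrite /K; have := normr_ge0 v1; have := normr_ge0 v2; lra.
have eK0 : 0 < e / K by rewrite divr_gt0.
have [e1 e10 DP] := open_box oD Dq.
have [e2 e20 AP] := continuous_box cux Dq eK0.
have [e3 e30 BP] := continuous_box cuy Dq eK0.
pose r := Num.min e1 (Num.min e2 e3).
have r0 : 0 < r by rewrite /r !lt_min e10 e20.
have rP a b : `|x - a| < r -> `|y - b| < r ->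
    [/\ D (a, b), `|A (x, y) - A (a, b)| < e / K & `|B (x, y) - B (a, b)| < e / K].
  rewrite /r !lt_min => /and3P[? ? ?] /and3P[? ? ?]; split.
  - exact: DP.
  - exact: AP.
  - exact: BP.
near=> h.
have h0 : h != 0 by near: h; exact: nbhs_dnbhs_neq.
have hr : `|h| < r / K by near: h; apply: dnbhs0_lt; rewrite divr_gt0.
have small w : `|w| <= K -> `|h * w| < r.
  move=> wK; rewrite normrM; have [->|w0] := eqVneq w 0; first by rewrite normr0 mulr0.
  have wp : 0 < `|w| by rewrite normr_gt0.
  by rewrite -ltr_pdivlMr //; apply: lt_le_trans hr _; rewrite ler_pdivrMr // mulrAC
    ler_pdivlMr // ler_pM2l.
have hv1 : `|h * v1| < r.
  by apply: small; rewrite /K; have := normr_ge0 v2; lra.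
have hv2 : `|h * v2| < r.
  by apply: small; rewrite /K; have := normr_ge0 v1; lra.
have yhv2 : `|y - (y + h * v2)| < r by rewrite opprD addrA subrr add0r normrN.
have xx : `|x - x| < r by rewrite subrr normr0.
have [c cI Ec] : exists2 c, `|x - c| <= `|h * v1| &
    u (x + h * v1, y + h * v2) - u (x, y + h * v2) = A (c, y + h * v2) * (h * v1).
  apply: (MVT_signed (g := fun t => u (t, y + h * v2))
    (dg := fun t => A (t, y + h * v2))) => t tI.
  apply: is_derive_slicex; apply: ux.
  by have [] := rP t (y + h * v2) (le_lt_trans tI hv1) yhv2.
have [d dI Ed] : exists2 d, `|y - d| <= `|h * v2| &
    u (x, y + h * v2) - u (x, y) = B (x, d) * (h * v2).
  apply: (MVT_signed (g := fun t => u (x, t)) (dg := fun t => B (x, t))) => t tI.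
  apply: is_derive_slicey; apply: uy.
  by have [] := rP x t xx (le_lt_trans tI hv2).
have [_ Ac _] := rP c (y + h * v2) (le_lt_trans cI hv1) yhv2.
have [_ _ Bd] := rP x d xx (le_lt_trans dI hv2).
rewrite [X in h^-1 *: X](_ : _ = A (c, y + h * v2) * (h * v1) + B (x, d) * (h * v2)).
  have bound (a b a' b' : R) : `|a - a'| < e / K -> `|b - b'| < e / K ->
      `|v1 * a + v2 * b - h^-1 * (a' * (h * v1) + b' * (h * v2))| < e.
    move=> aa bb; rewrite (_ : _ - _ = v1 * (a - a') + v2 * (b - b')); last by field.
    apply: le_lt_trans (ler_normD _ _) _; rewrite !normrM.
    apply: (@le_lt_trans _ _ ((`|v1| + `|v2|) * (e / K))).
      by rewrite mulrDl lerD // ler_wpM2l // ltW.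
    by rewrite mulrCA gtr_pMr // ltr_pdivrMr // mul1r /K ltrDl.
  exact: bound.
rewrite -Ec -Ed addrA subrK; congr (u _ - _).
by congr pair; rewrite /= addrC.
Unshelve. all: by end_near. Qed.

(** [Complex v.1 v.2] and [Complex v.1 (- v.2)] are the values of [dz] and [dzb] on [v]. *)
Lemma dC_direction D (u uz ub : R * R -> R[i]) q v : open D -> isd D u uz ub -> D q ->
  dC v u q = Complex v.1 v.2 * uz q + Complex v.1 (- v.2) * ub q.
Proof.
move=> oD du Dq; have [Ex Ey] := dC_isd du Dq.
have [[ur ui] _] := du.
have E : dC v u q = real_complex R v.1 * dC (dirx R) u q
                  + real_complex R v.2 * dC (diry R) u q.
  rewrite /dC (derive_direction v oD (ur 1%N) Dq) (derive_direction v oD (ui 1%N) Dq).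
  have gen (x1 x2 x3 x4 x5 x6 : R) : Complex (x1 * x3 + x2 * x4) (x1 * x5 + x2 * x6) =
      real_complex R x1 * Complex x3 x5 + real_complex R x2 * Complex x4 x6.
    by apply/eqP; rewrite eq_complex /= !mul0r !subr0 !addr0 !eqxx.
  exact: gen.
have v12 : Complex v.1 v.2 = real_complex R v.1 + iC R * real_complex R v.2.
  by apply/eqP; rewrite eq_complex /= !(mul0r, mul1r, mulr0, subr0, addr0, add0r) !eqxx.
have v12' : Complex v.1 (- v.2) = real_complex R v.1 - iC R * real_complex R v.2.
  by apply/eqP; rewrite eq_complex /= !(mul0r, mul1r, mulr0, subr0, addr0, add0r, oppr0) !eqxx.
rewrite E Ex Ey v12 v12'.
by move: (uz q) (ub q) (real_complex R v.1) (real_complex R v.2) => *; ring.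
Qed.

End DirectionalDerivative.

(** * Invertibility of the Wilczynski frame *)

Section Independence.
Variables (R : realType) (D : set (R * R)).
Hypothesis openD : open D.
Variables (f : R * R -> 'cV[R]_4) (b : R * R -> R[i]).
Hypotheses (imm : immersed_lift D f) (def : definite_conformal D f).

Let sf : smooth D f. Proof. by case: imm. Qed.

(** In a conformal coordinate the trace of the Gauss formula is the Laplacian: modulo [f], [f_x] and
    [f_y] it equals [2 * rho * xi] with [rho > 0], so it can replace [xi] as transversal field. *)
Definition lap q := 'D_(dirx R) (fun q => 'D_(dirx R) f q) q
                  + 'D_(diry R) (fun q => 'D_(diry R) f q) q.

Lemma lap_transversal q (c0 c1 c2 : R) : D q ->
  lap q <> c0 *: f q + c1 *: 'D_(dirx R) f q + c2 *: 'D_(diry R) f q.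
Proof.
move=> Dq; have [xi [h [[_ tr] gauss pos conf]]] := def.
have [rho hE] := conf q Dq.
have rho0 : 0 < rho.
  have e0 : (delta_mx 0 0 : 'cV[R]_2) != 0.
    by apply/eqP => /matrixP /(_ 0 0); rewrite !mxE /= => /eqP; rewrite oner_eq0.
  have := pos q Dq _ e0.
  rewrite hE mul_mx_scalar -scalemxAl mxE trmx_delta mul_delta_mx mxE /=.
  by rewrite mulr1.
have [g1 [g2 [T E0]]] := gauss q Dq 0 0.
have [g1' [g2' [T' E1]]] := gauss q Dq 1 1.
have alg (A B X Y F x : 'cV[R]_4) : A = g1 *: X + g2 *: Y + rho *: x + T *: F ->
    B = g1' *: X + g2' *: Y + rho *: x + T' *: F ->
    A + B = c0 *: F + c1 *: X + c2 *: Y ->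
    x = ((c0 - T - T') / (2 * rho)) *: F + ((c1 - g1 - g1') / (2 * rho)) *: X
        + ((c2 - g2 - g2') / (2 * rho)) *: Y.
  have r0 : rho != 0 by rewrite gt_eqF.
  move=> -> -> /matrixP E; apply/matrixP => i j; have := E i j; rewrite !mxE.
  move: (X i j) (Y i j) (F i j) (x i j) => X0 Y0 F0 x0 /eqP.
  rewrite -subr_eq0 => /eqP H0; apply: (mulfI (x := 2 * rho)); first by rewrite mulf_neq0.
  by apply/eqP; rewrite -subr_eq0; apply/eqP; rewrite -H0; field.
have G0 : 'D_(dirx R) (fun q => 'D_(dirx R) f q) q =
    g1 *: 'D_(dirx R) f q + g2 *: 'D_(diry R) f q + rho *: xi q + T *: f q.
  by move: E0; rewrite /dir eqxx hE mxE eqxx mulr1n.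
have G1 : 'D_(diry R) (fun q => 'D_(diry R) f q) q =
    g1' *: 'D_(dirx R) f q + g2' *: 'D_(diry R) f q + rho *: xi q + T' *: f q.
  by move: E1; rewrite /dir (_ : (1 == 0 :> 'I_2) = false) // hE mxE eqxx mulr1n.
move=> E; exact: (tr q Dq _ _ _ (alg _ _ _ _ _ _ G0 G1 E)).
Qed.

(** Transversality of the Laplacian gives [c3 = 0]; the rank condition of the immersion gives the
    rest. *)
Lemma real_independent q (c0 c1 c2 c3 : R) : D q ->
  c0 *: f q + c1 *: 'D_(dirx R) f q + c2 *: 'D_(diry R) f q + c3 *: lap q = 0 ->
  [/\ c0 = 0, c1 = 0, c2 = 0 & c3 = 0].
Proof.
move=> Dq E.
have c30 : c3 = 0.
  apply/eqP/negPn/negP => c3n0.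
  have alg (F X Y L : 'cV[R]_4) : c0 *: F + c1 *: X + c2 *: Y + c3 *: L = 0 ->
      L = (- c0 / c3) *: F + (- c1 / c3) *: X + (- c2 / c3) *: Y.
    move=> /matrixP E'; apply/matrixP => i j; have := E' i j; rewrite !mxE.
    move: (F i j) (X i j) (Y i j) (L i j) => F0 X0 Y0 L0 H0; apply: (mulfI c3n0).
    by apply/eqP; rewrite -subr_eq0; apply/eqP; rewrite -H0; field.
  exact: (lap_transversal Dq (alg _ _ _ _ E)).
move: E; rewrite c30 scale0r addr0 => E.
have [_ /(_ q Dq) [_ rk]] := imm.
set A := row_mx _ _ in rk.
pose w : 'cV[R]_(1 + (1 + 1)) := col_mx c0%:M (col_mx c1%:M c2%:M).
have Aw : A *m w = 0.
  rewrite /A /w (@mul_row_col _ 4 1 2 1) (@mul_row_col _ 4 1 1 1) !mul_mx_scalar addrA.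
  exact: E.
have fA : row_free A^T by rewrite /row_free mxrank_tr rk.
have w0 : w = 0.
  apply: trmx_inj; rewrite trmx0; apply/eqP; rewrite -(mulmx_free_eq0 _ fA).
  by rewrite -trmx_mul Aw trmx0.
have [e0 e1 e2] : [/\ (c0%:M = 0 :> 'M[R]_1), (c1%:M = 0 :> 'M[R]_1) & (c2%:M = 0 :> 'M[R]_1)].
  move: w0; rewrite /w -(col_mx0 R) => /eq_col_mx [-> ].
  by rewrite -(col_mx0 R) => /eq_col_mx [-> ->].
split=> //.
- by move/matrixP: e0 => /(_ 0 0); rewrite !mxE.
- by move/matrixP: e1 => /(_ 0 0); rewrite !mxE.
- by move/matrixP: e2 => /(_ 0 0); rewrite !mxE.
Qed.

Lemma complex_independent q (y0 y1 y2 y3 : R[i]) : D q ->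
  (forall i, y0 * real_complex R (f q i 0)
     + y1 * real_complex R ('D_(dirx R) f q i 0)
     + y2 * real_complex R ('D_(diry R) f q i 0)
     + y3 * real_complex R (lap q i 0) = 0) ->
  [/\ y0 = 0, y1 = 0, y2 = 0 & y3 = 0].
Proof.
move=> Dq E.
have part (g : R[i] -> R) : (g = @complex.Re R \/ g = @complex.Im R) ->
    [/\ g y0 = 0, g y1 = 0, g y2 = 0 & g y3 = 0].
  move=> gE.
  have genC (F X Y L : R) : y0 * real_complex R F + y1 * real_complex R X
      + y2 * real_complex R Y + y3 * real_complex R L = 0 ->
      g y0 * F + g y1 * X + g y2 * Y + g y3 * L = 0.
    move/(congr1 g); case: (y0) (y1) (y2) (y3) => r0 s0 [r1 s1] [r2 s2] [r3 s3].
    by case: gE => -> /=; rewrite !mulr0 ?subr0 ?add0r.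
  apply: (real_independent Dq); apply/matrixP => i j.
  have gen (F X Y L : 'cV[R]_4) : (g y0 *: F + g y1 *: X + g y2 *: Y + g y3 *: L) i 0 =
      g y0 * F i 0 + g y1 * X i 0 + g y2 * Y i 0 + g y3 * L i 0 by rewrite !mxE.
  rewrite ord1 gen [RHS]mxE; apply: genC; exact: E.
have [r0 r1 r2 r3] := part _ (or_introl erefl).
have [s0 s1 s2 s3] := part _ (or_intror erefl).
by split; apply/eqP; rewrite eq_complex; apply/andP; split; apply/eqP.
Qed.

(** The columns are complex combinations of [f], [f_x], [f_y] and the Laplacian, so a kernel vector
    yields a linear relation among these four vectors. *)
Lemma wilczynski_unit q : D q -> wilczynski f b q \in unitmx.
Proof.
move=> Dq.
suff inj (w : 'cV[R[i]]_4) : wilczynski f b q *m w = 0 -> w = 0.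
  rewrite -unitmx_tr -row_free_unit -kermx_eq0; apply/rowV0P => v /sub_kermxP vW.
  apply: trmx_inj; rewrite trmx0; apply: inj.
  by rewrite -[wilczynski f b q]trmxK -trmx_mul vW trmx0.
move=> Ww.
set i1 := lift ord0 ord0 : 'I_4.
set i2 := lift ord0 (lift ord0 ord0) : 'I_4.
set i3 := lift ord0 (lift ord0 (lift ord0 ord0)) : 'I_4.
pose a := dz (barC b) q / (2 * barC b q); pose c := dzb b q / (2 * b q).
pose n : R[i] := `|dzb b q| ^+ 2 / (4 * `|b q| ^+ 2) - `|b q| ^+ 2 / 2.
pose w0 := w ord0 0; pose w1 := w i1 0; pose w2 := w i2 0; pose w3 := w i3 0.
have smf := smooth_compC openD sf.
have dfx i : dC (dirx R) (compC f i) q = real_complex R ('D_(dirx R) f q i 0).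
  have [_ [dx _ _ _]] := sf 1%N.
  by rewrite /dC /= (derive_cst (0 : R^o)) (derive_mxE _ _ (dx q Dq)).
have dfy i : dC (diry R) (compC f i) q = real_complex R ('D_(diry R) f q i 0).
  have [_ [_ dy _ _]] := sf 1%N.
  by rewrite /dC /= (derive_cst (0 : R^o)) (derive_mxE _ _ (dy q Dq)).
have lapE i : dzb (dz (compC f i)) q = real_complex R (lap q i 0) / 4.
  have [_ [dx dy [_ [dxx _ _ _]] [_ [_ dyy _ _]]]] := sf 2%N.
  rewrite (dzb_dz_lap openD (smf i) Dq); congr (_ / _).
  have dfxx : dC (dirx R) (dC (dirx R) (compC f i)) q =
      real_complex R ('D_(dirx R) (fun q => 'D_(dirx R) f q) q i 0).
    rewrite (derive_mxE _ _ (dxx q Dq)).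
    rewrite (eq_dC openD (v := fun q => real_complex R ('D_(dirx R) f q i 0))) //.
      by rewrite /dC /= (derive_cst (0 : R^o)).
    move=> r Dr.
    by rewrite /dC /= (derive_cst (0 : R^o)) (derive_mxE _ _ (dx r Dr)).
  have dfyy : dC (diry R) (dC (diry R) (compC f i)) q =
      real_complex R ('D_(diry R) (fun q => 'D_(diry R) f q) q i 0).
    rewrite (derive_mxE _ _ (dyy q Dq)).
    rewrite (eq_dC openD (v := fun q => real_complex R ('D_(diry R) f q i 0))) //.
      by rewrite /dC /= (derive_cst (0 : R^o)).
    move=> r Dr.
    by rewrite /dC /= (derive_cst (0 : R^o)) (derive_mxE _ _ (dy r Dr)).
  by rewrite dfxx dfyy /lap mxE rmorphD.
(* The kernel relation is collected by [f], [f_x], [f_y] and the Laplacian. The coefficients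
   determine [x3], then [x1 + x2] and [x2 - x1], then [x0]; [j] stands for [iC]. *)
have alg (a' c' n' x0 x1 x2 x3 j F X Y L : R[i]) :
    F * x0 + (((X - j * Y) / 2 - a' * F) * x1 + (((X + j * Y) / 2 - c' * F) * x2
      + (L / 4 - a' * ((X + j * Y) / 2) - c' * ((X - j * Y) / 2) + n' * F) * x3)) = 0 ->
    (x0 - a' * x1 - c' * x2 + n' * x3) * F + ((x1 + x2 - (a' + c') * x3) / 2) * X
    + (j * (x2 - x1 + (c' - a') * x3) / 2) * Y + (x3 / 4) * L = 0.
  by move=> H; rewrite -[RHS]H; field.
have row i : (w0 - a * w1 - c * w2 + n * w3) * real_complex R (f q i 0)
    + ((w1 + w2 - (a + c) * w3) / 2) * real_complex R ('D_(dirx R) f q i 0)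
    + (iC R * (w2 - w1 + (c - a) * w3) / 2) * real_complex R ('D_(diry R) f q i 0)
    + (w3 / 4) * real_complex R (lap q i 0) = 0.
  move/matrixP: Ww => /(_ i 0) H.
  rewrite mxE !big_ord_recl big_ord0 addr0 !mxE /= in H.
  rewrite -/i1 -/i2 -/i3 -/w0 -/w1 -/w2 -/w3 -/a -/c -/n lapE in H.
  have Ez : dz (compC f i) q = (real_complex R ('D_(dirx R) f q i 0)
      - iC R * real_complex R ('D_(diry R) f q i 0)) / 2 by rewrite /dz dfx dfy.
  have Eb : dzb (compC f i) q = (real_complex R ('D_(dirx R) f q i 0)
      + iC R * real_complex R ('D_(diry R) f q i 0)) / 2 by rewrite /dzb dfx dfy.
  by rewrite Ez Eb in H; exact: alg H.
have [e0 e1 e2 e3] := complex_independent Dq row.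
have two0 : 2 != 0 :> R[i] by rewrite pnatr_eq0.
have four0 : 4 != 0 :> R[i] by rewrite pnatr_eq0.
have i0 : iC R != 0 by rewrite eq_complex /= oner_eq0 andbF.
have w30 : w3 = 0.
  by move/eqP: e3; rewrite mulf_eq0 invr_eq0 (negPf four0) orbF => /eqP.
move/eqP: e1; rewrite mulf_eq0 invr_eq0 (negPf two0) orbF w30 mulr0 subr0 => /eqP e1.
move/eqP: e2; rewrite !mulf_eq0 invr_eq0 (negPf two0) (negPf i0) orbF /= w30 mulr0 addr0.
rewrite subr_eq0 => /eqP e2.
have w10 : w1 = 0.
  move/eqP: e1; rewrite e2 -mulr2n -mulr_natl mulf_eq0 (negPf two0) => /eqP.
  by [].
have w20 : w2 = 0 by rewrite e2.
have w00 : w0 = 0 by move: e0; rewrite w10 w20 w30 !mulr0 !subr0 addr0.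
apply/matrixP => -[[|[|[|[|//]]]] lt4] j; rewrite ord1 [RHS]mxE.
- by rewrite -w00; congr (w _ 0); apply: val_inj.
- by rewrite -w10; congr (w _ 0); apply: val_inj.
- by rewrite -w20; congr (w _ 0); apply: val_inj.
- by rewrite -w30; congr (w _ 0); apply: val_inj.
Qed.

End Independence.

(** * Directional derivatives of matrix functions *)

Section MatrixCalculus.
Variables (R : realType) (D : set (R * R)).
Hypothesis openD : open D.
Local Notation C := R[i].

Lemma isdmx_mx4 (s sz sb : R * R -> seq (seq C)) :
  (forall i j : 'I_4, isd D (fun q => nth 0 (nth [::] (s q) i) j)
    (fun q => nth 0 (nth [::] (sz q) i) j) (fun q => nth 0 (nth [::] (sb q) i) j)) ->
  isdmx D (fun q => mx4 (s q)) (fun q => mx4 (sz q)) (fun q => mx4 (sb q)).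
Proof. by move=> H i j; apply: (eq_isd openD (H i j)) => q _; rewrite mxE. Qed.

Lemma isdmxZ m n (c : C) (A Az Ab : R * R -> 'M[C]_(m, n)) : isdmx D A Az Ab ->
  isdmx D (fun q => c *: A q) (fun q => c *: Az q) (fun q => c *: Ab q).
Proof.
move=> dA i j; apply: (eq_isd openD (isdM openD (isd_cst D c) (dA i j))) => q _;
by rewrite mxE // mul0r add0r.
Qed.

Lemma dmxC_isdmx m n (A Az Ab : R * R -> 'M[C]_(m, n)) q v : isdmx D A Az Ab -> D q ->
  dmxC v A q = Complex v.1 v.2 *: Az q + Complex v.1 (- v.2) *: Ab q.
Proof.
by move=> dA Dq; apply/matrixP => i j; rewrite !mxE (dC_direction _ openD (dA i j) Dq).
Qed.

End MatrixCalculus.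

(** * The involution [tau1] and the real form [G] *)

Section FourByFour.
Variable R : realType.
Local Notation C := R[i].

(** [J1] reverses the indices, so [tau1] is minus the reflection in the antidiagonal. *)
Lemma tau1E (X : 'M[C]_4) i j : tau1 X i j = - X (rev_ord j) (rev_ord i).
Proof.
rewrite /tau1 mxE !mulmx4E !mxE; congr (- _).
by move: i j => [[|[|[|[|//]]]] ?] [[|[|[|[|//]]]] ?] /=;
  rewrite !(mul0r, mul1r, mulr0, mulr1, add0r, addr0); congr (X _ _); apply: val_inj.
Qed.

(** Conjugation fixes [f] and [eta] and exchanges [f_1] and [f_2]. Membership of [X] in the real
    form is expressed by [cmx X = swap23 *m X *m swap23]. *)
Definition swap23 : 'M[C]_4 :=
  mx4 [:: [:: 1; 0; 0; 0]; [:: 0; 0; 1; 0]; [:: 0; 1; 0; 0]; [:: 0; 0; 0; 1]].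

Definition cmx m n (A : 'M[C]_(m, n)) : 'M[C]_(m, n) := map_mx (@conjc R) A.

Lemma cmxM m n p (A : 'M[C]_(m, n)) (B : 'M[C]_(n, p)) : cmx (A *m B) = cmx A *m cmx B.
Proof. exact: map_mxM. Qed.
Lemma cmxD m n (A B : 'M[C]_(m, n)) : cmx (A + B) = cmx A + cmx B.
Proof. exact: map_mxD. Qed.
Lemma cmxZ m n c (A : 'M[C]_(m, n)) : cmx (c *: A) = conjc c *: cmx A.
Proof. exact: map_mxZ. Qed.
Lemma cmxV n (A : 'M[C]_n) : cmx (invmx A) = invmx (cmx A).
Proof. exact: map_invmx. Qed.

Lemma swap23K : swap23 *m swap23 = 1%:M.
Proof.
apply/matrixP => -[[|[|[|[|//]]]] ?] [[|[|[|[|//]]]] ?]; rewrite mulmx4E !mxE /=;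
by rewrite !(mul0r, mul1r, mulr0, mulr1, add0r, addr0).
Qed.

Lemma swap23_unit : swap23 \in unitmx.
Proof. by case: (mulmx1_unit swap23K). Qed.

Lemma swap23V : invmx swap23 = swap23.
Proof. by rewrite -[invmx _]mulmx1 -swap23K mulmxA mulVmx ?swap23_unit // mul1mx. Qed.

Definition swap_ord (i : 'I_4) : 'I_4 :=
  nth ord0 [:: ord0; lift ord0 (lift ord0 ord0); lift ord0 ord0;
               lift ord0 (lift ord0 (lift ord0 ord0))] i.

Lemma swap23_conj (X Y : 'M[C]_4) :
  (forall i j, X i j = Y (swap_ord i) (swap_ord j)) -> X = swap23 *m Y *m swap23.
Proof.
move=> H; apply/matrixP => i j; rewrite mulmx4E !mulmx4E !mxE H.
by move: i j => [[|[|[|[|//]]]] ?] [[|[|[|[|//]]]] ?] /=;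
  rewrite !(mul0r, mul1r, mulr0, mulr1, add0r, addr0).
Qed.

Lemma sqrt2_sqr : real_complex R (Num.sqrt 2) * real_complex R (Num.sqrt 2) = 2 :> C.
Proof. by rewrite -rmorphM -expr2 sqr_sqrtr ?ler0n // rmorph_nat. Qed.

Lemma Lmx_conj : cmx (Lmx R) = Lmx R *m swap23.
Proof.
have ci : conjc (iC R) = - iC R by apply/eqP; rewrite eq_complex /= oppr0 !eqxx.
rewrite /Lmx cmxZ conjcV conjc_real -scalemxAl; congr (_ *: _).
apply/matrixP => -[[|[|[|[|//]]]] ?] [[|[|[|[|//]]]] ?]; rewrite mulmx4E !mxE /=;
  rewrite !(mul0r, mul1r, mulr0, mulr1, add0r, addr0) ?conjc0 ?conjc1 ?conjc_real //.
  all: by rewrite ?conjcN ?ci ?opprK.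
Qed.

(** The conjugate transpose of [L], which is a unitary matrix. *)
Definition LmxV : 'M[C]_4 :=
  let s : C := real_complex R (Num.sqrt 2) in
  s^-1 *: mx4 [:: [:: s; 0; 0; 0]; [:: 0; - iC R; 1; 0]; [:: 0; iC R; 1; 0]; [:: 0; 0; 0; s]].

Lemma LmxVK : Lmx R *m LmxV = 1%:M.
Proof.
rewrite /Lmx /LmxV -scalemxAl -scalemxAr scalerA -invfM sqrt2_sqr.
have i2 : iC R * iC R = -1 by rewrite -expr2 sqr_i.
have two0 : 2 != 0 :> C by rewrite pnatr_eq0.
apply/matrixP => -[[|[|[|[|//]]]] ?] [[|[|[|[|//]]]] ?];
  rewrite mxE mulmx4E !mxE /= ?sqrt2_sqr;
  rewrite !(mul0r, mul1r, mulr0, mulr1, add0r, addr0, mulrN, mulNr, opprK, i2, subrr) //;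
  by rewrite ?addNr ?mulr0 -?(natrD C 1 1) ?mulVf.
Qed.

Lemma Lmx_unit : Lmx R \in unitmx. Proof. exact: (proj1 (mulmx1_unit LmxVK)). Qed.

(** Conjugating [L] and its inverse produces two permutation matrices, which cancel those in the
    hypothesis. *)
Lemma Lmx_real (X : 'M[C]_4) : cmx X = swap23 *m X *m swap23 ->
  cmx (Lmx R *m X *m invmx (Lmx R)) = Lmx R *m X *m invmx (Lmx R).
Proof.
move=> cX; rewrite !cmxM cmxV Lmx_conj cX.
have iM (A B : 'M[C]_4) : A \in unitmx -> B \in unitmx -> invmx (A *m B) = invmx B *m invmx A.
  move=> uA uB; have uAB : A *m B \in unitmx by rewrite unitmx_mul uA.
  apply: (can_inj (mulKmx uAB)); rewrite mulmxV // mulmxA mulmxK //.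
  by rewrite mulmxV.
rewrite iM ?Lmx_unit ?swap23_unit // swap23V !mulmxA.
rewrite -[Lmx R *m swap23 *m swap23]mulmxA swap23K mulmx1.
by rewrite -[Lmx R *m X *m swap23 *m swap23]mulmxA swap23K mulmx1.
Qed.

End FourByFour.

(** * Curvature of the family [alpha^lambda] *)

Section FlatConnections.
Variables (R : realType) (D : set (R * R)).
Hypothesis openD : open D.
Local Notation C := R[i].
Local Notation isd := (isd D).
Variables (f : R * R -> 'cV[R]_4) (b p : R * R -> C).
Hypothesis surf : definite_surface D f b p.
Local Notation a := (dlogz b).
Local Notation c := (dlogb b).
Local Notation P := (Pinv b p).
Local Notation k := (kinv b).
Local Notation bar u := (fun q => conjc (u q)).

Let sf : smooth D f. Proof. by case: surf => [] []. Qed.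
Let cs : canonical_system D f b p. Proof. by case: surf. Qed.
Let b0 q : D q -> b q != 0. Proof. by case: surf => _ _ _; exact. Qed.
Let sb : smoothC D b. Proof. by case: cs. Qed.
Let bc0 q : D q -> conjc (b q) != 0. Proof. by move=> Dq; rewrite conjc_eq0 b0. Qed.

Lemma surface_unit q : D q -> wilczynski f b q \in unitmx.
Proof. by case: surf => imm def _ _; exact: wilczynski_unit. Qed.

Let dP := isd_of (smooth_P openD cs b0).
Let dk := isd_of (smooth_k openD cs b0).
Let db := isd_of sb.
Let da := isd_of (smooth_dlogz openD cs b0).
Let dc := isd_of (smooth_dlogb openD cs b0).
Let dbc := isd_conj openD db.
Let dPc := isd_conj openD dP.
Let dkc := isd_conj openD dk.

Lemma kinv_conj q : D q -> dzb P q = conjc (dzb k q) + 2 * a q * conjc (k q).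
Proof.
move=> Dq; rewrite (gauss_codazzi openD sf cs b0 surface_unit Dq).
by rewrite (isd_z dkc Dq).
Qed.

Lemma kinvE q : D q -> dzb k q + 2 * c q * k q = conjc (dzb P q).
Proof.
move=> Dq; rewrite kinv_conj // (dlogz_conj openD cs Dq).
by move: (dzb k q) (c q) (k q) => x y z; rewrite !conjcE.
Qed.

Lemma dzb_bE q : D q -> dzb b q = 2 * b q * c q.
Proof. by move=> Dq; rewrite /dlogb; have h := b0 Dq; move: (dzb b q) (b q) h => x y ?; field. Qed.

Lemma conj_dzbE q : D q -> conjc (dzb b q) = 2 * conjc (b q) * a q.
Proof.
move=> Dq; rewrite dzb_bE // (dlogz_conj openD cs Dq).
by move: (c q) (b q) => x y; rewrite !conjcE.
Qed.

Definition minimality q : C := barC b q * dz P q + 2 * dz (barC b) q * P q.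

Lemma minimalityE q : D q ->
  minimality q = conjc (b q) * dz P q + 2 * conjc (dzb b q) * P q.
Proof. by move=> Dq; rewrite /minimality (barP_dzb openD cs Dq). Qed.

(** For [U] and [V] the eigenparts of [tau1] are the diagonal and the off-diagonal part: the latter
    is symmetric in the antidiagonal, the former antisymmetric. *)
Definition Udiag q : 'M[C]_4 := diag_mx (\row_j nth 0 [:: a q; - a q; a q; - a q] j).
Definition Vdiag q : 'M[C]_4 := diag_mx (\row_j nth 0 [:: c q; c q; - c q; - c q] j).
Definition Uoff q : 'M[C]_4 := mx4
  [:: [:: 0; P q; k q; b q * conjc (P q)]; [:: 1; 0; 0; k q];
      [:: 0; b q; 0; P q]; [:: 0; 0; 1; 0]].
Definition Voff q : 'M[C]_4 := mx4
  [:: [:: 0; conjc (k q); conjc (P q); conjc (b q) * P q];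
      [:: 0; 0; conjc (b q); conjc (P q)]; [:: 1; 0; 0; conjc (k q)]; [:: 0; 1; 0; 0]].

Lemma UmxE q : Umx b p q = Udiag q + Uoff q.
Proof.
by apply/matrixP => -[[|[|[|[|//]]]] ?] [[|[|[|[|//]]]] ?];
  rewrite !mxE /= ?(mulr1n, mulr0n, addr0, add0r).
Qed.

Lemma VmxE q : Vmx b p q = Vdiag q + Voff q.
Proof.
by apply/matrixP => -[[|[|[|[|//]]]] ?] [[|[|[|[|//]]]] ?];
  rewrite !mxE /= ?(mulr1n, mulr0n, addr0, add0r).
Qed.

Lemma parts_of (X Y : 'M[C]_4) : tau1 X = X -> tau1 Y = - Y ->
  k_part (X + Y) = X /\ Defs.p_part (X + Y) = Y.
Proof.
move=> tX tY.
have tXY : tau1 (X + Y) = X - Y.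
  have E i j : tau1 (X + Y) i j = tau1 X i j + tau1 Y i j.
    apply: (etrans (tau1E (X + Y) i j)); apply: esym.
    apply: (etrans (congr2 +%R (tau1E X i j) (tau1E Y i j))).
    by rewrite mxE opprD.
  by apply/matrixP => i j; rewrite E tX tY [RHS]mxE.
rewrite /k_part /Defs.p_part tXY; split; apply/matrixP => i j; rewrite !mxE;
by move: (X i j) (Y i j) => x y; field.
Qed.

Lemma Uparts q : k_part (Umx b p q) = Udiag q /\ Defs.p_part (Umx b p q) = Uoff q.
Proof.
rewrite UmxE; apply: parts_of; apply/matrixP => i j; rewrite ?[RHS]mxE tau1E !mxE;
by move: i j => [[|[|[|[|//]]]] ?] [[|[|[|[|//]]]] ?] /=; rewrite ?(mulr1n, mulr0n, opprK, oppr0).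
Qed.

Lemma Vparts q : k_part (Vmx b p q) = Vdiag q /\ Defs.p_part (Vmx b p q) = Voff q.
Proof.
rewrite VmxE; apply: parts_of; apply/matrixP => i j; rewrite ?[RHS]mxE tau1E !mxE;
by move: i j => [[|[|[|[|//]]]] ?] [[|[|[|[|//]]]] ?] /=; rewrite ?(mulr1n, mulr0n, opprK, oppr0).
Qed.

Lemma UlamE lam q : Ulam b p lam q = Udiag q + lam^-1 *: Uoff q.
Proof. by rewrite /Ulam; have [-> ->] := Uparts q. Qed.

Lemma VlamE lam q : Vlam b p lam q = Vdiag q + lam *: Voff q.
Proof. by rewrite /Vlam; have [-> ->] := Vparts q. Qed.

Definition Uoffz q : 'M[C]_4 := mx4
  [:: [:: 0; dz P q; dz k q; dz b q * conjc (P q) + b q * conjc (dzb P q)];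
      [:: 0; 0; 0; dz k q]; [:: 0; dz b q; 0; dz P q]; [:: 0; 0; 0; 0]].
Definition Uoffb q : 'M[C]_4 := mx4
  [:: [:: 0; dzb P q; dzb k q; dzb b q * conjc (P q) + b q * conjc (dz P q)];
      [:: 0; 0; 0; dzb k q]; [:: 0; dzb b q; 0; dzb P q]; [:: 0; 0; 0; 0]].
Definition Voffz q : 'M[C]_4 := mx4
  [:: [:: 0; conjc (dzb k q); conjc (dzb P q);
          conjc (dzb b q) * P q + conjc (b q) * dz P q];
      [:: 0; 0; conjc (dzb b q); conjc (dzb P q)]; [:: 0; 0; 0; conjc (dzb k q)];
      [:: 0; 0; 0; 0]].
Definition Voffb q : 'M[C]_4 := mx4
  [:: [:: 0; conjc (dz k q); conjc (dz P q);
          conjc (dz b q) * P q + conjc (b q) * dzb P q];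
      [:: 0; 0; conjc (dz b q); conjc (dz P q)]; [:: 0; 0; 0; conjc (dz k q)];
      [:: 0; 0; 0; 0]].

Lemma isd_Uoff : isdmx D Uoff Uoffz Uoffb.
Proof.
apply: (isdmx_mx4 openD); have d0 := isd_cst D 0; have d1 := isd_cst D 1.
have dbP := isdM openD db dPc.
move=> [[|[|[|[|//]]]] ?] [[|[|[|[|//]]]] ?]; [> exact: d0 | exact: dP | exact: dk
  | exact: dbP | exact: d1 | exact: d0 | exact: d0 | exact: dk | exact: d0 | exact: db
  | exact: d0 | exact: dP | exact: d0 | exact: d0 | exact: d1 | exact: d0].
Qed.

Lemma isd_Voff : isdmx D Voff Voffz Voffb.
Proof.
apply: (isdmx_mx4 openD); have d0 := isd_cst D 0; have d1 := isd_cst D 1.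
have dbP := isdM openD dbc dP.
move=> [[|[|[|[|//]]]] ?] [[|[|[|[|//]]]] ?]; [> exact: d0 | exact: dkc | exact: dPc
  | exact: dbP | exact: d0 | exact: d0 | exact: dbc | exact: dPc | exact: d1 | exact: d0
  | exact: d0 | exact: dkc | exact: d0 | exact: d1 | exact: d0 | exact: d0].
Qed.

(** In [V_z - U_zb + [U, V]] for the family, [- EU] is the coefficient of [lam^-1] and [EV] that of
    [lam]. [EU] is also the [zb]-derivative of [Uoff] covariant with respect to [Vdiag], the form in
    which the tension field produces it. *)
Definition EU q := Uoffb q + (Vdiag q *m Uoff q - Uoff q *m Vdiag q).
Definition EV q := Voffz q + (Udiag q *m Voff q - Voff q *m Udiag q).

(** The bracket with the diagonal part adds multiples of [2 * c]. It annihilates the entry of [b] by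
    definition of [c], turns the entries of [k] into the conjugate of [P_zb] by the Codazzi
    equation, leaves [P_zb] unchanged, and completes the corner to the conjugate of [minimality]. *)
Lemma EUE q : D q -> EU q = mx4
  [:: [:: 0; dzb P q; conjc (dzb P q); conjc (minimality q)];
      [:: 0; 0; 0; conjc (dzb P q)]; [:: 0; 0; 0; dzb P q]; [:: 0; 0; 0; 0]].
Proof.
move=> Dq; have m' : conjc (minimality q) =
    dzb b q * conjc (P q) + b q * conjc (dz P q) + 2 * c q * (b q * conjc (P q)).
  rewrite minimalityE // [X in _ = _ + X](_ : _ = dzb b q * conjc (P q)).
    by move: (dzb b q) (b q) (P q) (dz P q) => x1 x2 x3 x4; rewrite !conjcE; ring.
  by rewrite dzb_bE //; move: (b q) (c q) (conjc _) => *; ring.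
rewrite m' -(kinvE Dq) /EU /Uoffb (dzb_bE Dq) /Vdiag mul_diag_mx mul_mx_diag.
apply/matrixP => -[[|[|[|[|//]]]] ?] [[|[|[|[|//]]]] ?]; rewrite !mxE /=;
generalize (dzb P q) (conjc (P q)) (conjc (dz P q)) (P q) (dzb k q) (k q) (b q) (c q);
by move=> *; ring.
Qed.

Lemma EVE q : D q -> EV q = mx4
  [:: [:: 0; dzb P q; conjc (dzb P q); minimality q];
      [:: 0; 0; 0; conjc (dzb P q)]; [:: 0; 0; 0; dzb P q]; [:: 0; 0; 0; 0]].
Proof.
move=> Dq; have m' : minimality q =
    conjc (dzb b q) * P q + conjc (b q) * dz P q + 2 * a q * (conjc (b q) * P q).
  rewrite minimalityE // conj_dzbE //; move: (conjc (b q)) (a q) (P q) (dz P q).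
  by move=> *; ring.
have kC : conjc (dzb k q) = dzb P q - 2 * a q * conjc (k q).
  by rewrite kinv_conj // addrK.
rewrite m' /EV /Voffz kC (conj_dzbE Dq) /Udiag mul_diag_mx mul_mx_diag.
apply/matrixP => -[[|[|[|[|//]]]] ?] [[|[|[|[|//]]]] ?]; rewrite !mxE /=;
generalize (dzb P q) (conjc (dzb P q)) (conjc (k q)) (P q) (dz P q) (conjc (P q)) (conjc (b q)) (a q);
by move=> *; ring.
Qed.

Definition holP q := dzb P q = 0 /\ minimality q = 0.

Lemma EU0P q : D q -> EU q = 0 <-> holP q.
Proof.
move=> Dq; rewrite EUE //; split=> [/matrixP E|[-> ->]].
  have := E ord0 ord_max; rewrite !mxE /= => /eqP; rewrite conjc_eq0 => /eqP m0.
  by have := E ord0 (lift ord0 ord0); rewrite !mxE /= => P0.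
by apply/matrixP => -[[|[|[|[|//]]]] ?] [[|[|[|[|//]]]] ?]; rewrite !mxE /= ?conjc0.
Qed.

Lemma EV0 q : D q -> holP q -> EV q = 0.
Proof.
move=> Dq; rewrite EVE // => -[-> ->].
by apply/matrixP => -[[|[|[|[|//]]]] ?] [[|[|[|[|//]]]] ?]; rewrite !mxE /= ?conjc0.
Qed.

Let smooth_opp u : smoothC D u -> smoothC D (fun q => - u q).
Proof. by move=> /isd_of /(isdN openD) []. Qed.

Lemma isd_Udiag : isdmx D Udiag (mx_of Udiag (@dz R)) (mx_of Udiag (@dzb R)).
Proof.
apply: (isdmx_of openD) => i j.
have sa := smooth_dlogz openD cs b0; have sna := smooth_opp sa.
have s0 := smoothC_cst D 0.
apply: (eq_smoothC openD (u := fun q => (nth 0 [:: a q; - a q; a q; - a q] i) *+ (i == j))).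
  by move=> q _; rewrite !mxE.
by move: i j => [[|[|[|[|//]]]] ?] [[|[|[|[|//]]]] ?].
Qed.

Lemma isd_Vdiag : isdmx D Vdiag (mx_of Vdiag (@dz R)) (mx_of Vdiag (@dzb R)).
Proof.
apply: (isdmx_of openD) => i j.
have sa := smooth_dlogb openD cs b0; have sna := smooth_opp sa.
have s0 := smoothC_cst D 0.
apply: (eq_smoothC openD (u := fun q => (nth 0 [:: c q; c q; - c q; - c q] i) *+ (i == j))).
  by move=> q _; rewrite !mxE.
by move: i j => [[|[|[|[|//]]]] ?] [[|[|[|[|//]]]] ?].
Qed.

Lemma isd_Umx : isdmx D (Umx b p) (fun q => mx_of Udiag (@dz R) q + Uoffz q)
  (fun q => mx_of Udiag (@dzb R) q + Uoffb q).
Proof.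
by apply: (eq_isdmx openD (isdmxD openD isd_Udiag isd_Uoff)) => // q _; rewrite UmxE.
Qed.

Lemma isd_Vmx : isdmx D (Vmx b p) (fun q => mx_of Vdiag (@dz R) q + Voffz q)
  (fun q => mx_of Vdiag (@dzb R) q + Voffb q).
Proof.
by apply: (eq_isdmx openD (isdmxD openD isd_Vdiag isd_Voff)) => // q _; rewrite VmxE.
Qed.

Lemma compatibility_split q : D q ->
  mx_of Udiag (@dzb R) q + Uoffb q + (Vdiag q + Voff q) *m (Udiag q + Uoff q) =
  mx_of Vdiag (@dz R) q + Voffz q + (Udiag q + Uoff q) *m (Vdiag q + Voff q).
Proof.
move=> Dq; have E := compatibility openD sf cs b0 surface_unit Dq.
rewrite -UmxE -VmxE.
have [_ <-] := isdmx_uniq (isdmx_of openD (smooth_Umx openD cs b0)) isd_Umx Dq.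
by have [<- _] := isdmx_uniq (isdmx_of openD (smooth_Vmx openD cs b0)) isd_Vmx Dq.
Qed.

Definition lam_curvature lam q : 'M[C]_4 :=
  mx_of Vdiag (@dz R) q + lam *: Voffz q - (mx_of Udiag (@dzb R) q + lam^-1 *: Uoffb q)
  + (Ulam b p lam q *m Vlam b p lam q - Vlam b p lam q *m Ulam b p lam q).

(** The curvature is a Laurent polynomial in [lam] with terms of degrees -1, 0 and 1. Its vanishing
    at [lam = 1] is the compatibility condition of the surface and eliminates the term of degree
    0. *)
Lemma lam_curvatureE lam q : lam != 0 -> D q ->
  lam_curvature lam q = (lam - 1) *: EV q + (1 - lam^-1) *: EU q.
Proof.
move=> l0 Dq; have := compatibility_split Dq; rewrite /lam_curvature UlamE VlamE /EU /EV.
rewrite !mulmxDl !mulmxDr -?scalemxAl -?scalemxAr ?scalerA.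
move: (mx_of Udiag _ q) (mx_of Vdiag _ q) (Uoffb q) (Voffz q).
move: (Udiag q *m Vdiag q) (Udiag q *m Voff q) (Uoff q *m Vdiag q) (Uoff q *m Voff q).
move: (Vdiag q *m Udiag q) (Voff q *m Udiag q) (Vdiag q *m Uoff q) (Voff q *m Uoff q).
move=> A1 A2 A3 A4 A5 A6 A7 A8 A9 A10 A11 A12 E; apply/matrixP => i j.
move/matrixP: E => /(_ i j); rewrite !mxE.
move: (A1 i j) (A2 i j) (A3 i j) (A4 i j) (A5 i j) (A6 i j) (A7 i j) (A8 i j)
  (A9 i j) (A10 i j) (A11 i j) (A12 i j).
move=> x1 x2 x3 x4 x5 x6 x7 x8 x9 x10 x11 x12 /eqP; rewrite -subr_eq0 => /eqP E.
by apply/eqP; rewrite -subr_eq0; apply/eqP; rewrite -[RHS]oppr0 -E; field.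
Qed.

Definition Ulamz lam q : 'M[C]_4 := mx_of Udiag (@dz R) q + lam^-1 *: Uoffz q.
Definition Ulamb lam q : 'M[C]_4 := mx_of Udiag (@dzb R) q + lam^-1 *: Uoffb q.
Definition Vlamz lam q : 'M[C]_4 := mx_of Vdiag (@dz R) q + lam *: Voffz q.
Definition Vlamb lam q : 'M[C]_4 := mx_of Vdiag (@dzb R) q + lam *: Voffb q.

Lemma isd_Ulam lam : isdmx D (Ulam b p lam) (Ulamz lam) (Ulamb lam).
Proof.
have dU := isdmxD openD isd_Udiag (isdmxZ openD lam^-1 isd_Uoff).
apply: (eq_isdmx openD dU) => [q _|//|//]; apply: esym; exact: UlamE.
Qed.

Lemma isd_Vlam lam : isdmx D (Vlam b p lam) (Vlamz lam) (Vlamb lam).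
Proof.
have dV := isdmxD openD isd_Vdiag (isdmxZ openD lam isd_Voff).
apply: (eq_isdmx openD dV) => [q _|//|//]; apply: esym; exact: VlamE.
Qed.

(** The scalar factor is the value of the two-form [dz /\ dzb] on the two vectors; terms symmetric
    in them cancel. *)
Let curvature_alg (n n' o o' : C) (Uz Ub Vz Vb U V : 'M[C]_4) :
  n *: (o *: Uz + o' *: Vz) + n' *: (o *: Ub + o' *: Vb)
  - (o *: (n *: Uz + n' *: Vz) + o' *: (n *: Ub + n' *: Vb))
  + ((n *: U + n' *: V) *m (o *: U + o' *: V) - (o *: U + o' *: V) *m (n *: U + n' *: V)) =
  (n * o' - n' * o) *: (Vz - Ub + (U *m V - V *m U)).
Proof.
rewrite !mulmxDl !mulmxDr -?scalemxAl -?scalemxAr ?scalerA.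
move: (U *m U) (U *m V) (V *m U) (V *m V) => A1 A2 A3 A4.
apply/matrixP => i j; rewrite !mxE.
move: (A1 i j) (A2 i j) (A3 i j) (A4 i j) (Uz i j) (Ub i j) (Vz i j) (Vb i j).
by move=> *; ring.
Qed.

Lemma curvatureE lam q v w : D q -> curvature (alpha b p lam) q v w =
  (Complex v.1 v.2 * Complex w.1 (- w.2) - Complex v.1 (- v.2) * Complex w.1 w.2)
    *: lam_curvature lam q.
Proof.
move=> Dq.
have dal (x : R * R) := isdmxD openD (isdmxZ openD (Complex x.1 x.2) (isd_Ulam lam))
    (isdmxZ openD (Complex x.1 (- x.2)) (isd_Vlam lam)).
have dmE x y : dmxC y (fun q => alpha b p lam q x) q = _ :=
  dmxC_isdmx openD y (dal x) Dq.
rewrite /curvature !dmE; exact: curvature_alg.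
Qed.

Lemma curvature0P lam q : D q ->
  (forall v w, curvature (alpha b p lam) q v w = 0) <-> lam_curvature lam q = 0.
Proof.
move=> Dq; split=> [H|H v w]; last by rewrite curvatureE // H scaler0.
(* On the coordinate fields the scalar factor is [- 2 i], hence nonzero. *)
have := H (dirx R) (diry R); rewrite curvatureE //= => /eqP; rewrite scaler_eq0.
case/orP => [|/eqP //]; rewrite eq_complex /= => /andP[_].
rewrite !(mul0r, mul1r, mulr0, mulr1, add0r, addr0, oppr0).
by rewrite -opprD oppr_eq0 -(natrD R 1 1) pnatr_eq0.
Qed.

Let acE q : D q -> conjc (a q) = c q.
Proof. by move=> Dq; rewrite (dlogz_conj openD cs Dq) conjcK. Qed.

Lemma cmx_Udiag q : D q -> cmx (Udiag q) = swap23 R *m Vdiag q *m swap23 R.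
Proof.
move=> Dq; apply: swap23_conj => i j; rewrite !mxE.
by move: i j => [[|[|[|[|//]]]] ?] [[|[|[|[|//]]]] ?];
  rewrite /= ?mulr1n ?mulr0n ?conjcN ?acE // conjc0.
Qed.

Lemma cmx_Uoff q : cmx (Uoff q) = swap23 R *m Voff q *m swap23 R.
Proof.
apply: swap23_conj => i j; rewrite !mxE.
by move: i j => [[|[|[|[|//]]]] ?] [[|[|[|[|//]]]] ?];
  rewrite /= ?conjc0 ?conjc1 // conjcM conjcK.
Qed.

Let swapK (X Y : 'M[C]_4) : cmx X = swap23 R *m Y *m swap23 R ->
  cmx Y = swap23 R *m X *m swap23 R.
Proof.
move=> /(congr1 (@cmx R _ _)).
have cK m n (A : 'M[C]_(m, n)) : cmx (cmx A) = A.
  by apply/matrixP => i j; rewrite !mxE conjcK.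
have cs23 : cmx (swap23 R) = swap23 R.
  by apply/matrixP => -[[|[|[|[|//]]]] ?] [[|[|[|[|//]]]] ?]; rewrite !mxE /= ?conjc0 ?conjc1.
rewrite cK !cmxM cs23 => ->; rewrite !mulmxA swap23K mul1mx -mulmxA swap23K mulmx1.
by [].
Qed.

(** Unimodularity enters as [conjc lam^-1 = lam], which keeps the family in the real form. *)
Lemma cmx_Ulam lam q : `|lam| = 1 -> D q ->
  cmx (Ulam b p lam q) = swap23 R *m Vlam b p lam q *m swap23 R.
Proof.
move=> l1 Dq; have lc : conjc lam^-1 = lam.
  rewrite conjcV; have := sqr_normc lam; rewrite l1 expr1n => lc.
  have cl0 : conjc lam != 0 by rewrite conjc_eq0 -normr_eq0 l1 oner_eq0.
  by apply: (mulIf cl0); rewrite mulVf.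
rewrite UlamE VlamE cmxD cmxZ lc cmx_Udiag // cmx_Uoff mulmxDr mulmxDl.
by rewrite -scalemxAr -scalemxAl.
Qed.

Lemma alpha_gLie lam q v : `|lam| = 1 -> D q -> gLie (alpha b p lam q v).
Proof.
move=> l1 Dq; split.
  have tr4 (A : 'M[C]_4) : \tr A = A ord0 ord0 + (A (lift ord0 ord0) (lift ord0 ord0)
      + (A (lift ord0 (lift ord0 ord0)) (lift ord0 (lift ord0 ord0))
      + A (lift ord0 (lift ord0 (lift ord0 ord0))) (lift ord0 (lift ord0 (lift ord0 ord0))))).
    by rewrite /mxtrace !big_ord_recl big_ord0 addr0.
  have trU0 : \tr (Udiag q) = 0.
    by rewrite tr4 !mxE /= !mulr1n; move: (a q) => x; ring.
  have trV0 : \tr (Vdiag q) = 0.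
    by rewrite tr4 !mxE /= !mulr1n; move: (c q) => x; ring.
  have trU1 : \tr (Uoff q) = 0 by rewrite tr4 !mxE /= !addr0.
  have trV1 : \tr (Voff q) = 0 by rewrite tr4 !mxE /= !addr0.
  have trU : \tr (Ulam b p lam q) = 0.
    by rewrite UlamE mxtraceD mxtraceZ trU0 trU1 mulr0 addr0.
  have trV : \tr (Vlam b p lam q) = 0.
    by rewrite VlamE mxtraceD mxtraceZ trV0 trV1 mulr0 addr0.
  have gen (x y : C) (A B : 'M[C]_4) : \tr A = 0 -> \tr B = 0 -> \tr (x *: A + y *: B) = 0.
    by move=> tA tB; rewrite mxtraceD !mxtraceZ tA tB !mulr0 addr0.
  exact: gen trU trV.
have cal : cmx (alpha b p lam q v) = swap23 R *m alpha b p lam q v *m swap23 R.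
  have gen (A B : 'M[C]_4) : cmx A = swap23 R *m B *m swap23 R ->
      cmx (Complex v.1 v.2 *: A + Complex v.1 (- v.2) *: B) =
      swap23 R *m (Complex v.1 v.2 *: A + Complex v.1 (- v.2) *: B) *m swap23 R.
    move=> cA; have cB := swapK cA.
    rewrite cmxD !cmxZ cA cB mulmxDr mulmxDl -!scalemxAr -!scalemxAl addrC.
    by rewrite /conjc opprK.
  exact: gen (cmx_Ulam l1 Dq).
move=> i j; have := Lmx_real cal; move/matrixP => /(_ i j); rewrite [LHS]mxE.
case: (_ i j) => x y; rewrite /conjc => -[/eqP].
by rewrite eq_sym -subr_eq0 opprK -mulr2n mulrn_eq0 /= => /eqP.
Qed.

Lemma flat_holP : (forall lam : C, `|lam| = 1 -> flat_connection D (alpha b p lam)) <->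
  (forall q, D q -> holP q).
Proof.
have n0 (lam : C) : `|lam| = 1 -> lam != 0.
  by move=> l1; rewrite -normr_eq0 l1 oner_eq0.
split=> [flat q Dq|hol lam l1].
  have K0 lam : `|lam| = 1 -> (lam - 1) *: EV q + (1 - lam^-1) *: EU q = 0.
    move=> l1; rewrite -(lam_curvatureE (n0 _ l1) Dq).
    by apply/(curvature0P lam Dq) => v w; have [_] := flat lam l1; exact.
  (* Two parameters suffice: [lam = -1] gives [EU = EV], and then [lam = i] gives
     [2 * i * EU = 0]. *)
  have i1 : `|iC R| = 1 by rewrite normc_def /= expr0n expr1n add0r sqrtr1.
  have i2 : iC R * iC R = -1 by rewrite -expr2 sqr_i.
  have iV : (iC R)^-1 = - iC R.
    by apply: (mulfI (n0 _ i1)); rewrite mulfV ?n0 // mulrN i2 opprK.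
  have l1 : `|- 1 : C| = 1 by rewrite normrN normr1.
  have E1 := K0 _ l1; rewrite invrN invr1 in E1.
  have E2 := K0 _ i1; rewrite iV in E2.
  have gen (X Y : 'M[C]_4) : (-1 - 1) *: Y + (1 - -1) *: X = 0 ->
      (iC R - 1) *: Y + (1 - - iC R) *: X = 0 -> X = 0.
    move=> /matrixP e1 /matrixP e2; apply/matrixP => i j; move: (e1 i j) (e2 i j).
    rewrite !mxE; move: (X i j) (Y i j) => x y {}e1 {}e2.
    have two0 : 2 != 0 :> C by rewrite pnatr_eq0.
    have xy : y = x.
      apply: (mulfI two0); apply/eqP; rewrite -subr_eq0; apply/eqP.
      by rewrite -[RHS]oppr0 -e1; ring.
    have : 2 * iC R * x = 0 by rewrite -e2 xy; ring.
    by move/eqP; rewrite !mulf_eq0 (negPf two0) (negPf (n0 _ i1)) /= => /eqP.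
  by apply/(EU0P Dq); exact: gen E1 E2.
split=> [q v Dq|q v w Dq]; first exact: alpha_gLie.
have L0 : lam_curvature lam q = 0.
  apply: (etrans (lam_curvatureE (n0 _ l1) Dq)).
  have EV00 := EV0 Dq (hol q Dq); have EU00 := (EU0P Dq).2 (hol q Dq).
  by move: (EV q) (EU q) EV00 EU00 => X Y -> ->; rewrite !scaler0 addr0.
exact: ((curvature0P lam Dq).2 L0 v w).
Qed.

End FlatConnections.

(** * Demoulin and projective minimal coincidence surfaces *)

Section Classification.
Variables (R : realType) (D : set (R * R)).
Hypotheses (openD : open D) (connD : connected D).
Local Notation C := R[i].
Local Notation isd := (isd D).
Variables (f : R * R -> 'cV[R]_4) (b p : R * R -> C).
Hypothesis surf : definite_surface D f b p.
Local Notation a := (dlogz b).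
Local Notation c := (dlogb b).
Local Notation P := (Pinv b p).
Local Notation k := (kinv b).
Local Notation bar u := (fun q => conjc (u q)).

Let cs : canonical_system D f b p. Proof. by case: surf. Qed.
Let b0 q : D q -> b q != 0. Proof. by case: surf => _ _ _; exact. Qed.
Let sb : smoothC D b. Proof. by case: cs. Qed.
Let bc0 q : D q -> conjc (b q) != 0. Proof. by move=> Dq; rewrite conjc_eq0 b0. Qed.
Let dP := isd_of (smooth_P openD cs b0).
Let dk := isd_of (smooth_k openD cs b0).
Let db := isd_of sb.
Let da := isd_of (smooth_dlogz openD cs b0).
Let dc := isd_of (smooth_dlogb openD cs b0).
Let two0 : 2 != 0 :> C. Proof. by rewrite pnatr_eq0. Qed.

(* [t = 0] says that [X = (log b)_z,zb] vanishes, since [X = |b|^2 - 2 k]. *)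
Definition tfun q : C := b q * conjc (b q) - 2 * k q.

Lemma dz_tfun q : D q -> dz c q = tfun q / 2.
Proof.
move=> Dq; rewrite (dzlogb openD cs b0 Dq) /tfun.
by move: (b q) (conjc _) (k q) => x y z; field.
Qed.

(** As [bbar_z = 2 * bbar * a], the factor [bbar ^ 2] contributes [4 * a] to the logarithmic
    derivative. *)
Lemma coincidenceE q : D q ->
  dz_log (fun q => b q * barC b q ^+ 2) q = dz b q / b q + 4 * a q.
Proof.
move=> Dq; have dbc := isd_conj openD db.
have E : (fun q => b q * barC b q ^+ 2) = (fun q => b q * (conjc (b q) * conjc (b q))).
  by apply/funext => r; rewrite /barC expr2.
rewrite /dz_log E (isd_z (isdM openD db (isdM openD dbc dbc)) Dq) (conj_dzbE openD surf Dq) /=.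
rewrite [barC b q ^+ 2](_ : _ = conjc (b q) * conjc (b q)); last by rewrite /barC expr2.
move: (dz b q) (b q) (conjc (b q)) (a q) (b0 Dq) (bc0 Dq) => x y z w y0 z0.
by field; rewrite y0 z0.
Qed.

Lemma coincidenceP : coincidence D b <-> forall q, D q -> dz b q = - 4 * a q * b q.
Proof.
split=> H q Dq; have := coincidenceE Dq.
  rewrite H // => /esym/eqP; rewrite addr_eq0 => /eqP E.
  by rewrite -[LHS](divfK (b0 Dq)) E mulNr.
by move=> ->; rewrite H // mulfK ?b0 // mulNr addNr.
Qed.

Lemma coincidence_tfun q : coincidence D b -> D q -> tfun q = 0.
Proof.
move=> /coincidenceP H Dq.
have dlog : isd (fun q => dz b q / b q) (fun q => - 4 * dz a q) (fun q => - 4 * dzb a q).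
  have d4 := isdM openD (isd_cst D (- 4)) da.
  apply: (eq_isd openD d4) => r Dr; rewrite ?mul0r ?add0r //.
  by rewrite H // mulfK ?b0.
have tE : dzb (dz_log b) q = tfun q.
  rewrite /tfun /kinv sqr_normc; move: (dzb _ q) (b q) (conjc _) => x y z.
  by field.
have E : tfun q = - 4 * dzb a q by rewrite -tE (isd_b dlog Dq).
have E2 : dzb a q = conjc (tfun q) / 2.
  rewrite (isd_b (isd_dlogz openD cs b0) Dq) dz_tfun //.
  by move: (tfun q) => x; rewrite !conjcE.
rewrite E2 in E.
(* [E] now reads [t = - 2 * tbar]; comparing moduli forces [t = 0]. *)
have n : `|tfun q| = 2 * `|tfun q|.
  have nc : `|conjc (tfun q)| = `|tfun q|.
    by rewrite !normc_def; case: (tfun q) => x y /=; rewrite sqrrN.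
  rewrite {1}E (_ : - 4 * (conjc (tfun q) / 2) = - (2 * conjc (tfun q))).
    by rewrite normrN normrM nc normr_nat.
  by move: (conjc _) => x; field.
apply/eqP; rewrite -normr_eq0; move/eqP: n; rewrite mulr_natl mulr2n.
by rewrite -{1}[`|tfun q|]addr0 (inj_eq (addrI _)) eq_sym.
Qed.

Lemma dzb_k_of_tfun q : (forall r, D r -> tfun r = 0) -> D q ->
  dzb k q = (dzb b q * conjc (b q) + b q * conjc (dz b q)) / 2.
Proof.
move=> t0 Dq; have dbc := isd_conj openD db.
have dk' := isdM openD (isdM openD db dbc) (isd_cst D 2^-1).
have kE r : D r -> b r * conjc (b r) * 2^-1 = k r.
  move=> /t0; rewrite /tfun => /eqP; rewrite subr_eq0 => /eqP ->.
  by rewrite mulrC mulKf.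
have dk2 : isd k _ _ := eq_isd openD dk' kE (fun _ _ => erefl) (fun _ _ => erefl).
by rewrite (isd_b dk2 Dq) mulr0 addr0.
Qed.

(* When [k = |b|^2 / 2], [k_zb + 2 c k] is the conjugate of the logarithmic
   derivative of [b * bbar ^ 2] up to a factor. *)
Lemma dzb_P_of_tfun q : (forall r, D r -> tfun r = 0) -> D q ->
  conjc (dzb P q) = b q * conjc (dz b q + 4 * a q * b q) / 2.
Proof.
move=> t0 Dq; rewrite -(kinvE openD surf Dq) (dzb_k_of_tfun t0 Dq).
have kE : 2 * k q = b q * conjc (b q).
  by have := t0 q Dq; rewrite /tfun => /eqP; rewrite subr_eq0 => /eqP ->.
have -> : conjc (dz b q + 4 * a q * b q) = conjc (dz b q) + 4 * c q * conjc (b q).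
  rewrite (dlogz_conj openD cs Dq); move: (dz b q) (c q) (b q) => x y z.
  by rewrite !conjcE.
have -> : 2 * c q * k q = c q * (2 * k q) by move: (c q) (k q) => *; ring.
rewrite kE (dzb_bE surf Dq).
by move: (conjc (dz b q)) (c q) (b q) (conjc (b q)) => *; field.
Qed.

Lemma minimal_holP : projective_minimal D b p -> coincidence D b ->
  forall q, D q -> holP b p q.
Proof.
move=> pm co q Dq; split; last exact: pm.
have t0 r : D r -> tfun r = 0 by exact: coincidence_tfun.
have := dzb_P_of_tfun t0 Dq.
have -> : dz b q + 4 * a q * b q = 0 by rewrite (coincidenceP.1 co q Dq) !mulNr addNr.
by rewrite conjc0 mulr0 mul0r => /eqP; rewrite conjc_eq0 => /eqP.
Qed.

Lemma demoulin_holP : demoulin D b p -> forall q, D q -> holP b p q.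
Proof.
move=> dem q Dq.
have d0 : isd P (fun=> 0) (fun=> 0).
  by apply: (eq_isd openD (isd_cst D 0)) => // r Dr; rewrite dem.
split; first exact: (isd_b d0 Dq).
by rewrite /minimality (isd_z d0 Dq) dem // !mulr0 addr0.
Qed.

(* [|P|^2] solves a linear homogeneous first order system. *)
Lemma holP_vanish q0 : (forall q, D q -> holP b p q) -> D q0 -> P q0 = 0 ->
  forall q, D q -> P q = 0.
Proof.
move=> hol Dq0 P0 q Dq.
pose phi r := complex.Re (P r * conjc (P r)) : R^o.
have dPc := isd_conj openD dP.
have dN : isd (fun q => P q * conjc (P q)) (fun q => - 4 * a q * (P q * conjc (P q)))
    (fun q => - 4 * c q * (P q * conjc (P q))).
  have Pz r : D r -> dz P r = - 4 * a r * P r.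
    move=> Dr; have [_] := hol r Dr; rewrite (minimalityE openD surf Dr) (conj_dzbE openD surf Dr).
    move: (dz P r) (conjc (b r)) (a r) (P r) (bc0 Dr) => x y z w y0 E.
    apply: (mulfI y0); apply/eqP; rewrite -subr_eq0; apply/eqP; rewrite -[RHS]E; ring.
  apply: (eq_isd openD (isdM openD dP dPc)) => // r Dr.
  - have [Pb _] := hol r Dr; rewrite Pb conjc0 mulr0 addr0 Pz //.
    by move: (a r) (P r) (conjc _) => *; ring.
  - have [Pb _] := hol r Dr; rewrite Pb mul0r add0r Pz // (dlogz_conj openD cs Dr).
    by move: (c r) (P r) => x y; rewrite !conjcE; ring.
have [[sphi _] _] := dN.
have [cphi [dx dy _ _]] := sphi 1%N.
have real r : P r * conjc (P r) = real_complex R (phi r).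
  by rewrite /phi; case: (P r) => x y; apply/eqP; rewrite eq_complex /= eqxx /=; apply/eqP; ring.
have sa := smooth_dlogz openD cs b0; have sc := smooth_dlogb openD cs b0.
(* With [N = |P|^2] one has [N_x = (- 4 a - 4 c) N] and [N_y = i (- 4 a + 4 c) N]. Both coefficients
   are real because [a] and [c] are conjugate, so taking real parts loses nothing. *)
pose m1 r := complex.Re (- 4 * a r - 4 * c r) : R^o.
pose m2 r := complex.Re (iC R * (- 4 * a r + 4 * c r)) : R^o.
have dm1 := isdB openD (isdM openD (isd_cst D (- 4)) da) (isdM openD (isd_cst D 4) dc).
have dm2 := isdM openD (isd_cst D (iC R))
  (isdD openD (isdM openD (isd_cst D (- 4)) da) (isdM openD (isd_cst D 4) dc)).
have cm1 : {in D, continuous m1} by have [[/(_ 0%N) [cm _] _] _] := dm1; exact: cm.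
have cm2 : {in D, continuous m2} by have [[/(_ 0%N) [cm _] _] _] := dm2; exact: cm.
have reM (z : C) (x : R) : complex.Re (z * real_complex R x) = complex.Re z * x.
  by case: z => u v /=; rewrite mulr0 subr0.
have phiq : phi q = 0.
  apply: (vanish_connected openD connD cphi cm1 cm2 dx dy) Dq0 _ q Dq.
  - move=> r Dr; have [Ex _] := dC_isd dN Dr.
    have := congr1 (@complex.Re R) Ex; rewrite {1}/dC [X in X = _]/= => ->.
    rewrite -mulrDl real reM; congr (complex.Re _ * _).
    by move: (a r) (c r) => *; ring.
  - move=> r Dr; have [_ Ey] := dC_isd dN Dr.
    have := congr1 (@complex.Re R) Ey; rewrite {1}/dC [X in X = _]/= => ->.
    rewrite -mulrBl mulrA real reM; congr (complex.Re _ * _).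
    by move: (a r) (c r) (iC R) => *; ring.
  - by rewrite /phi P0 mul0r.
have := real q; rewrite phiq rmorph0 => /eqP; rewrite mulf_eq0 conjc_eq0 orbb.
by move/eqP.
Qed.

Lemma holP_coincidence : (forall q, D q -> holP b p q) ->
  (forall q, D q -> P q != 0) -> coincidence D b.
Proof.
move=> hol Pn0.
have Pz r : D r -> dz P r = - 4 * a r * P r.
  move=> Dr; have [_] := hol r Dr; rewrite (minimalityE openD surf Dr) (conj_dzbE openD surf Dr).
  move: (dz P r) (conjc (b r)) (a r) (P r) (bc0 Dr) => x y z w y0 E.
  apply: (mulfI y0); apply/eqP; rewrite -subr_eq0; apply/eqP; rewrite -[RHS]E; ring.
(* P holomorphic makes [a = - P_z / (4 P)] holomorphic. *)
have ab r : D r -> dzb a r = 0.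
  move=> Dr.
  have dP' : isd P (fun q => - 4 * a q * P q) (fun=> 0).
    by apply: (eq_isd openD dP) => // s Ds; have [] := hol s Ds.
  have dPz := isdM openD (isdM openD (isd_cst D (- 4)) da) dP'.
  (* The mixed derivative of [P] is zero when computed from [P_zb = 0], and [- 4 a_zb P] when
     computed from [P_z = - 4 a P]. *)
  have E := isd_mixed openD dP' dPz (isd_cst D 0) Dr.
  have : - 4 * dzb a r * P r = 0 by rewrite -[RHS]E /=; move: (dzb a r) (a r) (P r) => *; ring.
  have gen (x y : C) : - 4 * x * y = 0 -> y != 0 -> x = 0.
    move=> /eqP; rewrite !mulf_eq0 oppr_eq0 pnatr_eq0 /= => /orP[/eqP //|/eqP ->].
    by rewrite eqxx.
  by move=> /gen; apply; exact: Pn0.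
have t0 r : D r -> tfun r = 0.
  move=> Dr; have := ab r Dr; rewrite (isd_b (isd_dlogz openD cs b0) Dr) dz_tfun // => /eqP.
  by rewrite conjc_eq0 mulf_eq0 invr_eq0 (negPf two0) orbF => /eqP.
apply/coincidenceP => q Dq; have := dzb_P_of_tfun t0 Dq.
have [-> _] := hol q Dq; rewrite conjc0 => /esym/eqP.
rewrite !mulf_eq0 invr_eq0 (negPf two0) (negPf (b0 Dq)) orbF /= conjc_eq0 addr_eq0 => /eqP ->.
by rewrite !mulNr.
Qed.

Lemma class_holP q0 : D q0 ->
  (demoulin D b p \/ (projective_minimal D b p /\ coincidence D b)) <->
  (forall q, D q -> holP b p q).
Proof.
move=> Dq0; split=> [[dem|[pm co]]|hol].
- exact: demoulin_holP.
- exact: minimal_holP.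
have [z|nz] := pselect (exists2 q, D q & P q = 0).
  by left; have [q1 Dq1 P1] := z; exact: holP_vanish P1.
right; split; first by move=> q Dq; have [_] := hol q Dq.
by apply: holP_coincidence => // q Dq; apply/eqP => Pq; apply: nz; exists q.
Qed.

End Classification.

(** * Signature (3,1) and membership in the target space *)

Section Signature.
Variable R : realType.
Local Notation C := R[i].
Local Notation toC := (map_mx (real_complex R)).

Lemma toC_conj m n (A : 'M[R]_(m, n)) : cmx (toC A) = toC A.
Proof. by apply/matrixP => i j; rewrite !mxE conjc_real. Qed.

(* Together with symmetry and [det S = -1], this says that S has signature (3, 1). *)
Definition lorentzian (S : 'M[R]_4) := exists l : 'cV[C]_4,
  forall x : 'rV[C]_4, x *m l = 0 -> 0 <= (x *m toC S *m (cmx x)^T) 0 0.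

(** A congruence merely moves the hyperplane, replacing [l] by [A *m l]. Eigenvalues do not
    transform so simply, which motivates this description of the signature. *)
Lemma lorentzian_congr (S A : 'M[R]_4) : lorentzian S -> lorentzian (A *m S *m A^T).
Proof.
move=> [l lP]; exists (toC A *m l) => x xl.
have := lP (x *m toC A); rewrite -mulmxA xl => /(_ erefl).
by rewrite cmxM trmx_mul toC_conj !map_mxM map_trmx !mulmxA.
Qed.

Lemma lorentzian_J1hat : lorentzian (J1hat R).
Proof.
(* For [x_0 = 0] the cross terms of [x_0] and [x_3] disappear and the form is
   [|x_1|^2 + |x_2|^2]. *)
exists (delta_mx ord0 ord0) => x /matrixP /(_ 0 0) x0.
rewrite !mxE !big_ord_recl big_ord0 !mxE /= !(mulr0, addr0, mulr1) in x0.
rewrite [X in 0 <= X](_ : _ = x 0 (lift ord0 ord0) * conjc (x 0 (lift ord0 ord0))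
  + x 0 (lift ord0 (lift ord0 ord0)) * conjc (x 0 (lift ord0 (lift ord0 ord0)))).
  by rewrite addr_ge0 // mulcJ_ge0.
rewrite mxE !big_ord_recl big_ord0 !mxE !big_ord_recl !big_ord0 !mxE /= ?x0.
rewrite !(rmorph0 (real_complex R)) !(rmorph1 (real_complex R)) ?conjc0.
by rewrite !(mul0r, mulr0, addr0, add0r, mulr1).
Qed.

(** The complexified matrix is Hermitian, hence unitarily diagonalisable with real spectrum. The
    eigenvectors obtained are complex, which is why [lorentzian] tests complex rows. *)
Lemma spectral_real (S : 'M[R]_4) : S^T = S -> exists (d : 'I_4 -> R) (Q : 'M[C]_4),
  [/\ Q \in unitmx, (cmx Q)^T *m Q = 1%:M &
      toC S = (cmx Q)^T *m diag_mx (\row_i real_complex R (d i)) *m Q].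
Proof.
move=> Ssym.
have herm : toC S \is hermsymmx.
  apply/is_hermitianmxP; rewrite expr0 scale1r; apply/matrixP => i j.
  by rewrite !mxE /=; move/matrixP: Ssym => /(_ j i); rewrite mxE => ->; exact/esym/conjc_real.
have norm := hermitian_normalmx herm.
have /orthomx_spectralP E := norm.
have dreal := hermitian_spectral_diag_real herm.
set Q := spectralmx (toC S) in E *.
have uQ := spectral_unitarymx (toC S).
exists (fun i => complex.Re (spectral_diag (toC S) 0 i)), Q.
have QV : invmx Q = (cmx Q)^T.
  by rewrite invmx_unitary //; apply/matrixP => i j; rewrite !mxE.
split.
- exact: unitarymx_unit.
- by rewrite -QV mulVmx // unitarymx_unit.
rewrite -QV {1}E; congr (_ *m diag_mx _ *m _); apply/rowP => i; rewrite !mxE.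
by rewrite RRe_real //; move/mxOverP: dreal; exact.
Qed.

Lemma char_poly_spectral (S : 'M[R]_4) (d : 'I_4 -> R) (Q : 'M[C]_4) :
  Q \in unitmx -> (cmx Q)^T *m Q = 1%:M ->
  toC S = (cmx Q)^T *m diag_mx (\row_i real_complex R (d i)) *m Q ->
  char_poly S = \prod_(i < 4) ('X - (d i)%:P).
Proof.
move=> uQ QQ E; apply: (map_poly_inj (real_complex R)).
have -> : map_poly (real_complex R) (char_poly S) = char_poly (toC S).
  by rewrite map_char_poly.
have sim : char_poly (toC S) = char_poly (diag_mx (\row_i real_complex R (d i))).
  rewrite /char_poly E.
  have -> : char_poly_mx ((cmx Q)^T *m diag_mx (\row_i real_complex R (d i)) *m Q) =
    map_mx polyC (cmx Q)^T *m char_poly_mx (diag_mx (\row_i real_complex R (d i)))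
      *m map_mx polyC Q.
    rewrite /char_poly_mx mulmxBr mulmxBl !map_mxM; congr (_ - _).
    by rewrite mul_mx_scalar -scalemxAl -map_mxM QQ map_mx1 scalemx1.
  rewrite !det_mulmx mulrAC -det_mulmx -map_mxM QQ map_mx1 det1 mul1r.
  by [].
rewrite sim rmorph_prod /= /char_poly /char_poly_mx.
rewrite (_ : _ - _ = diag_mx (\row_i ('X - (real_complex R (d i))%:P))).
  by rewrite det_diag; apply: eq_bigr => i _; rewrite mxE map_polyXsubC.
apply/matrixP => i j; rewrite !mxE; case: eqP => [->|_]; rewrite ?mulr1n ?mulr0n //.
by rewrite polyC0 subrr.
Qed.

Let quad (S : 'M[R]_4) (d : 'I_4 -> R) (Q : 'M[C]_4) (y : 'rV[C]_4) :
  (cmx Q)^T *m Q = 1%:M ->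
  toC S = (cmx Q)^T *m diag_mx (\row_i real_complex R (d i)) *m Q ->
  (y *m Q *m toC S *m (cmx (y *m Q))^T) 0 0 =
  \sum_i real_complex R (d i) * (y 0 i * conjc (y 0 i)).
Proof.
move=> QQ ->.
have QQ' : Q *m (cmx Q)^T = 1%:M by exact: mulmx1C.
rewrite cmxM trmx_mul !mulmxA -(mulmxA y) QQ' mulmx1.
rewrite -[_ *m Q *m _]mulmxA QQ' mulmx1 mul_mx_diag mxE.
by apply: eq_bigr => i _; rewrite !mxE (mulrC (y 0 i)) mulrA.
Qed.

(** Two negative eigenvalues would give a plane on which the form is negative definite, and a plane
    meets the hyperplane annihilated by [l] nontrivially. *)
Lemma lorentzian_count (S : 'M[R]_4) (d : 'I_4 -> R) (Q : 'M[C]_4) :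
  lorentzian S -> Q \in unitmx -> (cmx Q)^T *m Q = 1%:M ->
  toC S = (cmx Q)^T *m diag_mx (\row_i real_complex R (d i)) *m Q ->
  forall i j, i != j -> d i < 0 -> d j < 0 -> False.
Proof.
move=> [l lP] uQ QQ E i j ij di dj.
(* A combination of the two eigenvectors is annihilated by [l]. *)
pose m := Q *m l.
have [u [v [uv0 muv]]] : exists u v : C, (u != 0) || (v != 0) /\ u * m i 0 + v * m j 0 = 0.
  have [mi0|mi0] := eqVneq (m i 0) 0.
    by exists 1, 0; rewrite oner_eq0 mi0 mulr0 mul0r addr0.
  by exists (m j 0), (- m i 0); rewrite oppr_eq0 mi0 orbT mulrC mulNr subrr.
pose y : 'rV[C]_4 := u *: delta_mx 0 i + v *: delta_mx 0 j.
have yi : y 0 i = u by rewrite !mxE !eqxx (negPf ij) mulr1 mulr0 addr0.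
have yj : y 0 j = v by rewrite !mxE !eqxx eq_sym (negPf ij) mulr1 mulr0 add0r.
have yr r : r != i -> r != j -> y 0 r = 0.
  by move=> ri rj; rewrite !mxE (negPf ri) (negPf rj) !mulr0 addr0.
have yQl : y *m Q *m l = 0.
  have gen (M : 'cV[C]_4) : u * M i 0 + v * M j 0 = 0 -> u *: row i M + v *: row j M = 0.
    by move=> E0; apply/matrixP => r s; rewrite !ord1 !mxE.
  by rewrite -mulmxA -/m /y mulmxDl -!scalemxAl -!rowE; exact: gen.
have := lP _ yQl; rewrite (quad _ QQ E) (bigD1 i) //= (bigD1 j) 1?eq_sym //= big1.
  rewrite addr0 yi yj => ge0.
  have neg (t : R) (w : C) : t < 0 -> real_complex R t * (w * conjc w) <= 0.
    by move=> t0; rewrite mulr_le0_ge0 ?mulcJ_ge0 // lecR ltW.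
  have sneg (t : R) (w : C) : t < 0 -> w != 0 -> real_complex R t * (w * conjc w) < 0.
    move=> t0 w0; rewrite lt_neqAle neg // andbT !mulf_neq0 // ?conjc_eq0 //.
    by apply/eqP => -[] t00; rewrite t00 ltxx in t0.
  suff : real_complex R (d i) * (u * conjc u) + real_complex R (d j) * (v * conjc v) < 0.
    by move/lt_geF; rewrite ge0.
  case/orP: uv0 => w0.
    by rewrite -[ltRHS]addr0 ltr_leD ?sneg ?neg.
  by rewrite -[ltRHS]addr0 ler_ltD ?sneg ?neg.
by move=> r /andP[ri rj]; rewrite yr // mul0r mulr0.
Qed.

Lemma det_spectral (S : 'M[R]_4) (d : 'I_4 -> R) (Q : 'M[C]_4) : (cmx Q)^T *m Q = 1%:M ->
  toC S = (cmx Q)^T *m diag_mx (\row_i real_complex R (d i)) *m Q ->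
  \det S = \prod_i d i.
Proof.
move=> QQ E; apply: (@complexI R); rewrite -[LHS](det_map_mx (real_complex R)) E.
rewrite !det_mulmx mulrAC -det_mulmx QQ det1 mul1r det_diag rmorph_prod.
by apply: eq_bigr => i _; rewrite mxE.
Qed.

(** The product [-1] excludes zeros and four positive numbers; the other hypotheses exclude two
    negative ones. *)
Lemma signs_count (x0 x1 x2 x3 : R) : x0 * (x1 * (x2 * x3)) = -1 ->
  (x0 < 0 -> x1 < 0 -> False) -> (x0 < 0 -> x2 < 0 -> False) ->
  (x0 < 0 -> x3 < 0 -> False) -> (x1 < 0 -> x2 < 0 -> False) ->
  (x1 < 0 -> x3 < 0 -> False) -> (x2 < 0 -> x3 < 0 -> False) ->
  count (fun a => 0 < a) [:: x0; x1; x2; x3] = 3%N /\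
  count (fun a => a < 0) [:: x0; x1; x2; x3] = 1%N.
Proof.
move=> E n01 n02 n03 n12 n13 n23.
have [z0 z1 z2 z3] : [/\ x0 != 0, x1 != 0, x2 != 0 & x3 != 0].
  have : x0 * (x1 * (x2 * x3)) != 0 by rewrite E oppr_eq0 oner_eq0.
  by rewrite !mulf_eq0 !negb_or => /and4P.
have np : ~ (0 < x0 /\ 0 < x1 /\ 0 < x2 /\ 0 < x3).
  move=> [h0 [h1 [h2 h3]]]; have : 0 < x0 * (x1 * (x2 * x3)) by rewrite !mulr_gt0.
  by rewrite E oppr_gt0 ltNge ler01.
have [h0|h0|h0] := ltgtP x0 0; last by move/eqP: z0; rewrite h0.
all: have [h1|h1|h1] := ltgtP x1 0; last by move/eqP: z1; rewrite h1.
all: have [h2|h2|h2] := ltgtP x2 0; last by move/eqP: z2; rewrite h2.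
all: have [h3|h3|h3] := ltgtP x3 0; last by move/eqP: z3; rewrite h3.
all: try by exfalso; auto.
all: by rewrite /= ?h0 ?h1 ?h2 ?h3 ?(lt_gtF h0) ?(lt_gtF h1) ?(lt_gtF h2) ?(lt_gtF h3).
Qed.

(** Trades the eigenvalue count for conditions that are visibly stable under congruence by matrices
    of determinant one. *)
Lemma QspaceP (S : 'M[R]_4) : Qspace S <-> [/\ S^T = S, \det S = -1 & lorentzian S].
Proof.
split=> [[Ssym dS [s [cp cpos cneg]]]|[Ssym dS lS]].
  split=> //; have [d [Q [uQ QQ E]]] := spectral_real Ssym.
  have cpd := char_poly_spectral uQ QQ E.
  have ds : perm_eq [seq d i | i <- enum 'I_4] s.
    by apply: prod_XsubC_eq; rewrite big_map -cp cpd big_enum.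
  have c1 : #|[set i | d i < 0]%SET| = 1%N.
    apply: etrans cneg; rewrite -(seq.permP ds) count_map -sum1_count big_enum_cond /=.
    by rewrite -sum1dep_card.
  have /cards1P [i iE] : #|[set i | d i < 0]%SET| == 1%N by rewrite c1.
  have dpos j : j != i -> 0 <= d j.
    move=> ji; rewrite leNgt; apply/negP => dj.
    have : j \in [set i | d i < 0]%SET by rewrite inE.
    by rewrite iE inE (negPf ji).
  (* The normal is the eigenvector of the only negative eigenvalue, so its hyperplane is spanned by
     the remaining eigenvectors. *)
  exists ((cmx Q)^T *m delta_mx i 0) => x xl.
  have xE : x = x *m (cmx Q)^T *m Q by rewrite -mulmxA QQ mulmx1.
  rewrite {1 2}xE (quad _ QQ E); apply: sumr_ge0 => j _.
  have [->|ji] := eqVneq j i.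
    move/matrixP: xl => /(_ 0 0); rewrite mulmxA -colE !mxE => ->.
    by rewrite mul0r mulr0.
  by rewrite mulr_ge0 ?mulcJ_ge0 // ler0c dpos.
have [d [Q [uQ QQ E]]] := spectral_real Ssym.
split=> //; exists [tuple d i | i < 4].
have cpd := char_poly_spectral uQ QQ E.
have dd := det_spectral QQ E; rewrite dS in dd.
have lc := lorentzian_count lS uQ QQ E.
have en : [tuple d i | i < 4] = [:: d ord0; d (lift ord0 ord0);
    d (lift ord0 (lift ord0 ord0)); d (lift ord0 (lift ord0 (lift ord0 ord0)))] :> seq R.
  by rewrite /= enum_ordSl /= !enum_ordSl /= enum_ord0.
split.
- by rewrite cpd big_map big_enum.
all: rewrite en; move: dd; rewrite !big_ord_recl big_ord0 mulr1 => /esym dd.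
all: have [] := @signs_count _ _ _ _ dd; try exact: lc.
all: by [].
Qed.

Lemma Qspace_congr (S A : 'M[R]_4) : Qspace S -> \det A = 1 -> Qspace (A *m S *m A^T).
Proof.
move=> /QspaceP [Ssym dS lS] dA; apply/QspaceP; split.
- by rewrite !trmx_mul trmxK Ssym mulmxA.
- by rewrite !det_mulmx det_tr dA dS mul1r mulr1.
- exact: lorentzian_congr.
Qed.

Lemma Qspace_J1hat : Qspace (J1hat R).
Proof.
apply/QspaceP; split; last exact: lorentzian_J1hat.
  by apply/matrixP => -[[|[|[|[|//]]]] ?] [[|[|[|[|//]]]] ?]; rewrite !mxE.
have -> : J1hat R = perm_mx (tperm ord0 (lift ord0 (lift ord0 (lift ord0 ord0)))).
  by apply/matrixP => -[[|[|[|[|//]]]] ?] [[|[|[|[|//]]]] ?]; rewrite !mxE permE.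
by rewrite det_perm odd_tperm.
Qed.

End Signature.

(** * The Levi-Civita connection of the target space *)

Section LeviCivita.
Variable R : realType.
Implicit Types (S X Y Z N : 'M[R]_4) (c : R -> 'M[R]_4).

(** The derivative of [S^-1] is [- S^-1 dS S^-1], so differentiating the metric produces two
    products of this kind; they are shared equally between the two fields and symmetrised so that
    the torsion vanishes. *)
Definition Gam0 S X Y : 'M[R]_4 :=
  - (2^-1 *: (X *m invmx S *m Y + Y *m invmx S *m X)).

Lemma is_derive_mxP m n (c : R -> 'M[R]_(m, n)) (t : R) (dc : 'M[R]_(m, n)) :
  is_derive t 1 c dc <-> forall i j, is_derive t 1 (fun s => c s i j : R^o) (dc i j).
Proof.
split=> [[dct <-] i j|H].
  by apply: DeriveDef; [have /derivable_mxP := dct; exact|rewrite derive_mxE].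
have dct : derivable c t 1 by apply/derivable_mxP => i j; have [] := H i j.
apply: DeriveDef => //; apply/matrixP => i j.
by rewrite derive_mxE //; have [] := H i j.
Qed.

Lemma is_derive_sumR n (h dh : 'I_n -> R -> R) (t : R) :
  (forall i, is_derive t 1 (h i : R -> R^o) (dh i t)) ->
  is_derive t 1 (fun s => \sum_i h i s : R^o) (\sum_i dh i t).
Proof.
elim: n h dh => [|n IHn] h dh H.
  rewrite big_ord0 (_ : (fun _ => _) = cst 0); first exact: is_derive_cst.
  by apply/funext => s; rewrite big_ord0.
rewrite big_ord_recl (_ : (fun _ => _) = (h ord0 : R -> R^o) + (fun s => \sum_i h (lift ord0 i) s : R^o)).
  have H1 := H ord0.
  have H2 := IHn _ (fun i => dh (lift ord0 i)) (fun i => H (lift ord0 i)).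
  exact: (is_deriveD H1 H2).
by apply/funext => s; rewrite big_ord_recl.
Qed.

Lemma is_derive_mulmx m n p (A : R -> 'M[R]_(m, n)) (B : R -> 'M[R]_(n, p)) dA dB (t : R) :
  is_derive t 1 A dA -> is_derive t 1 B dB ->
  is_derive t 1 (fun s => A s *m B s) (dA *m B t + A t *m dB).
Proof.
move=> /is_derive_mxP HA /is_derive_mxP HB; apply/is_derive_mxP => i j.
have := is_derive_sumR (h := fun k s => A s i k * B s k j)
  (dh := fun k t => dA i k * B t k j + A t i k * dB k j) (t := t).
rewrite (_ : (fun s => \sum_k _) = (fun s => (A s *m B s) i j)); last first.
  by apply/funext => s; rewrite mxE.
rewrite (_ : \sum_k _ = (dA *m B t + A t *m dB) i j); last first.
  by rewrite !mxE big_split.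
apply=> k; apply: (is_derive_eq (is_deriveM (HA i k) (HB k j))).
by rewrite /GRing.scale /= addrC mulrC.
Qed.

Lemma is_derive_linear m n p q (L : {linear 'M[R]_(m, n) -> 'M[R]_(p, q)})
    (A : R -> 'M[R]_(m, n)) dA (t : R) :
  is_derive t 1 A dA -> is_derive t 1 (fun s => L (A s)) (L dA).
Proof.
move=> /is_derive_mxP HA; apply/is_derive_mxP => i j.
have LE (B : 'M[R]_(m, n)) : L B i j =
    \sum_(k : 'I_#|{: 'I_m * 'I_n}|) B (enum_val k).1 (enum_val k).2 *
      L (delta_mx (enum_val k).1 (enum_val k).2) i j.
  rewrite {1}(matrix_sum_delta B) pair_big /= linear_sum summxE.
  have bij := onW_bij (fun=> true) (@enum_val_bij ('I_m * 'I_n)%type).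
  by rewrite (reindex _ bij) /=; apply: eq_bigr => k _; rewrite linearZ mxE.
rewrite LE (_ : (fun s => _) = fun s => \sum_(k : 'I_#|{: 'I_m * 'I_n}|)
    A s (enum_val k).1 (enum_val k).2 * L (delta_mx (enum_val k).1 (enum_val k).2) i j);
  last by apply/funext => s; rewrite LE.
apply: (is_derive_sumR (h := fun k s => A s (enum_val k).1 (enum_val k).2 *
   L (delta_mx (enum_val k).1 (enum_val k).2) i j)
   (dh := fun k t => dA (enum_val k).1 (enum_val k).2 *
   L (delta_mx (enum_val k).1 (enum_val k).2) i j)) => k.
apply: (is_derive_eq (is_deriveM (HA _ _)
  (is_derive_cst (L (delta_mx (enum_val k).1 (enum_val k).2) i j : R^o) t 1))).
by rewrite /GRing.scale /= mulr0 add0r mulrC.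
Qed.

Lemma is_derive_mxtrace n (A : R -> 'M[R]_n) dA (t : R) :
  is_derive t 1 A dA -> is_derive t 1 (fun s => \tr (A s) : R^o) (\tr dA).
Proof.
move=> /is_derive_mxP HA.
by apply: (is_derive_sumR (h := fun i s => A s i i) (dh := fun i _ => dA i i)).
Qed.

Lemma derivable_prodR n (h : 'I_n -> R -> R) (t : R) :
  (forall i, derivable (h i : R -> R^o) t 1) ->
  derivable (fun s => \prod_i h i s : R^o) t 1.
Proof.
elim: n h => [|n IHn] h H.
  rewrite (_ : (fun _ => _) = cst 1); first exact: derivable_cst.
  by apply/funext => s; rewrite big_ord0.
rewrite (_ : (fun _ => _) = (h ord0 : R -> R^o) * (fun s => \prod_i h (lift ord0 i) s : R^o)).
  by apply: derivableM => //; exact: IHn.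
by apply/funext => s; rewrite big_ord_recl.
Qed.

Lemma derivable_det n (A : R -> 'M[R]_n) (t : R) :
  (forall i j, derivable (fun s => A s i j : R^o) t 1) ->
  derivable (fun s => \det (A s) : R^o) t 1.
Proof.
move=> HA.
have bij := onW_bij (fun=> true) (@enum_val_bij {perm 'I_n}).
rewrite (_ : (fun _ => _) = fun s => \sum_(k : 'I_#|{: 'S_n}|)
    ((-1) ^+ (enum_val k : 'S_n) * \prod_i A s i ((enum_val k : 'S_n) i)) : R^o); last first.
  by apply/funext => s; rewrite /determinant (reindex _ bij).
have H (k : 'I_#|{: 'S_n}|) : derivable (fun s => (-1) ^+ (enum_val k : 'S_n) *
    \prod_i A s i ((enum_val k : 'S_n) i) : R^o) t 1.
  apply: derivableM; first exact: derivable_cst.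
  exact: (derivable_prodR (h := fun i s => A s i ((enum_val k : 'S_n) i))).
have := is_derive_sumR (h := fun k s => (-1) ^+ (enum_val k : 'S_n) *
    \prod_i A s i ((enum_val k : 'S_n) i)) (dh := fun k t => _) (t := t) (fun k => derivableP (H k)).
by case.
Qed.

(** At determinant [-1] the inverse is minus the adjugate, whose entries are polynomial and hence
    derivable; the derivative then follows from [c * c^-1 = 1]. *)
Lemma is_derive_invmx (c : R -> 'M[R]_4) dc (t : R) : is_derive t 1 c dc ->
  (forall s, \det (c s) = -1) ->
  is_derive t 1 (fun s => invmx (c s)) (- (invmx (c t) *m dc *m invmx (c t))).
Proof.
move=> Hc dets.
have u s : c s \in unitmx by rewrite unitmxE dets unitrN unitr1.
have invE s : invmx (c s) = - \adj (c s).
  by rewrite /invmx u dets invrN invr1 scaleN1r.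
have dI : derivable (fun s => invmx (c s)) t 1.
  apply/derivable_mxP => i j.
  rewrite (_ : (fun _ => _) = fun s => - ((-1) ^+ (j + i) * \det (row' j (col' i (c s)))) : R^o).
    apply: derivableN; apply: derivableM; first exact: derivable_cst.
    apply: derivable_det => r s.
    rewrite (_ : (fun _ => _) = fun x => c x (lift j r) (lift i s) : R^o).
      by have /is_derive_mxP /(_ (lift j r) (lift i s)) [] := Hc.
    by apply/funext => x; rewrite !mxE.
  by apply/funext => s; rewrite invE !mxE.
have HI := derivableP dI.
have HcI := is_derive_mulmx Hc HI.
have H1 : is_derive t 1 (fun s => c s *m invmx (c s)) 0.
  rewrite (_ : (fun _ => _) = cst 1%:M); first exact: is_derive_cst.
  by apply/funext => s; rewrite mulmxV.
have E : dc *m invmx (c t) + c t *m 'D_1 (fun s => invmx (c s)) t = 0.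
  by rewrite -(@derive_val _ _ _ _ _ _ _ HcI) (@derive_val _ _ _ _ _ _ _ H1).
apply: (is_derive_eq HI); apply: (can_inj (mulKmx (u t))).
rewrite mulmxN !mulmxA mulmxV // mul1mx.
by apply/eqP; rewrite -addr_eq0 addrC; apply/eqP.
Qed.

Lemma Qspace_unit S : Qspace S -> S \in unitmx.
Proof. by move=> [_ dS _]; rewrite unitmxE dS unitrN unitr1. Qed.

Lemma Qspace_invT S : Qspace S -> (invmx S)^T = invmx S.
Proof. by move=> [sS _ _]; rewrite trmx_inv sS. Qed.

Lemma smooth_curve_is_derive c (t : R) : smooth_curve c -> is_derive t 1 c (derive1 c t).
Proof. by move=> /(_ 0%N t) dc; apply: DeriveDef => //; rewrite derive1E. Qed.

Let metric_alg (I c Y Z Y' Z' : 'M[R]_4) :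
  \tr (((- (I *m c *m I) *m Y + I *m Y') *m I + I *m Y *m - (I *m c *m I)) *m Z
    + I *m Y *m I *m Z') =
  \tr (I *m (Y' - 2^-1 *: (c *m I *m Y + Y *m I *m c)) *m I *m Z)
  + \tr (I *m Y *m I *m (Z' - 2^-1 *: (c *m I *m Z + Z *m I *m c))).
Proof.
do 3 rewrite ?(mulmxDl, mulmxDr, mulmxN, mulNmx) -?scalemxAr -?scalemxAl.
rewrite ?mulmxA !(mxtraceD, raddfN, mxtraceZ) /= ?(mxtraceZ, mxtraceD) ?mulmxA.
have -> : \tr (I *m Y *m I *m Z *m I *m c) = \tr (I *m c *m I *m Y *m I *m Z).
  by rewrite -mulmxA mxtrace_mulC !mulmxA.
have fin (t1 t2 t3 t4 : R) : - t1 + t2 - t3 + t4 =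
  t2 - 2^-1 * (t1 + t3) + (t4 - 2^-1 * (t3 + t1)) by field.
exact: fin.
Qed.

(** Tangency comes from differentiating [Tr (c^-1 Y) = 0] along the curve, compatibility with the
    metric from the derivative of [c^-1] and cyclicity of the trace. *)
Lemma levi_civita_Gam0 : levi_civita Gam0.
Proof.
split.
- move=> S QS a X X' Y _ _ _; rewrite /Gam0 !mulmxDl !mulmxDr -!scalemxAl -!scalemxAr.
  move: (X *m _ *m Y) (X' *m _ *m Y) (Y *m _ *m X) (Y *m _ *m X') => A1 A2 A3 A4.
  apply/matrixP => i j; rewrite !mxE.
  by move: (A1 i j) (A2 i j) (A3 i j) (A4 i j) => *; ring.
- by move=> S QS X Y _ _; rewrite /Gam0 addrC.
- move=> c sc Qc Y [sY tY] t.
  have Hc := smooth_curve_is_derive t sc; have HY := smooth_curve_is_derive t sY.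
  have dets s : \det (c s) = -1 by have [] := Qc s.
  have HI := is_derive_invmx Hc dets.
  have symc : (derive1 c t)^T = derive1 c t.
    have HT := is_derive_linear (@trmx R 4 4) Hc.
    have E : (fun s => (c s)^T) = c by apply/funext => s; have [] := Qc s.
    by rewrite /= E in HT; rewrite -(@derive_val _ _ _ _ _ _ _ HT) (@derive_val _ _ _ _ _ _ _ Hc).
  have symY : (derive1 Y t)^T = derive1 Y t.
    have HT := is_derive_linear (@trmx R 4 4) HY.
    have E : (fun s => (Y s)^T) = Y by apply/funext => s; have [] := tY s.
    by rewrite /= E in HT; rewrite -(@derive_val _ _ _ _ _ _ _ HT) (@derive_val _ _ _ _ _ _ _ HY).
  have [symYt trYt] := tY t.
  split; rewrite /cov_along /Gam0.
    rewrite linearD linearN linearZ /= linearD /= !trmx_mul symY symc symYt.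
    by rewrite (Qspace_invT (Qc t)) !mulmxA [X in _ *: X]addrC.
  have Htr := is_derive_mxtrace (is_derive_mulmx HI HY).
  have H0 : is_derive t 1 (fun s => \tr (invmx (c s) *m Y s) : R^o) 0.
    rewrite (_ : (fun _ => _) = cst 0); first exact: is_derive_cst.
    by apply/funext => s; have [] := tY s.
  have := @derive_val _ _ _ _ _ _ _ Htr; rewrite (@derive_val _ _ _ _ _ _ _ H0).
  rewrite mulmxDr mulmxN -scalemxAr mulmxDr !mulmxA.
  rewrite !mxtraceD !linearN /= mxtraceZ mxtraceD mulNmx linearN /=.
  set I := invmx (c t); set c' := derive1 c t; set Y' := derive1 Y t.
  have -> : \tr (I *m Y t *m I *m c') = \tr (I *m c' *m I *m Y t).
    by rewrite -mulmxA mxtrace_mulC mulmxA.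
  by move: (\tr (I *m c' *m I *m Y t)) (\tr (I *m Y')) => x y e; rewrite [RHS]e; field.
- move=> c sc Qc Y Z [sY tY] [sZ tZ] t.
  have Hc := smooth_curve_is_derive t sc; have HY := smooth_curve_is_derive t sY.
  have HZ := smooth_curve_is_derive t sZ.
  have dets s : \det (c s) = -1 by have [] := Qc s.
  have HI := is_derive_invmx Hc dets.
  have HIY := is_derive_mulmx HI HY; have HIZ := is_derive_mulmx HI HZ.
  have Htr := is_derive_mxtrace (is_derive_mulmx (is_derive_mulmx HIY HI) HZ).
  rewrite derive1E (_ : (fun t' => _) = (fun s => \tr (invmx (c s) *m Y s *m invmx (c s) *m Z s) : R^o)) //.
  rewrite (@derive_val _ _ _ _ _ _ _ Htr) /Qmetric /cov_along /Gam0.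
  exact: metric_alg.
Qed.

Definition trilinear_skew (B : 'M[R]_4 -> 'M[R]_4 -> 'M[R]_4) S X :=
  forall Y Z, Qtangent S Y -> Qtangent S Z ->
  Qmetric S (B X Y) Z + Qmetric S Y (B X Z) = 0.

Lemma QmetricC S X Y : Qmetric S X Y = Qmetric S Y X.
Proof. by rewrite /Qmetric -mulmxA mxtrace_mulC mulmxA. Qed.

Lemma QmetricDl S X X' Y : Qmetric S (X + X') Y = Qmetric S X Y + Qmetric S X' Y.
Proof. by rewrite /Qmetric mulmxDr !mulmxDl mxtraceD. Qed.

Lemma QmetricDr S X Y Y' : Qmetric S X (Y + Y') = Qmetric S X Y + Qmetric S X Y'.
Proof. by rewrite /Qmetric mulmxDr mxtraceD. Qed.

Lemma QmetricBl S X X' Y : Qmetric S (X - X') Y = Qmetric S X Y - Qmetric S X' Y.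
Proof. by apply/esym/eqP; rewrite subr_eq -QmetricDl subrK. Qed.

Lemma QmetricBr S X Y Y' : Qmetric S X (Y - Y') = Qmetric S X Y - Qmetric S X Y'.
Proof. by apply/esym/eqP; rewrite subr_eq -QmetricDr subrK. Qed.

(** The metric is indefinite, but pairing [X] with [W = S^-1 X S^-1] gives [Tr (W W^T)], a sum of
    squares. A multiple of [S], orthogonal to [X], is subtracted to make the test vector tangent. *)
Lemma Qmetric_nondeg S X : Qspace S -> Qtangent S X ->
  (forall Z, Qtangent S Z -> Qmetric S X Z = 0) -> X = 0.
Proof.
move=> QS [Xs Xt] H; have [sS _ _] := QS; have uS := Qspace_unit QS.
pose W := invmx S *m X *m invmx S.
have Ws : W^T = W by rewrite /W !trmx_mul Xs (Qspace_invT QS) mulmxA.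
pose al := \tr (invmx S *m W) / 4.
have tSS : \tr (invmx S *m S) = 4 by rewrite mulVmx // mxtrace1.
have four0 : 4 != 0 :> R by rewrite pnatr_eq0.
have tZ : Qtangent S (W - al *: S).
  split; first by rewrite linearB linearZ /= Ws sS.
  by rewrite mulmxBr -scalemxAr linearB /= mxtraceZ tSS /al divfK // subrr.
have := H _ tZ; rewrite /Qmetric -/W mulmxBr -scalemxAr linearB /= mxtraceZ.
have -> : \tr (W *m S) = 0 by rewrite /W mulmxKV // mxtrace_mulC mxtrace_mulC.
rewrite mulr0 subr0 -{2}Ws => WW0.
have W0 : W = 0.
  apply/matrixP => i j; rewrite [RHS]mxE.
  have sum0 : \sum_i \sum_j W i j ^+ 2 = 0.
    rewrite -[RHS]WW0; apply: eq_bigr => r _; rewrite mxE; apply: eq_bigr => s _.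
    by rewrite [W^T _ _]mxE expr2.
  have := sum0 => /eqP; rewrite psumr_eq0 => [|r _]; last first.
    by apply: sumr_ge0 => s _; rewrite sqr_ge0.
  move=> /allP /(_ i); rewrite mem_index_enum => /(_ isT) /=.
  rewrite psumr_eq0 => [|s _]; last by rewrite sqr_ge0.
  move=> /allP /(_ j); rewrite mem_index_enum => /(_ isT) /=.
  by rewrite sqrf_eq0 => /eqP.
have : S *m W *m S = X by rewrite /W mulmxA mulmxA mulmxV // mul1mx mulmxKV.
by rewrite W0 mulmx0 mul0mx => <-.
Qed.

(** For [N ^ 2 = 0] the factor [1 + t N] is [exp (t N)]: the curve is polynomial in [t], is defined
    for all real [t] as [smooth_curve] demands, and stays in [Qspace] when these factors have
    determinant one. *)
Definition orbit_curve S N (t : R) : 'M[R]_4 := (1%:M + t *: N) *m S *m (1%:M + t *: N)^T.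

Lemma quadratic_curve (A0 A1 A2 : 'M[R]_4) (t : R) :
  is_derive t 1 (fun t : R => A0 + t *: A1 + t ^+ 2 *: A2) (A1 + (2 * t) *: A2).
Proof.
apply/is_derive_mxP => i j.
have d1 := is_derive_id t (1 : R^o).
have d2 := is_deriveD (is_deriveD (is_derive_cst (A0 i j : R^o) t 1)
    (is_deriveM d1 (is_derive_cst (A1 i j : R^o) t 1)))
    (is_deriveM (is_deriveM d1 d1) (is_derive_cst (A2 i j : R^o) t 1)).
rewrite (_ : (fun s => _) = (cst (A0 i j) + (id : R -> R^o) * cst (A1 i j)
    + ((id : R -> R^o) * id) * cst (A2 i j))).
  apply: (is_derive_eq d2); rewrite /GRing.scale /= !mxE.
  by rewrite -[(id * id) t]/(t * t); ring.
by apply/funext => s; rewrite !mxE expr2.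
Qed.

Lemma smooth_quadratic (A0 A1 A2 : 'M[R]_4) :
  smooth_curve (fun t : R => A0 + t *: A1 + t ^+ 2 *: A2).
Proof.
move=> n; elim: n A0 A1 A2 => [|n IHn] A0 A1 A2 t; first by have [] := quadratic_curve A0 A1 A2 t.
rewrite derive1Sn.
have -> : derive1 (fun t : R => A0 + t *: A1 + t ^+ 2 *: A2) =
    fun t : R => A1 + t *: (2 *: A2) + t ^+ 2 *: 0.
  apply/funext => s; rewrite derive1E (@derive_val _ _ _ _ _ _ _ (quadratic_curve A0 A1 A2 s)).
  by rewrite scaler0 addr0 scalerA mulrC.
exact: IHn.
Qed.

Lemma orbit_curveE S N : orbit_curve S N =
  fun t : R => S + t *: (N *m S + S *m N^T) + t ^+ 2 *: (N *m S *m N^T).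
Proof.
apply/funext => t; rewrite /orbit_curve linearD /= trmx1 linearZ /=.
rewrite mulmxDl mul1mx mulmxDr mulmx1 mulmxDl -!scalemxAl -!scalemxAr scalerA -expr2.
by rewrite scalerDr !addrA.
Qed.

Lemma orbit_inv N (t : R) : N *m N = 0 -> (1%:M + t *: N) *m (1%:M - t *: N) = 1%:M.
Proof.
move=> NN; rewrite mulmxDl mul1mx mulmxBr mulmx1 -scalemxAl -scalemxAr NN !scaler0.
by rewrite subr0 subrK.
Qed.

(** Moving tangent vectors by the same congruences as [S] yields tangent fields along the orbit
    curve. Subtracting the axioms of the two connections at time zero cancels the ordinary
    derivatives and leaves pointwise facts about their difference. *)
Lemma levi_civita_skew (Gam : 'M[R]_4 -> 'M[R]_4 -> 'M[R]_4 -> 'M[R]_4) S N :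
  levi_civita Gam -> Qspace S -> N *m N = 0 -> (forall t, \det (1%:M + t *: N) = 1) ->
  (forall Y, Qtangent S Y -> Qtangent S (Gam S (N *m S + S *m N^T) Y - Gam0 S (N *m S + S *m N^T) Y)) /\
  trilinear_skew (fun X Y => Gam S X Y - Gam0 S X Y) S (N *m S + S *m N^T).
Proof.
move=> lc QS NN dN.
pose c := orbit_curve S N.
have sc Y : smooth_curve (orbit_curve Y N) by rewrite orbit_curveE; exact: smooth_quadratic.
have Qc t : Qspace (c t) by exact: Qspace_congr.
have c0 Y : orbit_curve Y N 0 = Y by rewrite /orbit_curve scale0r addr0 mul1mx trmx1 mulmx1.
have dc0 : derive1 c 0 = N *m S + S *m N^T.
  rewrite /c orbit_curveE derive1E.
  rewrite (@derive_val _ _ _ _ _ _ _ (quadratic_curve S (N *m S + S *m N^T) _ 0)).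
  by rewrite mulr0 scale0r addr0.
have tc Y : Qtangent S Y -> tangent_field_along c (orbit_curve Y N).
  move=> [Ys Yt]; split; first exact: sc.
  move=> t; split; first by rewrite /orbit_curve !trmx_mul trmxK Ys mulmxA.
  have uA : 1%:M + t *: N \in unitmx by case: (mulmx1_unit (orbit_inv t NN)).
  have iM (A B : 'M[R]_4) : A \in unitmx -> B \in unitmx -> invmx (A *m B) = invmx B *m invmx A.
    move=> uA' uB; have uAB : A *m B \in unitmx by rewrite unitmx_mul uA'.
    apply: (can_inj (mulKmx uAB)); rewrite mulmxV // mulmxA mulmxK //.
    by rewrite mulmxV.
  have uS := Qspace_unit QS.
  rewrite /c /orbit_curve iM ?unitmx_mul ?uA ?uS ?unitmx_tr // iM //.
  rewrite mxtrace_mulC !mulmxA mulmxK ?unitmx_tr // mxtrace_mulC !mulmxA mulVmx // mul1mx.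
  by rewrite mxtrace_mulC.
have [_ _ tG mG] := lc; have [_ _ tG0 mG0] := levi_civita_Gam0.
have tB Y : Qtangent S Y -> Qtangent S (Gam S (N *m S + S *m N^T) Y - Gam0 S (N *m S + S *m N^T) Y).
  move=> tY; have [s1 t1] := tG c (sc S) Qc _ (tc Y tY) 0.
  have [s2 t2] := tG0 c (sc S) Qc _ (tc Y tY) 0.
  move: s1 s2 t1 t2; rewrite /cov_along dc0 /c !c0 => s1 s2 t1 t2.
  set D := derive1 _ _ in s1 s2 t1 t2.
  rewrite (_ : _ - _ = (D + Gam S (N *m S + S *m N^T) Y) - (D + Gam0 S (N *m S + S *m N^T) Y)).
    split; first by rewrite linearB /= s1 s2.
    by rewrite mulmxBr linearB /= t1 t2 subrr.
  by rewrite opprD addrACA subrr add0r.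
split=> // Y Z tY tZ.
have := mG c (sc S) Qc _ _ (tc Y tY) (tc Z tZ) 0.
rewrite (mG0 c (sc S) Qc _ _ (tc Y tY) (tc Z tZ) 0) /cov_along dc0 /c !c0.
set DY := derive1 (orbit_curve Y N) 0; set DZ := derive1 (orbit_curve Z N) 0 => E.
have gen (A0 A1 A2 A3 A4 A5 : 'M[R]_4) :
    Qmetric S (A0 + A2) Z + Qmetric S Y (A3 + A5) = Qmetric S (A0 + A1) Z + Qmetric S Y (A3 + A4) ->
    Qmetric S (A1 - A2) Z + Qmetric S Y (A4 - A5) = 0.
  rewrite QmetricBl QmetricBr !QmetricDl !QmetricDr => /eqP; rewrite -subr_eq0 => /eqP {}E.
  by rewrite -[RHS]oppr0 -E; ring.
exact: gen E.
Qed.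

(** The bordered matrix [M] factors in two ways: one exposes [1 + u v], the other, thanks to
    [v u = 0], has unipotent triangular factors only. *)
Lemma det_1D_rank1 (u : 'cV[R]_4) (v : 'rV[R]_4) : v *m u = 0 -> \det (1%:M + u *m v) = 1.
Proof.
move=> vu.
pose M := block_mx (1%:M : 'M[R]_1) (- v) u (1%:M : 'M[R]_4).
have d1 : \det M = \det (1%:M + u *m v).
  have -> : M = block_mx 1%:M 0 u 1%:M *m block_mx 1%:M (- v) 0 (1%:M + u *m v).
    rewrite mulmx_block ?mul1mx ?mulmx1 ?mul0mx ?mulmx0 ?mul1mx ?mulmx1 ?addr0 ?add0r.
    by rewrite mulmxN addrC addrK.
  by rewrite det_mulmx det_lblock det_ublock !det1 !mul1r.
have d2 : \det M = 1.
  have -> : M = block_mx 1%:M (- v) 0 1%:M *m block_mx 1%:M 0 u 1%:M.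
    rewrite mulmx_block ?mul1mx ?mulmx1 ?mul0mx ?mulmx0 ?mul1mx ?mulmx1 ?addr0 ?add0r.
    by rewrite mulNmx vu oppr0 addr0.
  by rewrite det_mulmx det_lblock det_ublock !det1 !mul1r.
by rewrite -d1.
Qed.

(** * Uniqueness of the connection at a point *)

Section Uniqueness.
Variables (Gam : 'M[R]_4 -> 'M[R]_4 -> 'M[R]_4 -> 'M[R]_4) (S : 'M[R]_4).
Hypotheses (lc : levi_civita Gam) (QS : Qspace S).

Let B X Y := Gam S X Y - Gam0 S X Y.
(** The tangent vector at [S] that [N] generates under the congruence action. *)
Let fld N := N *m S + S *m N^T.

Let tangent_fld N : \tr N = 0 -> Qtangent S (fld N).
Proof.
move=> tN; have [sS _ _] := QS; have uS := Qspace_unit QS; split.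
  by rewrite /fld linearD /= !trmx_mul trmxK sS addrC.
by rewrite /fld mulmxDr mxtraceD mxtrace_mulC mulmxK // mulKmx // mxtrace_tr tN addr0.
Qed.

(** Stated for generators [N]: the condition is linear in [N], holds for square-zero matrices of
    rank one because these generate usable curves, and such matrices span the trace-free ones. *)
Let good N := [/\ \tr N = 0, forall Y, Qtangent S Y -> Qtangent S (B (fld N) Y)
  & trilinear_skew B S (fld N)].

Let B_lin (a : R) N1 N2 Y : \tr N1 = 0 -> \tr N2 = 0 -> Qtangent S Y ->
  B (fld (a *: N1 + N2)) Y = a *: B (fld N1) Y + B (fld N2) Y.
Proof.
move=> t1 t2 tY; have [l1 _ _ _] := lc; have [l0 _ _ _] := levi_civita_Gam0.
have -> : fld (a *: N1 + N2) = a *: fld N1 + fld N2.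
  rewrite /fld linearD /= linearZ /= mulmxDl mulmxDr -!scalemxAl -!scalemxAr.
  by rewrite scalerDr addrACA.
rewrite /B l1 ?l0 //; try exact: tangent_fld.
by rewrite scalerBr opprD addrACA.
Qed.

Let good_lin (a : R) N1 N2 : good N1 -> good N2 -> good (a *: N1 + N2).
Proof.
move=> [t1 h1 s1] [t2 h2 s2]; split.
- by rewrite mxtraceD mxtraceZ t1 t2 mulr0 addr0.
- move=> Y tY; rewrite B_lin //; have [a1 b1] := h1 Y tY; have [a2 b2] := h2 Y tY.
  split; first by rewrite linearD linearZ /= a1 a2.
  by rewrite mulmxDr -scalemxAr mxtraceD mxtraceZ b1 b2 mulr0 addr0.
- move=> Y Z tY tZ; rewrite !B_lin //.
  have := s1 Y Z tY tZ; have := s2 Y Z tY tZ; rewrite /Qmetric.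
  move: (B (fld N1) Y) (B (fld N1) Z) (B (fld N2) Y) (B (fld N2) Z) => b1 b2 b3 b4 e2 e1.
  rewrite !(mulmxDr, mulmxDl) -!scalemxAr -!scalemxAl !mxtraceD !mxtraceZ.
  rewrite addrACA -mulrDr e1 mulr0 add0r.
  exact: e2.
Qed.

Let good0 : good 0.
Proof.
have fld0 : fld 0 = 0 by rewrite /fld linear0 mul0mx mulmx0 addr0.
have t0 : Qtangent S 0 by rewrite -fld0; apply: tangent_fld; rewrite linear0.
have B0 Y : Qtangent S Y -> B 0 Y = 0.
  move=> tY; have := B_lin 1 (N1 := 0) (N2 := 0) (linear0 _) (linear0 _) tY.
  rewrite scaler0 addr0 fld0 scale1r => /eqP.
  by rewrite -[X in X == _]addr0 (inj_eq (addrI _)) eq_sym => /eqP.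
split; first exact: linear0.
- by move=> Y tY; rewrite fld0 B0.
- by move=> Y Z tY tZ; rewrite fld0 !B0 // /Qmetric !(mulmx0, mul0mx) linear0 addr0.
Qed.

Let good_sum (I : Type) (r : seq I) (F : I -> 'M[R]_4) (a : I -> R) :
  (forall i, good (F i)) -> good (\sum_(i <- r) a i *: F i).
Proof.
move=> gF; elim: r => [|i r IH]; first by rewrite big_nil.
by rewrite big_cons; exact: (good_lin (a i) (gF i) IH).
Qed.

Let good_rank1 (u : 'cV[R]_4) (v : 'rV[R]_4) : v *m u = 0 -> good (u *m v).
Proof.
move=> vu.
have NN : (u *m v) *m (u *m v) = 0 by rewrite mulmxA -(mulmxA u) vu mulmx0 mul0mx.
have dN (t : R) : \det (1%:M + t *: (u *m v)) = 1.
  by rewrite scalemxAl det_1D_rank1 // -scalemxAr vu scaler0.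
have [h1 h2] := levi_civita_skew lc QS NN dN.
by split; [rewrite mxtrace_mulC vu linear0|exact: h1|exact: h2].
Qed.

Let good_delta i j : i != j -> good (delta_mx i j).
Proof.
move=> ij; rewrite -(mul_delta_mx (0 : 'I_1)); apply: good_rank1.
by rewrite mul_delta_mx_0 // eq_sym.
Qed.

(** For [i] different from 0, [E_ii - E_00] is not nilpotent, but it equals
    [(e_i + e_0) (e_i - e_0)^T + E_i0 - E_0i], a combination of square-zero matrices of rank one. *)
Let good_diag i M : M = delta_mx i i - delta_mx ord0 ord0 -> good M.
Proof.
move=> ME; have [i0|i0] := eqVneq i ord0.
  have M0 : M = 0 by rewrite ME i0 subrr.
  by rewrite M0; exact: good0.
pose u : 'cV[R]_4 := delta_mx i 0 + delta_mx ord0 0.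
pose v : 'rV[R]_4 := delta_mx 0 i - delta_mx 0 ord0.
have i0' : ord0 != i by rewrite eq_sym.
have vu : v *m u = 0.
  rewrite /v /u mulmxDr !mulmxBl !mul_delta_mx !mul_delta_mx_0 //.
  by rewrite subr0 sub0r subrr.
have uv : u *m v = delta_mx i i - delta_mx i ord0 + (delta_mx ord0 i - delta_mx ord0 ord0).
  by rewrite /u /v mulmxDl !mulmxBr !mul_delta_mx.
have E : M = 1 *: (u *m v) + (1 *: delta_mx i ord0 + (-1 *: delta_mx ord0 i + 0)).
  rewrite ME uv !scale1r scaleN1r addr0.
  move: (delta_mx i i) (delta_mx i ord0) (delta_mx ord0 i) (delta_mx ord0 ord0).
  move=> A1 A2 A3 A4; apply/matrixP => r s; rewrite !mxE.
  by move: (A1 r s) (A2 r s) (A3 r s) (A4 r s) => *; ring.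
rewrite E.
apply: good_lin; first exact: good_rank1.
apply: good_lin; first exact: good_delta.
apply: good_lin; last exact: good0.
exact: (good_delta i0').
Qed.

Let good_all N : \tr N = 0 -> good N.
Proof.
move=> tN.
pose F (ij : 'I_4 * 'I_4) : 'M[R]_4 :=
  if ij.1 == ij.2 then delta_mx ij.1 ij.1 - delta_mx ord0 ord0 else delta_mx ij.1 ij.2.
have gF ij : good (F ij).
  rewrite /F; case: eqP => [_|/eqP]; first exact: (good_diag erefl).
  exact: good_delta.
(* Replacing each [E_ii] by [E_ii - E_00] changes the expansion of [N] by [Tr N] times [E_00], which
   is zero. *)
suff -> : N = \sum_ij N ij.1 ij.2 *: F ij by exact: good_sum.
have E : \sum_ij N ij.1 ij.2 *: F ij =
    \sum_ij N ij.1 ij.2 *: delta_mx ij.1 ij.2 -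
    \sum_(ij : 'I_4 * 'I_4) (if ij.1 == ij.2 then N ij.1 ij.2 else 0) *: delta_mx ord0 ord0.
  rewrite -sumrB; apply: eq_bigr => -[i j] _; rewrite /F /=.
  by case: eqP => [->|_]; rewrite ?scalerBr // scale0r subr0.
rewrite E -scaler_suml.
have -> : \sum_(ij : 'I_4 * 'I_4) (if ij.1 == ij.2 then N ij.1 ij.2 else 0) = \tr N.
  rewrite -(pair_bigA _ (fun i j => if i == j then N i j else 0)) /=.
  apply: eq_bigr => i _; rewrite (bigD1 i) //= eqxx big1 ?addr0 // => j.
  by rewrite eq_sym => /negPf ->.
rewrite tN scale0r subr0 [LHS]matrix_sum_delta.
by rewrite pair_big.
Qed.

(** Koszul's argument: the difference [B] is symmetric in its arguments and skew for the metric, and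
    three exchanges of each kind, alternating, return to the start with the opposite sign. *)
Lemma levi_civita_unique X Y : Qtangent S X -> Qtangent S Y -> Gam S X Y = Gam0 S X Y.
Proof.
move=> tX tY; have uS := Qspace_unit QS; have [sS _ _] := QS.
(* The generator [Z S^-1 / 2] is trace-free because [Z] is tangent, and each of the two terms of
   [fld] gives [Z / 2]. *)
have fldE Z : Qtangent S Z -> exists2 N, \tr N = 0 & fld N = Z.
  move=> [sZ tZ]; exists (2^-1 *: (Z *m invmx S)).
    by rewrite mxtraceZ mxtrace_mulC tZ mulr0.
  rewrite /fld linearZ /= trmx_mul sZ (Qspace_invT QS) -scalemxAl -scalemxAr.
  rewrite mulmxKV // mulmxA mulmxV // mul1mx -scalerDl.
  by rewrite (_ : 2^-1 + 2^-1 = 1) ?scale1r //; field.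
have skew Z : Qtangent S Z -> (forall W, Qtangent S W -> Qtangent S (B Z W)) /\ trilinear_skew B S Z.
  by move=> /fldE [N tN <-]; have [] := good_all tN.
have sym U V : Qtangent S U -> Qtangent S V -> B U V = B V U.
  move=> tU tV; have [_ s1 _ _] := lc; have [_ s0 _ _] := levi_civita_Gam0.
  by rewrite /B s1 // s0.
have anti U V W : Qtangent S U -> Qtangent S V -> Qtangent S W ->
    Qmetric S (B U V) W = - Qmetric S (B U W) V.
  move=> tU tV tW; have [_ sk] := skew U tU; have := sk V W tV tW.
  by rewrite (QmetricC _ V) => /eqP; rewrite addr_eq0 => /eqP.
apply/eqP; rewrite -subr_eq0; apply/eqP; apply: (Qmetric_nondeg QS).
  by have [h _] := skew X tX; exact: h.
move=> Z tZ; rewrite -/(B X Y).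
have E := etrans (anti X Y Z tX tY tZ) (congr1 -%R (etrans
  (congr1 (fun M => Qmetric S M Y) (sym X Z tX tZ)) (etrans (anti Z X Y tZ tX tY)
  (congr1 -%R (etrans (congr1 (fun M => Qmetric S M X) (sym Z Y tZ tY))
  (etrans (anti Y Z X tY tZ tX)
  (congr1 -%R (congr1 (fun M => Qmetric S M Z) (sym Y X tY tX))))))))).
move: E; generalize (Qmetric S (B X Y) Z) => x; rewrite opprK => /eqP.
by rewrite -subr_eq0 opprK -mulr2n mulrn_eq0 => /eqP.
Qed.

End Uniqueness.

(** Harmonicity is stated with an unspecified Levi-Civita connection; this allows computing with
    [Gam0]. *)
Lemma tension_Gam0 (Gam : 'M[R]_4 -> 'M[R]_4 -> 'M[R]_4 -> 'M[R]_4) (g : R * R -> 'M[R]_4) q :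
  levi_civita Gam -> Qspace (g q) ->
  (forall i, Qtangent (g q) ('D_(dir R i) g q)) -> tension Gam g q = tension Gam0 g q.
Proof.
move=> lc Qg tg; apply: eq_bigr => i _; congr (_ + _).
exact: (levi_civita_unique lc Qg).
Qed.

End LeviCivita.

(** * Tension of real matrix maps in the complex coordinate *)

Section RealMatrixFunctions.
Variables (R : realType) (D : set (R * R)).
Hypothesis openD : open D.
Local Notation C := R[i].
Local Notation toC := (map_mx (real_complex R)).

Lemma smooth_toC m n (g : R * R -> 'M[R]_(m, n)) gz gb :
  isdmx D (fun q => toC (g q)) gz gb -> smooth D g.
Proof.
move=> dg k; apply/(Ck_mxP _ _ openD) => i j; have [[re _] _] := dg i j.
by apply: (eq_Ck openD _ (re k)) => q _; rewrite mxE.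
Qed.

Lemma toC_derive m n (g : R * R -> 'M[R]_(m, n)) gz gb q :
  isdmx D (fun q => toC (g q)) gz gb -> D q ->
  toC ('D_(dirx R) g q) = gz q + gb q /\ toC ('D_(diry R) g q) = iC R *: (gz q - gb q).
Proof.
move=> dg Dq; have [_ [dx dy _ _]] := smooth_toC dg 1%N.
have dCE w i j : derivable g q w ->
    dC w (fun q => toC (g q) i j) q = real_complex R ('D_w g q i j).
  move=> dgw; rewrite (derive_mxE _ _ dgw) /dC.
  rewrite (_ : (fun q' => complex.Re _) = (fun q' => g q' i j : R^o)); last first.
    by apply/funext => r; rewrite mxE.
  rewrite (_ : (fun q' => complex.Im _) = (cst (0 : R^o))); last first.
    by apply/funext => r; rewrite mxE.
  by rewrite derive_cst.
split; apply/matrixP => i j; rewrite [LHS]mxE -dCE ?mxE; auto.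
  by have [-> _] := dC_isd (dg i j) Dq.
by have [_ ->] := dC_isd (dg i j) Dq.
Qed.

Lemma toC_inj m n (A B : 'M[R]_(m, n)) : toC A = toC B -> A = B.
Proof.
by move=> /matrixP E; apply/matrixP => i j; have := E i j; rewrite !mxE => /complexI.
Qed.

(** The arguments stand for [g^-1], [g_z], [g_zb], [g_zz], [g_{z zb}] and [g_{zb zb}]. The factors
    [i] of the [y]-derivatives square to [-1], so all unmixed terms cancel. *)
Let laplace_alg (I m1 m2 m3 m4 m5 : 'M[C]_4) :
  (m3 + m4 + (m4 + m5)) + - ((m1 + m2) *m I *m (m1 + m2))
  + (iC R *: (iC R *: (m3 + (-1) *: m4) - iC R *: (m4 + (-1) *: m5))
     + - (iC R *: (m1 - m2) *m I *m (iC R *: (m1 - m2)))) =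
  4 *: m4 - 2 *: (m1 *m I *m m2 + m2 *m I *m m1).
Proof.
have i2 : iC R * iC R = -1 by rewrite -expr2 sqr_i.
rewrite -!scalemxAl -scalemxAr !scalerA i2 -scalerBr scalerA i2 !scaleN1r.
rewrite !(mulmxDl, mulmxDr, mulmxN, mulNmx).
move: (m1 *m I *m m1) (m1 *m I *m m2) (m2 *m I *m m1) (m2 *m I *m m2) => n1 n2 n3 n4.
apply/matrixP => i j; rewrite !mxE.
move: (m3 i j) (m4 i j) (m5 i j) (n1 i j) (n2 i j) (n3 i j) (n4 i j).
by move=> x1 x2 x3 x4 x5 x6 x7; ring.
Qed.

(* [g_xx + g_yy = 4 g_z,zb] and
   [g_x g^-1 g_x + g_y g^-1 g_y = 2 (g_z g^-1 g_zb + g_zb g^-1 g_z)]. *)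
Lemma toC_tension (g : R * R -> 'M[R]_4) gz gb gzz gzb gbz gbb q :
  isdmx D (fun q => toC (g q)) gz gb -> isdmx D gz gzz gzb -> isdmx D gb gbz gbb -> D q ->
  toC (tension (@Gam0 R) g q) = 4 *: gzb q
    - 2 *: (gz q *m invmx (toC (g q)) *m gb q + gb q *m invmx (toC (g q)) *m gz q).
Proof.
move=> dg dgz dgb Dq.
have dgx : isdmx D (fun q => toC ('D_(dirx R) g q)) (fun q => gzz q + gbz q)
    (fun q => gzb q + gbb q).
  apply: (eq_isdmx openD (isdmxD openD dgz dgb)) => // r Dr.
  by have [-> _] := toC_derive dg Dr.
have dgy : isdmx D (fun q => toC ('D_(diry R) g q))
    (fun q => iC R *: (gzz q + (-1) *: gbz q)) (fun q => iC R *: (gzb q + (-1) *: gbb q)).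
  apply: (eq_isdmx openD (isdmxZ openD (iC R) (isdmxD openD dgz (isdmxZ openD (-1) dgb)))) => // r Dr.
  by have [_ ->] := toC_derive dg Dr; rewrite scaleN1r.
have [gxE gyE] := toC_derive dg Dq.
have [gxxE _] := toC_derive dgx Dq; have [_ gyyE] := toC_derive dgy Dq.
have mixE := isdmx_mixed openD dg dgz dgb Dq.
have tE : tension (@Gam0 R) g q =
    ('D_(dirx R) (fun q => 'D_(dirx R) g q) q + Gam0 (g q) ('D_(dirx R) g q) ('D_(dirx R) g q))
  + ('D_(diry R) (fun q => 'D_(diry R) g q) q + Gam0 (g q) ('D_(diry R) g q) ('D_(diry R) g q)).
  by rewrite /tension big_ord_recl big_ord1.
rewrite tE.
have GamE (S X : 'M[R]_4) : toC (Gam0 S X X) = - (toC X *m invmx (toC S) *m toC X).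
  have half (A : 'M[R]_4) : 2^-1 *: (A + A) = A.
    by apply/matrixP => i j; rewrite !mxE; move: (A i j) => x; field.
  by rewrite /Gam0 half map_mxN !map_mxM map_invmx.
have {}GamE (S X : 'M[R]_4) X' : toC X = X' -> toC (Gam0 S X X) = - (X' *m invmx (toC S) *m X').
  by move=> <-; exact: GamE.
have mapD (A1 A2 A3 A4 : 'M[R]_4) :
    toC (A1 + A2 + (A3 + A4)) = toC A1 + toC A2 + (toC A3 + toC A4).
  by rewrite !map_mxD.
apply: (etrans (mapD _ _ _ _)).
apply: (etrans (congr2 +%R (congr2 +%R gxxE (GamE _ _ _ gxE)) (congr2 +%R gyyE (GamE _ _ _ gyE)))).
rewrite -mixE.
move: (invmx _) (gz q) (gb q) (gzz q) (gzb q) (gbb q) => I m1 m2 m3 m4 m5.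
exact: laplace_alg.
Qed.

End RealMatrixFunctions.

(** * Tension field of the first-order Gauss map *)

Section HarmonicGaussMap.
Variables (R : realType) (D : set (R * R)).
Hypotheses (openD : open D) (connD : connected D).
Local Notation C := R[i].
Local Notation toC := (map_mx (real_complex R)).
Variables (f : R * R -> 'cV[R]_4) (b p : R * R -> C) (zs : R * R).
Hypotheses (surf : definite_surface D f b p) (Dzs : D zs).
Local Notation W := (wilczynski f b).
Local Notation J := (J1 C).
Local Notation a := (dlogz b).
Local Notation c := (dlogb b).

Let sf : smooth D f. Proof. by case: surf => [] []. Qed.
Let cs : canonical_system D f b p. Proof. by case: surf. Qed.
Let b0 q : D q -> b q != 0. Proof. by case: surf => _ _ _; exact. Qed.

(** Since [f] is real, conjugation exchanges [f_z] with [f_zb] and [a] with [c]; it fixes the outer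
    columns and exchanges the inner ones. *)
Lemma cmx_wilczynski q : D q -> cmx (W q) = W q *m swap23 R.
Proof.
move=> Dq; have aE := dlogz_conj openD cs Dq.
have cE : conjc (a q) = c q by rewrite aE conjcK.
rewrite (wilczynski_cols openD cs b0 Dq).
apply/matrixP => i j.
have sphi := smooth_compC openD sf i; have dphi := isd_of sphi.
have creal r : conjc (compC f i r) = compC f i r by exact: conjc_real.
have dbar := isd_conj openD dphi.
have dbar' : isd D (compC f i) (fun q => conjc (dzb (compC f i) q)) (fun q => conjc (dz (compC f i) q)).
  by apply: (eq_isd openD dbar).
have e1 r : D r -> dz (compC f i) r = conjc (dzb (compC f i) r).
  by move=> Dr; exact: isd_z dbar' Dr.
have e2 r : D r -> conjc (dz (compC f i) r) = dzb (compC f i) r.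
  by move=> Dr; rewrite e1 // conjcK.
have e3 : conjc (dzb (dz (compC f i)) q) = dzb (dz (compC f i)) q.
  have dbz := isd_conj openD (isd_of (smooth_dz openD sphi)).
  have dbz' : isd D (dzb (compC f i)) (fun q => conjc (dzb (dz (compC f i)) q)) (fun q => conjc (dz (dz (compC f i)) q)).
    by apply: (eq_isd openD dbz) => // r Dr; rewrite e2.
  by rewrite -(isd_z dbz' Dq) -(dzb_dz openD sphi Dq).
have cE' : conjc (c q) = a q by rewrite -aE.
have h1 (x y z : C) : conjc (x - y * z) = conjc x - conjc y * conjc z by rewrite !conjcE.
have h3 (x y z a' c' b1 b2 w : C) :
    conjc (x - a' * y - c' * z + (a' * c' - b1 * b2 / 2) * w) =
    conjc x - conjc a' * conjc y - conjc c' * conjc z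
    + (conjc a' * conjc c' - conjc b1 * conjc b2 / 2) * conjc w by rewrite !conjcE.
have E1 : conjc (frame1 (compC f i) (dz (compC f i)) a q) = frame2 (compC f i) (dzb (compC f i)) c q.
  by rewrite /frame1 /frame2 h1 creal cE (e2 _ Dq).
have E2 : conjc (frame2 (compC f i) (dzb (compC f i)) c q) = frame1 (compC f i) (dz (compC f i)) a q.
  by rewrite -E1 conjcK.
have E3 : conjc (frame3 (compC f i) (dz (compC f i)) (dzb (compC f i)) (dzb (dz (compC f i)))
        b (fun q => conjc (b q)) a c q) = frame3 (compC f i) (dz (compC f i)) (dzb (compC f i)) (dzb (dz (compC f i)))
        b (fun q => conjc (b q)) a c q.
  rewrite /frame3 h3 e3 cE cE' creal (e2 _ Dq) -(e1 _ Dq) conjcK.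
  move: (dzb (dz (compC f i)) q) (a q) (c q) (dz (compC f i) q) (dzb (compC f i) q)
    (b q) (conjc (b q)) (compC f i q) => *; ring.
rewrite mulmx4E !mxE /=.
by move: j => [[|[|[|[|//]]]] ?] /=; rewrite !(mulr0, mulr1, add0r, addr0).
Qed.

Lemma W_unit q : D q -> W q \in unitmx. Proof. exact: (surface_unit openD surf). Qed.

(** [g_1] is the congruence of [J1] by this matrix, the factor [L^-1] of [Fhat] being absorbed by
    [L J1 L^T = J1hat]. *)
Definition Aframe q : 'M[C]_4 := Lmx R *m frame f b zs q.

Lemma frame_unit q : D q -> frame f b zs q \in unitmx.
Proof. by move=> Dq; rewrite unitmx_mul unitmx_inv !W_unit. Qed.

Lemma Aframe_unit q : D q -> Aframe q \in unitmx.
Proof. by move=> Dq; rewrite unitmx_mul Lmx_unit frame_unit. Qed.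

Lemma cmx_frame q : D q -> cmx (frame f b zs q) = swap23 R *m frame f b zs q *m swap23 R.
Proof.
move=> Dq; rewrite /frame cmxM cmxV !cmx_wilczynski // !mulmxA.
have uW := W_unit Dzs; have uWs : W zs *m swap23 R \in unitmx.
  by rewrite unitmx_mul uW swap23_unit.
congr (_ *m _ *m _); apply: (can_inj (mulKmx uWs)).
by rewrite mulmxV // -mulmxA (mulmxA (swap23 R)) swap23K mul1mx mulmxV.
Qed.

Lemma toC_Fhat q : D q -> toC (Fhat f b zs q) = Aframe q *m invmx (Lmx R).
Proof.
move=> Dq; have gen (X : 'M[C]_4) : cmx X = X -> toC (map_mx (@complex.Re R) X) = X.
  move=> /matrixP cX; apply/matrixP => i j; have := cX i j; rewrite !mxE.
  case: (X i j) => x y; rewrite /conjc => -[] /eqP.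
  by rewrite eq_sym -subr_eq0 opprK -mulr2n mulrn_eq0 /= => /eqP ->.
exact: gen (Lmx_real (cmx_frame Dq)).
Qed.

Lemma Lmx_J1 : Lmx R *m J *m (Lmx R)^T = J1hat C.
Proof.
have i2 : iC R * iC R = -1 by rewrite -expr2 sqr_i.
have two0 : 2 != 0 :> C by rewrite pnatr_eq0.
set s := real_complex R (Num.sqrt 2).
have s2 : s * s = 2 by exact: sqrt2_sqr.
rewrite /Lmx -/s; set M := mx4 _.
have MJ : M *m J = mx4 [:: [:: 0; 0; 0; s]; [:: 0; - iC R; iC R; 0];
    [:: 0; 1; 1; 0]; [:: s; 0; 0; 0]].
  apply/matrixP => -[[|[|[|[|//]]]] ?] [[|[|[|[|//]]]] ?]; rewrite mulmx4E !mxE /=;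
  by rewrite !(mul0r, mul1r, mulr0, mulr1, add0r, addr0).
have MJM : M *m J *m M^T = 2 *: J1hat C.
  rewrite MJ; apply/matrixP => -[[|[|[|[|//]]]] ?] [[|[|[|[|//]]]] ?];
    rewrite mulmx4E !mxE /=;
  by rewrite !(mul0r, mul1r, mulr0, mulr1, add0r, addr0, mulrN, mulNr, opprK, i2, s2, subrr, addNr).
have sV : s^-1 * s^-1 * 2 = 1 by rewrite -invfM s2 mulVf.
by rewrite linearZ /= -!scalemxAl -scalemxAr MJM !scalerA sV scale1r.
Qed.

Lemma toC_gauss_map q : D q -> toC (gauss_map1 f b zs q) = Aframe q *m J *m (Aframe q)^T.
Proof.
move=> Dq; rewrite /gauss_map1 !map_mxM -map_trmx toC_Fhat //.
have -> : toC (J1hat R) = Lmx R *m J *m (Lmx R)^T.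
  rewrite Lmx_J1.
  by apply/matrixP => -[[|[|[|[|//]]]] ?] [[|[|[|[|//]]]] ?]; rewrite !mxE /=.
rewrite trmx_mul trmx_inv !mulmxA mulmxKV ?Lmx_unit //.
by rewrite -(mulmxA _ (Lmx R)^T) mulmxV ?unitmx_tr ?Lmx_unit // mulmx1.
Qed.

Lemma isd_Aframe : isdmx D Aframe (fun q => Aframe q *m Umx b p q) (fun q => Aframe q *m Vmx b p q).
Proof.
have dW := isd_wilczynski openD sf cs b0 W_unit.
have := isdmxM openD (isdmx_cst openD (Lmx R *m invmx (W zs))) dW.
by move/(eq_isdmx openD); apply=> q _; rewrite ?mul0mx ?add0r /Aframe /frame !mulmxA.
Qed.

Lemma J_sqr : J *m J = 1%:M.
Proof.
apply/matrixP => -[[|[|[|[|//]]]] ?] [[|[|[|[|//]]]] ?]; rewrite mulmx4E !mxE /=;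
by rewrite !(mul0r, mul1r, mulr0, mulr1, add0r, addr0).
Qed.

(** [X J + J X^T] measures how far [X] is from preserving [J]. Consequently the [k]-part drops out
    when [A J A^T] is differentiated. *)
Lemma p_part_J (X Y : 'M[C]_4) : Defs.p_part X = Y -> X *m J + J *m X^T = 2 *: (Y *m J).
Proof.
move=> <-; rewrite /Defs.p_part /tau1 opprK -scalemxAl scalerA mulfV ?pnatr_eq0 // scale1r.
by rewrite mulmxDl -(mulmxA _ J J) J_sqr mulmx1.
Qed.

Lemma U_J q : Umx b p q *m J + J *m (Umx b p q)^T = 2 *: (Uoff b p q *m J).
Proof. by apply: p_part_J; have [] := Uparts b p q. Qed.

Lemma V_J q : Vmx b p q *m J + J *m (Vmx b p q)^T = 2 *: (Voff b p q *m J).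
Proof. by apply: p_part_J; have [] := Vparts b p q. Qed.

Definition Gz q : 'M[C]_4 := 2 *: (Aframe q *m Uoff b p q *m J *m (Aframe q)^T).
Definition Gb q : 'M[C]_4 := 2 *: (Aframe q *m Voff b p q *m J *m (Aframe q)^T).

Let congrJ (A X Y : 'M[C]_4) : X *m J + J *m X^T = 2 *: (Y *m J) ->
  A *m X *m J *m A^T + A *m J *m (A *m X)^T = 2 *: (A *m Y *m J *m A^T).
Proof.
move=> E; rewrite trmx_mul !mulmxA -mulmxDl -!(mulmxA A) -mulmxDr E.
by rewrite -scalemxAr -scalemxAl !mulmxA.
Qed.

Lemma isd_gauss_map : isdmx D (fun q => toC (gauss_map1 f b zs q)) Gz Gb.
Proof.
have dA := isd_Aframe.
have := isdmxM openD (isdmxM openD dA (isdmx_cst openD J)) (isdmxT openD dA).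
move/(eq_isdmx openD); apply=> q Dq; first by rewrite toC_gauss_map.
  by rewrite mulmx0 addr0; apply: congrJ; exact: U_J.
by rewrite mulmx0 addr0; apply: congrJ; exact: V_J.
Qed.

(** Writing [J V^T] as [(2 V1 - V) J] brings everything to the left of [J]: the diagonal part [V0]
    then acts by a commutator, the off-diagonal part [V1] by an anticommutator. *)
Let Gzb_alg (A U1 U1b V V0 V1 : 'M[C]_4) : V = V0 + V1 ->
  V *m J + J *m V^T = 2 *: (V1 *m J) ->
  (A *m V *m U1 + A *m U1b) *m J *m A^T + A *m U1 *m J *m (A *m V)^T =
  A *m (U1b + (V0 *m U1 - U1 *m V0) + (V1 *m U1 + U1 *m V1)) *m J *m A^T.
Proof.
move=> VE E.
have E' : J *m V^T = (2 *: V1 - V) *m J.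
  by rewrite mulmxBl -scalemxAl -E addrC addKr.
rewrite trmx_mul mulmxA -(mulmxA _ J V^T) E' !mulmxA -mulmxDl; congr (_ *m _).
rewrite -mulmxDl; congr (_ *m _); rewrite -!(mulmxA A) -!mulmxDr; congr (_ *m _).
rewrite VE !(mulmxDl, mulmxDr, mulmxN) -scalemxAr.
move: (V0 *m U1) (V1 *m U1) (U1 *m V0) (U1 *m V1) => m1 m2 m3 m4.
apply/matrixP => i j; rewrite !mxE.
by move: (m1 i j) (m2 i j) (m3 i j) (m4 i j) (U1b i j) => *; ring.
Qed.

Definition Gzb q : 'M[C]_4 := 2 *: (Aframe q *m (EU b p q
  + (Voff b p q *m Uoff b p q + Uoff b p q *m Voff b p q)) *m J *m (Aframe q)^T).

Lemma isd_Gz : exists Gzz, isdmx D Gz Gzz Gzb.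
Proof.
have dA := isd_Aframe; have dU := isd_Uoff openD surf.
have d1 := isdmxM openD (isdmxM openD (isdmxM openD dA dU) (isdmx_cst openD J)) (isdmxT openD dA).
have d2 := isdmxZ openD 2 d1.
eexists; apply: (eq_isdmx openD d2) => [//|q Dq|q Dq]; first by reflexivity.
rewrite mulmx0 addr0 /Gzb; congr (_ *: _).
by apply: Gzb_alg; [exact: VmxE|exact: V_J].
Qed.

Lemma isd_Gb : exists Gbz Gbb, isdmx D Gb Gbz Gbb.
Proof.
have dA := isd_Aframe; have dV := isd_Voff openD surf.
have d1 := isdmxM openD (isdmxM openD (isdmxM openD dA dV) (isdmx_cst openD J)) (isdmxT openD dA).
by eexists; eexists; exact: (isdmxZ openD 2 d1).
Qed.

Let inv_congr (K A : 'M[C]_4) : K *m K = 1%:M -> A \in unitmx ->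
  invmx (A *m K *m A^T) = invmx A^T *m K *m invmx A.
Proof.
move=> KK uA; have uK : K \in unitmx by case: (mulmx1_unit KK).
have uT : A^T \in unitmx by rewrite unitmx_tr.
have uG : A *m K *m A^T \in unitmx by rewrite !unitmx_mul uT uA uK.
apply: (can_inj (mulKmx uG)); rewrite mulmxV // !mulmxA mulmxK //.
by rewrite -(mulmxA A) KK mulmx1 mulmxV.
Qed.

Let prod_alg (K A X Y : 'M[C]_4) : K *m K = 1%:M -> A \in unitmx ->
  (2 *: (A *m X *m K *m A^T)) *m invmx (A *m K *m A^T) *m (2 *: (A *m Y *m K *m A^T)) =
  4 *: (A *m (X *m Y) *m K *m A^T).
Proof.
move=> KK uA; have uT : A^T \in unitmx by rewrite unitmx_tr.
have core : A *m X *m K *m A^T *m (invmx A^T *m K *m invmx A) *m (A *m Y *m K *m A^T) =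
    A *m (X *m Y) *m K *m A^T.
  move: (A *m X) (A *m (X *m Y)) (mulmxA A X Y) => AX AXY ->.
  have -> : AX *m K *m A^T *m (invmx A^T *m K *m invmx A) = AX *m invmx A.
    by rewrite 2!mulmxA (mulmxK uT) -(mulmxA AX K K) KK mulmx1.
  by rewrite 3!mulmxA (mulmxKV uA).
rewrite (inv_congr KK uA) -scalemxAl -scalemxAl -scalemxAr core scalerA.
by rewrite -natrM.
Qed.

(** The anticommutator in [g_{z zb}] is the same combination of products as in the connection term,
    with factors [4 * 2] and [2 * 4], so that only [E] survives. *)
Let tension_alg (K A E X Y : 'M[C]_4) : K *m K = 1%:M -> A \in unitmx ->
  4 *: (2 *: (A *m (E + (Y *m X + X *m Y)) *m K *m A^T))
  - 2 *: ((2 *: (A *m X *m K *m A^T)) *m invmx (A *m K *m A^T) *m (2 *: (A *m Y *m K *m A^T))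
    + (2 *: (A *m Y *m K *m A^T)) *m invmx (A *m K *m A^T) *m (2 *: (A *m X *m K *m A^T))) =
  8 *: (A *m E *m K *m A^T).
Proof.
move=> KK uA; rewrite (prod_alg X Y KK uA) (prod_alg Y X KK uA).
move: (X *m Y) (Y *m X) => XY YX.
rewrite !mulmxDr !mulmxDl.
move: (A *m E *m K *m A^T) (A *m YX *m K *m A^T) (A *m XY *m K *m A^T) => m1 m2 m3.
apply/matrixP => i j; rewrite !mxE.
by move: (m1 i j) (m2 i j) (m3 i j) => *; ring.
Qed.

Lemma tension_gauss_map q : D q ->
  toC (tension (@Gam0 R) (gauss_map1 f b zs) q) =
  8 *: (Aframe q *m EU b p q *m J *m (Aframe q)^T).
Proof.
move=> Dq; have [Gzz dGz] := isd_Gz; have [Gbz [Gbb dGb]] := isd_Gb.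
apply: (etrans (toC_tension openD isd_gauss_map dGz dGb Dq)).
rewrite (toC_gauss_map Dq); exact: tension_alg J_sqr (Aframe_unit Dq).
Qed.

Lemma tension0P q : D q ->
  tension (@Gam0 R) (gauss_map1 f b zs) q = 0 <-> holP b p q.
Proof.
move=> Dq; split=> [T0|/(EU0P openD surf Dq) E0].
  apply/(EU0P openD surf Dq).
  have := tension_gauss_map Dq; rewrite T0 map_mx0 => /esym/eqP.
  rewrite scaler_eq0 pnatr_eq0 /= => /eqP.
  have uA := Aframe_unit Dq; have uJ : J \in unitmx by case: (mulmx1_unit J_sqr).
  move=> /(congr1 (fun M => invmx (Aframe q) *m (M *m invmx (Aframe q)^T *m invmx J))).
  by rewrite mulmxK ?unitmx_tr // mulmxK // mulKmx // !mul0mx mulmx0.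
apply: toC_inj; rewrite tension_gauss_map // E0 map_mx0.
by rewrite !(mulmx0, mul0mx) scaler0.
Qed.

(** [U] and [V] are trace-free, so by Jacobi's formula the determinant is constant on the connected
    domain, and it is one at [zs]. *)
Lemma det_frame q : D q -> \det (frame f b zs q) = 1.
Proof.
move=> Dq.
have dF : isdmx D (frame f b zs) (fun q => frame f b zs q *m Umx b p q)
    (fun q => frame f b zs q *m Vmx b p q).
  have dW := isd_wilczynski openD sf cs b0 W_unit.
  have := isdmxM openD (isdmx_cst openD (invmx (W zs))) dW.
  by move/(eq_isdmx openD); apply=> r _; rewrite ?mul0mx ?add0r /frame ?mulmxA.
have tr4 (A : 'M[C]_4) : \tr A = A ord0 ord0 + (A (lift ord0 ord0) (lift ord0 ord0)
    + (A (lift ord0 (lift ord0 ord0)) (lift ord0 (lift ord0 ord0))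
    + A (lift ord0 (lift ord0 (lift ord0 ord0))) (lift ord0 (lift ord0 (lift ord0 ord0))))).
  by rewrite /mxtrace !big_ord_recl big_ord0 addr0.
have trU r : \tr (Umx b p r) = 0.
  rewrite tr4 /Umx !mxE /=; move: (_ / _) => x; ring.
have trV r : \tr (Vmx b p r) = 0.
  rewrite tr4 /Vmx !mxE /=; move: (_ / _) => x; ring.
have tr0 (F X : 'M[C]_4) : \tr X = 0 -> \tr (F *m X *m \adj F) = 0.
  by move=> tX; rewrite mxtrace_mulC mulmxA mul_adj_mx mul_scalar_mx mxtraceZ tX mulr0.
have d0 : isd D (fun q => \det (frame f b zs q)) (fun=> 0) (fun=> 0).
  by apply: (eq_isd openD (isd_det openD dF)) => // r _; rewrite tr0.
rewrite (isd_constant openD connD d0 Dzs Dq) /frame mulVmx ?W_unit //.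
exact: det1.
Qed.

Lemma Qspace_gauss_map q : D q -> Qspace (gauss_map1 f b zs q).
Proof.
move=> Dq; apply: Qspace_congr; first exact: Qspace_J1hat.
apply: (@complexI R); rewrite -[LHS](det_map_mx (real_complex R)) toC_Fhat // rmorph1.
rewrite /Aframe det_mulmx (det_mulmx (Lmx R)) det_frame // mulr1 -det_mulmx mulmxV ?Lmx_unit //.
exact: det1.
Qed.

Let trace_alg (K A X : 'M[C]_4) : K *m K = 1%:M -> A \in unitmx -> \tr X = 0 ->
  \tr (invmx (A *m K *m A^T) *m (2 *: (A *m X *m K *m A^T))) = 0.
Proof.
move=> KK uA tX; have uT : A^T \in unitmx by rewrite unitmx_tr.
rewrite (inv_congr KK uA) -scalemxAr mxtraceZ mxtrace_mulC !mulmxA mulmxK //.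
by rewrite -(mulmxA (A *m X) K K) KK mulmx1 mxtrace_mulC mulKmx // tX mulr0.
Qed.

Let sym_comb (A B : 'M[C]_4) x y :
  A^T = A -> B^T = B -> (x *: A + y *: B)^T = x *: A + y *: B.
Proof. by move=> sA sB; rewrite linearD !linearZ /= sA sB. Qed.

Let tr_comb (M A B : 'M[C]_4) x y :
  \tr (M *m A) = 0 -> \tr (M *m B) = 0 -> \tr (M *m (x *: A + y *: B)) = 0.
Proof. by move=> tA tB; rewrite mulmxDr -!scalemxAr mxtraceD !mxtraceZ tA tB !mulr0 addr0. Qed.

Let toC_trace (M X : 'M[R]_4) :
  real_complex R (\tr (invmx M *m X)) = \tr (invmx (toC M) *m toC X).
Proof.
rewrite -map_invmx -map_mxM /mxtrace rmorph_sum.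
by apply: eq_bigr => r _; rewrite [RHS]mxE.
Qed.

(** Uniqueness of the connection concerns tangent vectors, so tangency has to be checked. Symmetry
    follows by differentiating [g^T = g], and the trace condition reduces to the zero traces of
    [Uoff] and [Voff]. *)
Lemma tangent_gauss_map q (i : 'I_2) : D q ->
  Qtangent (gauss_map1 f b zs q) ('D_(dir R i) (gauss_map1 f b zs) q).
Proof.
move=> Dq; have dg := isd_gauss_map.
have [gx gy] := toC_derive openD dg Dq.
have symG : (Gz q)^T = Gz q /\ (Gb q)^T = Gb q.
  apply: (isdmx_uniq (isdmxT openD dg) _ Dq); apply: (eq_isdmx openD dg) => // r Dr.
  by rewrite map_trmx; have [-> _ _] := Qspace_gauss_map Dr.
have uA := Aframe_unit Dq.
have trG (X : 'M[C]_4) : \tr X = 0 ->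
    \tr (invmx (Aframe q *m J *m (Aframe q)^T) *m (2 *: (Aframe q *m X *m J *m (Aframe q)^T))) = 0.
  move=> tX.
  exact: trace_alg J_sqr uA tX.
have trU : \tr (Uoff b p q) = 0 by rewrite /mxtrace !big_ord_recl big_ord0 !mxE /= !addr0.
have trV : \tr (Voff b p q) = 0 by rewrite /mxtrace !big_ord_recl big_ord0 !mxE /= !addr0.
have trGz : \tr (invmx (toC (gauss_map1 f b zs q)) *m Gz q) = 0.
  by rewrite (toC_gauss_map Dq); exact: (trG _ trU).
have trGb : \tr (invmx (toC (gauss_map1 f b zs q)) *m Gb q) = 0.
  by rewrite (toC_gauss_map Dq); exact: (trG _ trV).
have key (X : 'M[R]_4) (x y : C) : toC X = x *: Gz q + y *: Gb q -> Qtangent (gauss_map1 f b zs q) X.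
  move=> XE; split.
    by have [sz sb] := symG; apply: toC_inj; rewrite -map_trmx XE; exact: sym_comb.
  apply: (@complexI R); rewrite rmorph0.
  apply: (etrans (toC_trace _ _)); rewrite XE; exact: (tr_comb _ _ trGz trGb).
rewrite /dir; case: ifP => _.
  apply: (key _ 1 1); exact: (etrans gx (congr2 +%R (esym (scale1r _)) (esym (scale1r _)))).
by apply: (key _ (iC R) (- iC R)); rewrite gy scalerBr scaleNr.
Qed.

Lemma harmonic_holP :
  harmonic_into_Q D (gauss_map1 f b zs) <-> forall q, D q -> holP b p q.
Proof.
split=> [[_ _ [Gam [lc T0]]] q Dq|hol].
  apply/(tension0P Dq); rewrite -(T0 q Dq); apply: esym.
  by apply: tension_Gam0 => //; [exact: Qspace_gauss_map|move=> i; exact: tangent_gauss_map].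
split; first exact: (smooth_toC openD isd_gauss_map).
  by move=> q; exact: Qspace_gauss_map.
exists (@Gam0 R); split; first exact: levi_civita_Gam0.
by move=> q Dq; apply/(tension0P Dq); exact: hol.
Qed.

End HarmonicGaussMap.

Theorem theorem5p2 (R : realType) (D : set (R * R)) (zs : R * R)
    (f : R * R -> 'cV[R]_4) (b p : R * R -> R[i])
    (openD : open D) (simplyD : simply_connected D) (Dzs : D zs)
    (surf : definite_surface D f b p) :
  [<-> demoulin D b p \/ (projective_minimal D b p /\ coincidence D b);
       harmonic_into_Q D (gauss_map1 f b zs);
       forall lam : R[i], `|lam| = 1 -> flat_connection D (alpha b p lam)].
Proof.
have [connD _] := simplyD.
have cls := class_holP openD connD surf Dzs.
have har := harmonic_holP openD connD surf Dzs.
have flt := flat_holP openD surf.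
split; first by move/cls/har.
split; first by move/har/flt.
by move/flt/cls.
Qed.
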